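(* Let $r\ge1$, let $w\in F_r$ be a word of length $\ell\ge1$, let $0<\beta<1$, and let $\mathsf{G}_1,\ldots,\mathsf{G}_r$ be independent, Haar-distributed random variables in $\mathrm{U}_n$. For every $\epsilon>0$ and every $n>\max\left\{\frac{4\ell}{1-\beta},\frac{8}{1-\beta},16\right\}$, $$\mathbb{P}\left(w(\mathsf{G}_1,\ldots,\mathsf{G}_r)\text{ fails to be }(\beta,\epsilon)\text{-spread}\right)<2^{3n^2}\epsilon^{\frac{n^2(1-\beta)^2}{4(\ell+1)}}.$$
   Context: $F_r$ is the free group on $x_1,\ldots,x_r$; words are assumed reduced, and $w(\mathsf{G}_1,\ldots,\mathsf{G}_r)$ is obtained by substituting $x_i\leftarrow\mathsf{G}_i$ in $w$. For $0<\beta<1$ and $\epsilon>0$, an element $g\in\mathrm{U}_n$ is $(\beta,\epsilon)$-spread if at most $(1-\beta)n$ of the eigenvalues of $g$ (counted with multiplicity) lie in any arc of diameter $2\epsilon$ of the unit circle $\mathrm{U}_1$, the diameter of an arc being its arc length (angle). *)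

(* Defs.v *)
From HB Require Import structures.
From mathcomp Require Import all_boot all_order all_algebra spectral complex.
From mathcomp Require Import all_classical all_reals all_analysis.

Set Implicit Arguments.
Unset Strict Implicit.
Unset Printing Implicit Defensive.

Import Order.TTheory GRing.Theory Num.Theory.
Import numFieldTopology.Exports.

Local Open Scope classical_set_scope.
Local Open Scope ring_scope.
Local Open Scope complex_scope.

(* The usual topology of the complex plane, given by the norm of [R[i]]; the
   library only provides it on the alias [R[i]^o]. *)
HB.instance Definition _ (R : realType) :=
  PseudoPointedMetric.copy R[i] (R[i]^o).

Record unitary (R : realType) (n : nat) := Unitary {
  unitary_mx :> 'M[R[i]]_n ;
  unitary_mxP : unitary_mx \is unitarymx }.

Section UnitaryGroup.
Variables (R : realType) (n : nat).
Local Notation U := (unitary R n).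

HB.instance Definition _ := [isSub for @unitary_mx R n].
HB.instance Definition _ := [Choice of U by <:].

Fact unitary_one_subproof : @scalar_mx R[i] n 1 \is unitarymx.
Proof. by apply/unitarymxP; rewrite trmx1 map_mx1 mulmx1. Qed.

Fact unitary_inv_subproof (g : U) : invmx (unitary_mx g) \is unitarymx.
Proof. by rewrite invmx_unitary ?trmxC_unitary unitary_mxP. Qed.

Fact unitary_mul_subproof (g h : U) : (unitary_mx g) *m h \is unitarymx.
Proof. by rewrite mul_unitarymx ?unitary_mxP. Qed.

Definition unitary_one : U := Unitary unitary_one_subproof.
Definition unitary_inv (g : U) : U := Unitary (unitary_inv_subproof g).
Definition unitary_mul (g h : U) : U := Unitary (unitary_mul_subproof g h).

Fact unitary_mulA : associative unitary_mul.
Proof. by move=> g h k; apply: val_inj; rewrite /= mulmxA. Qed.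

Fact unitary_mul1 : left_id unitary_one unitary_mul.
Proof. by move=> g; apply: val_inj; rewrite /= mul1mx. Qed.

Fact unitary_mulr1 : right_id unitary_one unitary_mul.
Proof. by move=> g; apply: val_inj; rewrite /= mulmx1. Qed.

Fact unitary_mulV : left_inverse unitary_one unitary_inv unitary_mul.
Proof.
by move=> g; apply: val_inj; rewrite /= mulVmx ?unitarymx_unit ?unitary_mxP.
Qed.

Fact unitary_mulrV : right_inverse unitary_one unitary_inv unitary_mul.
Proof.
by move=> g; apply: val_inj; rewrite /= mulmxV ?unitarymx_unit ?unitary_mxP.
Qed.

HB.instance Definition _ := isGroup.Build U unitary_mulA unitary_mul1
  unitary_mulr1 unitary_mulV unitary_mulrV.

HB.instance Definition _ := isPointed.Build U unitary_one.

HB.instance Definition _ := Topological.copy U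
  (initial_topology (val : U -> 'M[R[i]]_n)).
HB.instance Definition _ := Measurable.copy U
  (g_sigma_algebraType (@open U)).

End UnitaryGroup.

(* On the compact group U_n, the Haar measure is the unique left-invariant
   Borel probability measure. *)
Definition is_haar (R : realType) (n : nat)
    (mu : probability (unitary R n) R) : Prop :=
  forall (g : unitary R n) (A : set (unitary R n)), measurable A ->
    mu [set (g * h)%g | h in A] = mu A.

Definition mutually_independent d d' (T : measurableType d)
    (T' : measurableType d') (R : realType) (P : probability T R)
    (I : finType) (X : I -> {RV P >-> T'}) : Prop :=
  forall (J : {set I}) (A : I -> set T'),
    (forall i, i \in J -> measurable (A i)) ->
    P (\bigcap_(i in [set` J]) (X i @^-1` A i)) =
    (\prod_(i in J) P (X i @^-1` A i))%E.

(* [(i, false)] is the letter x_i and [(i, true)] its inverse; the elements of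
   the free group F_r are represented by the reduced words. *)
Definition word (r : nat) := seq ('I_r * bool).

Definition reduced (r : nat) (w : word r) : bool :=
  sorted (fun a b => ~~ ((a.1 == b.1) && (a.2 != b.2))) w.

Definition eval_word (r : nat) (H : groupType) (w : word r) (g : 'I_r -> H)
    : H :=
  (\prod_(a <- w) if a.2 then (g a.1)^-1 else g a.1)%g.

Definition eigenvalues (R : realType) (n : nat) (A : 'M[R[i]]_n) : seq R[i] :=
  sval (closed_field_poly_normal (char_poly A)).

(* The closed arc of length [a] starting at e^(i t), in the positive
   direction; it is the whole circle when a >= 2 pi. *)
Definition circle_arc (R : realType) (t a : R) : set R[i] :=
  [set cos (t + s) +i* sin (t + s) | s in `[0, a]%classic].

Definition spread (R : realType) (n : nat) (beta eps : R) (g : unitary R n)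
    : Prop :=
  forall t : R,
    (count (mem (circle_arc t (2 * eps))) (eigenvalues g))%:R <= (1 - beta) * n%:R.

(* Main.v *)
Require Import Defs.
From HB Require Import structures.
From mathcomp Require Import all_boot all_order all_algebra spectral complex.
From mathcomp Require Import all_classical all_reals all_analysis.
From mathcomp Require Import measurable_realfun.
From mathcomp Require Import zify ring lra.

Import Order.TTheory GRing.Theory Num.Theory.
Import numFieldNormedType.Exports.
Local Open Scope classical_set_scope.
Local Open Scope ring_scope.

Set Implicit Arguments.
Unset Strict Implicit.
Unset Printing Implicit Defensive.

(** Call a tuple [g] bad when [A = w(g)] is not spread.  Then more than
    [M = (1 - beta) * n] eigenvalues of [A] are at distance at most [eps] from one
    point [z] of the unit circle, so that [A - z] multiplies lengths by at most
    [eps] on a space of dimension [m > M].  The proof compares two estimates of one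
    negative moment, attached to the images under [A] of [k] orthonormal vectors,
    with [k] close to [M / (2 * (l + 1))].

    The upper estimate.  Apply the letters of [w] one after the other to the first
    [k] basis vectors, and consider the squared distance of each of the resulting
    vectors from the span of all the previous ones.  Given the past, the next letter
    is a Haar unitary conditioned on the images of the vectors to which it was
    applied before.  The new vector is thus the sum of a known vector and of a
    vector of known length and uniform direction; as [w] is reduced, the latter is
    at least as long as the distance of the vector to which the letter is applied
    from the span of those that come before it ([fresh_domain], [fresh_range]).
    The negative moment of order [al = n - k * (l + 1)] of the squared length of a
    projection of a uniform unit vector is at most [2 ^ n], provided that the rank
    of the projection exceeds [al] ([projection_upper]).  Hence the product of the
    last [k] squared distances, the [potential], has a negative moment of order
    [al] of at most [2 ^ (n * k * l)] ([int_potential]).  The basis vectors belong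
    to the past, so this product is at most the product of the squared lengths of
    the vectors [e (A - z)], where [e] runs through the [k] basis vectors, whatever
    [z] is ([potential_end]).

    The lower estimate.  The law of [g] is invariant under simultaneous conjugation
    by an independent Haar unitary, which replaces the basis vectors by a random
    frame.  When [g] is bad, the squared length of [xi (A - z)], for a random unit
    vector [xi], is of order [eps ^ 2] when [xi] is at distance [eps] from the
    nearly null space, an event whose probability is about [eps ^ (2 * (n - m))];
    its negative moment of order [al] is therefore at least of the order of
    [eps ^ (- 2 * (al - (n - m) - 1))] ([projection_lower], [int_nearly_null]).
    The vectors of the frame can be revealed one at a time, and contribute [k] such
    factors ([int_frame]).  By Markov's inequality the probability of the bad
    tuples is at most the quotient of the two estimates ([prob_nearly_null]), and
    the choice of [k] makes the exponent of [eps] large enough ([exponent_lower]).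

    Two devices keep the probability theory elementary.  Instead of conditional
    laws, [kap D] is a measurable map onto the stabilizer of the vectors of [D] that
    commutes with left translations by that stabilizer; it carries the Haar measure
    to the law of a unitary conditioned on fixing [D], and conditioning becomes an
    application of Fubini's theorem and of invariance ([int_kap_reveal_left],
    [int_kap_reveal_right]).  Instead of densities on the sphere, the negative
    moments of projections are compared with each other by an integration by parts
    that expresses the invariance under reflections ([stein_sphere]). *)

(** * Row vectors, projectors and reflections *)

Section RowVectors.
Variable R : realType.
Local Notation C := R[i].
Local Open Scope complex_scope.
Local Open Scope sesquilinear_scope.
Local Notation conjC := Num.Def.conjC.

Lemma adjM m n p (A : 'M[C]_(m, n)) (B : 'M[C]_(n, p)) :
  (A *m B)^t* = B^t* *m A^t*.
Proof. by rewrite trmx_mul map_mxM. Qed.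

Lemma adjD m n (A B : 'M[C]_(m, n)) : (A + B)^t* = A^t* + B^t*.
Proof. by rewrite linearD map_mxD. Qed.

Lemma adjB m n (A B : 'M[C]_(m, n)) : (A - B)^t* = A^t* - B^t*.
Proof. by rewrite linearB map_mxB. Qed.

Lemma adjZ m n c (A : 'M[C]_(m, n)) : (c *: A)^t* = conjC c *: A^t*.
Proof. by rewrite linearZ map_mxZ. Qed.

Lemma adj1 n : (1%:M : 'M[C]_n)^t* = 1%:M.
Proof. by rewrite trmx1 map_mx1. Qed.

Lemma adj0 m n : (0 : 'M[C]_(m, n))^t* = 0.
Proof. by rewrite trmx0 map_mx0. Qed.

Lemma conjCE (z : C) : conjC z = conjc z.
Proof.
apply/eqP; rewrite -subr_eq0; apply/eqP.
have [-> | z0] := eqVneq z 0; first by rewrite conjC0 conjc0 subr0.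
apply: (mulfI z0); rewrite mulr0 mulrBr -normCK.
case: z z0 => a b _; apply/eqP; rewrite subr_eq0; apply/eqP.
by rewrite /Num.norm /= -rmorphXn /= sqr_sqrtr ?addr_ge0 ?sqr_ge0.
Qed.

Lemma conjC_real (x : R) : conjC (x%:C) = x%:C :> C.
Proof. by rewrite conjCE conjc_real. Qed.

Definition sqn n (v : 'rV[C]_n) : R :=
  \sum_j (complex.Re (v 0 j) ^+ 2 + complex.Im (v 0 j) ^+ 2).

Lemma mul_conjC (z : C) :
  z * conjC z = (complex.Re z ^+ 2 + complex.Im z ^+ 2)%:C.
Proof.
rewrite conjCE; case: z => a b; rewrite -[LHS]/((_ +i* _)%C) /=.
by congr (_ +i* _); ring.
Qed.

Lemma sqnE n (v : 'rV[C]_n) : v *m v^t* = (sqn v)%:C%:M.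
Proof.
apply/rowP=> i; rewrite !ord1 !mxE eqxx mulr1n /sqn rmorph_sum /=.
by apply: eq_bigr => j _; rewrite !mxE mul_conjC.
Qed.

Lemma sqn_ge0 n (v : 'rV[C]_n) : 0 <= sqn v.
Proof. by apply: sumr_ge0 => j _; rewrite addr_ge0 ?sqr_ge0. Qed.

Lemma sqn_eq0 n (v : 'rV[C]_n) : (sqn v == 0) = (v == 0).
Proof.
apply/eqP/eqP => [|->]; last first.
  by rewrite /sqn big1 // => j _; rewrite mxE /= expr0n /= addr0.
move=> /eqP; rewrite psumr_eq0 => [|j _]; last by rewrite addr_ge0 ?sqr_ge0.
move=> /allP h; apply/rowP => j; rewrite mxE.
have /implyP/(_ isT) := h j (mem_index_enum _).
rewrite paddr_eq0 ?sqr_ge0 // !sqrf_eq0 => /andP[/eqP ha /eqP hb].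
by apply/eqP; rewrite eq_complex ha hb !eqxx.
Qed.

Lemma sqn0 n : sqn (0 : 'rV[C]_n) = 0.
Proof. by apply/eqP; rewrite sqn_eq0. Qed.

Lemma scalar1_inj (x y : R) : (x%:C%:M : 'M[C]_1) = y%:C%:M -> x = y.
Proof. by move=> /rowP/(_ 0); rewrite !mxE eqxx !mulr1n => -[]. Qed.

Lemma sqn_unitary m n (v : 'rV[C]_m) (u : 'M[C]_(m, n)) : u \is unitarymx ->
  sqn (v *m u) = sqn v.
Proof.
move=> /unitarymxP uu; apply: scalar1_inj; rewrite -!sqnE adjM mulmxA.
by rewrite -[v *m u *m _]mulmxA uu mulmx1.
Qed.

Lemma pythagoras n (v w : 'rV[C]_n) : v *m w^t* = 0 ->
  sqn (v + w) = sqn v + sqn w.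
Proof.
move=> vw0; have wv0 : w *m v^t* = 0.
  by rewrite -[w]trmxCK -adjM vw0 adj0.
apply: scalar1_inj; rewrite -!sqnE adjD mulmxDl !mulmxDr vw0 wv0.
by rewrite addr0 add0r !sqnE rmorphD raddfD.
Qed.

Lemma sqnZ n (c : C) (v : 'rV[C]_n) :
  sqn (c *: v) = (complex.Re c ^+ 2 + complex.Im c ^+ 2) * sqn v.
Proof.
apply: scalar1_inj; rewrite -sqnE adjZ -scalemxAl -scalemxAr scalerA.
by rewrite mul_conjC sqnE rmorphM scale_scalar_mx.
Qed.

Lemma sqnN n (v : 'rV[C]_n) : sqn (- v) = sqn v.
Proof.
by rewrite -scaleN1r sqnZ /= sqrrN expr1n oppr0 expr0n /= addr0 mul1r.
Qed.

(** ** Orthogonal projectors *)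

Definition projector n (P : 'M[C]_n) := P *m P = P /\ P^t* = P.

Lemma projector0 n : projector (0 : 'M[C]_n).
Proof. by split; rewrite ?mul0mx ?adj0. Qed.

Lemma projectorC n (P : 'M[C]_n) : projector P -> projector (1%:M - P).
Proof.
move=> [PP Ps]; split; last by rewrite adjB adj1 Ps.
by rewrite mulmxBl mul1mx mulmxBr mulmx1 PP subrr subr0.
Qed.

Lemma projector_conj n (P u : 'M[C]_n) : u \is unitarymx -> projector P ->
  projector (u *m P *m u^t*).
Proof.
move=> uU [PP Ps]; split; last by rewrite !adjM trmxCK Ps mulmxA.
by rewrite !mulmxA mulmxKtV // -[_ *m P *m P]mulmxA PP.
Qed.

Lemma sqn_projector n (P : 'M[C]_n) (v : 'rV[C]_n) : projector P ->
  sqn v = sqn (v *m P) + sqn (v *m (1%:M - P)).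
Proof.
move=> [PP Ps]; rewrite -pythagoras.
  by rewrite mulmxBr mulmx1 addrC subrK.
rewrite adjM adjB adj1 Ps mulmxA -[v *m P *m _]mulmxA mulmxBr mulmx1 PP subrr.
by rewrite mulmx0 mul0mx.
Qed.

Lemma sqn_projector_le n (P : 'M[C]_n) (v : 'rV[C]_n) : projector P ->
  sqn (v *m P) <= sqn v.
Proof. by move=> hP; rewrite (sqn_projector v hP) lerDl sqn_ge0. Qed.

(** The projector onto the span of a list of row vectors, obtained by adding
    the vectors one at a time.  Since the inverse of 0 is 0, a vector which
    depends on the previous ones changes nothing, and the entries of the
    projector are measurable functions of the vectors, without case analysis. *)
Fixpoint prs n (s : seq 'rV[C]_n) : 'M[C]_n :=
  if s is v :: s' then
    let y := v *m (1%:M - prs s') in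
    prs s' + (sqn y)^-1%:C *: (y^t* *m y)
  else 0.

Lemma mul_rank1 n (y : 'rV[C]_n) :
  (y^t* *m y) *m (y^t* *m y) = (sqn y)%:C *: (y^t* *m y).
Proof.
by rewrite mulmxA -[_ *m y *m _]mulmxA sqnE -mulmxA mul_scalar_mx -scalemxAr.
Qed.

Lemma sqn_invK n (y : 'rV[C]_n) :
  (sqn y)^-1%:C *: (y *m y^t* *m y) = y.
Proof.
rewrite sqnE mul_scalar_mx scalerA -rmorphM /=.
have [y0|y0] := eqVneq (sqn y) 0; last by rewrite mulVf // scale1r.
by move: y0 => /eqP; rewrite sqn_eq0 => /eqP ->; rewrite scaler0.
Qed.

Lemma prs_projector n (s : seq 'rV[C]_n) : projector (prs s).
Proof.
elim: s => [|v s [PP Ps]] /=; first exact: projector0.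
set y := v *m _; set P := prs s in PP Ps y *.
have yP : y *m P = 0.
  by rewrite /y -mulmxA mulmxBl mul1mx PP subrr mulmx0.
have Py : P *m y^t* = 0 by rewrite -{1}Ps -adjM yP adj0.
split.
  have PE : P *m (y^t* *m y) = 0 by rewrite mulmxA Py mul0mx.
  have EP : (y^t* *m y) *m P = 0 by rewrite -mulmxA yP mulmx0.
  rewrite mulmxDl !mulmxDr PP -!scalemxAl -!scalemxAr mul_rank1 PE EP.
  rewrite !scaler0 addr0 add0r !scalerA -!rmorphM.
  congr (_ + _%:C *: _).
  by have [->|y0] := eqVneq (sqn y) 0; rewrite ?invr0 ?mul0r // mulfVK.
by rewrite adjD Ps adjZ conjC_real adjM trmxCK.
Qed.

Lemma mul_prs n (s : seq 'rV[C]_n) v : v \in s -> v *m prs s = v.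
Proof.
elim: s => [//|w s ih] /=; set y := w *m _; set P := prs s in ih y *.
have [PP Ps] : projector P by exact: prs_projector.
have yP : y *m P = 0.
  by rewrite /y -mulmxA mulmxBl mul1mx PP subrr mulmx0.
have Py : P *m y^t* = 0 by rewrite -{1}Ps -adjM yP adj0.
rewrite inE => /predU1P[->|/ih vP].
  have -> : w = w *m P + y by rewrite /y mulmxBr mulmx1 addrC subrK.
  clearbody y; have wPP : w *m P *m P = w *m P by rewrite -mulmxA PP.
  have wPy : w *m P *m y^t* = 0 by rewrite -mulmxA Py mulmx0.
  rewrite mulmxDl !mulmxDr -!scalemxAr wPP yP !mulmxA wPy mul0mx scaler0 addr0.
  by rewrite add0r sqn_invK.
have vy : v *m y^t* = 0 by rewrite -vP -mulmxA Py mulmx0.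
by rewrite mulmxDr vP -scalemxAr mulmxA vy mul0mx scaler0 addr0.
Qed.

Lemma prs_annihilate n m (s : seq 'rV[C]_n) (X : 'M[C]_(n, m)) :
  (forall v, v \in s -> v *m X = 0) -> prs s *m X = 0.
Proof.
elim: s => [_|w s ih h] /=; first by rewrite mul0mx.
have PX : prs s *m X = 0 by apply: ih => v vs; apply: h; rewrite inE vs orbT.
rewrite mulmxDl PX add0r -scalemxAl -[_ *m X]mulmxA -[w *m _ *m X]mulmxA.
by rewrite mulmxBl PX mul1mx subr0 h ?mem_head // mulmx0 scaler0.
Qed.

Lemma prs_fix n (s : seq 'rV[C]_n) (X : 'M[C]_n) :
  (forall v, v \in s -> v *m X = v) -> prs s *m X = prs s.
Proof.
move=> h; apply/eqP; rewrite -subr_eq0 -{2}[prs s]mulmx1 -mulmxBr.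
by rewrite prs_annihilate // => v vs; rewrite mulmxBr mulmx1 h ?subrr.
Qed.

Lemma rank_prs n (s : seq 'rV[C]_n) : (\rank (prs s) <= size s)%N.
Proof.
elim: s => [|w s ih] /=; first by rewrite mxrank0.
apply: leq_trans (mxrank_add _ _) _; rewrite -[(size s).+1]addn1 leq_add //.
apply: leq_trans (mxrank_scale _ _) _.
by apply: leq_trans (mxrankM_maxr _ _) _; apply: rank_leq_row.
Qed.

Lemma sqn_residual_le n (P Q : 'M[C]_n) (v : 'rV[C]_n) :
  projector Q -> P *m Q = P ->
  sqn (v *m (1%:M - Q)) <= sqn (v *m (1%:M - P)).
Proof.
move=> hQ PQ; have -> : 1%:M - Q = (1%:M - P) *m (1%:M - Q).
  by rewrite mulmxBl mul1mx mulmxBr mulmx1 PQ subrr subr0.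
by rewrite mulmxA sqn_projector_le //; exact: projectorC.
Qed.

(** ** Complex reflections *)

(** For [a] and [e] of the same length, the unitary that carries [a] to [e] and
    fixes every vector orthogonal to both; when [a = e] the convention on the inverse of 0 makes it the
    identity. *)
Definition refl n (a e : 'rV[C]_n) : 'M[C]_n :=
  1%:M - ((a *m (a - e)^t*) 0 0)^-1 *: ((a - e)^t* *m (a - e)).

(** The condition on [c] says that [w] is multiplied by [- conjC c / c], of
    modulus 1; on the orthogonal complement of [w] the matrix is the identity. *)
Lemma rank1_unitary n (w : 'rV[C]_n) (c : C) : (sqn w)%:C = c + conjC c ->
  1%:M - c^-1 *: (w^t* *m w) \is unitarymx.
Proof.
move=> wc; apply/unitarymxP.
rewrite adjB adj1 adjZ adjM trmxCK mulmxBl mul1mx mulmxBr mulmx1.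
rewrite -scalemxAl -scalemxAr mul_rank1 !scalerA wc fmorphV.
have [->|c0] := eqVneq c 0.
  by rewrite rmorph0 invr0 !mul0r !scale0r !subr0.
have c'0 : conjC c != 0 by rewrite conjC_eq0.
have -> : c^-1 * (conjC c)^-1 * (c + conjC c) = c^-1 + (conjC c)^-1.
  by field; rewrite c0 c'0.
rewrite scalerDl; move: (w^t* *m w) => E.
by apply/matrixP => i j; rewrite !mxE; ring.
Qed.

Lemma mul_adj_sub n (a w : 'rV[C]_n) : w *m w^t* =
  (a - w) *m (a - w)^t* - a *m a^t* + (a *m w^t* + w *m a^t*).
Proof.
rewrite adjB mulmxBl !mulmxBr; move: (a *m a^t*) (a *m w^t*) (w *m a^t*).
by move: (w *m w^t*) => p q r t; apply/matrixP => i j; rewrite !mxE; ring.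
Qed.

Section Reflection.
Variables (n : nat) (a e : 'rV[C]_n).
Hypothesis ae : sqn a = sqn e.
Let w := a - e.
Let c : C := (a *m w^t*) 0 0.

Let awE : a *m w^t* = c%:M.
Proof. by rewrite [LHS]mx11_scalar. Qed.

Let waE : w *m a^t* = (conjC c)%:M.
Proof.
rewrite -[w]trmxCK -adjM awE; apply/rowP => i.
by rewrite !ord1 !mxE eqxx !mulr1n.
Qed.

Let sqn_wE : (sqn w)%:C = c + conjC c.
Proof.
have ew : a - w = e by rewrite /w opprB addrC subrK.
have ww := mul_adj_sub a w; rewrite ew in ww.
suff : ((sqn w)%:C%:M : 'M[C]_1) = (c + conjC c)%:M.
  by move=> /rowP/(_ 0); rewrite !mxE eqxx !mulr1n.
by rewrite -sqnE ww awE waE !sqnE ae subrr add0r raddfD.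
Qed.

Lemma refl_unitary : refl a e \is unitarymx.
Proof. exact: rank1_unitary sqn_wE. Qed.

Lemma mul_refl : a *m refl a e = e.
Proof.
rewrite /refl -/w -/c mulmxBr mulmx1 -scalemxAr mulmxA awE mul_scalar_mx.
rewrite scalerA; have [c0|c0] := eqVneq c 0; last first.
  by rewrite mulVf // scale1r /w opprB addrC subrK.
have : sqn w = 0 by apply/complexI; rewrite sqn_wE c0 conjC0 addr0.
move=> /eqP; rewrite sqn_eq0 subr_eq0 => /eqP ea.
by rewrite c0 mulr0 scale0r subr0.
Qed.

Lemma refl_id (d : 'rV[C]_n) : d *m a^t* = 0 -> d *m e^t* = 0 ->
  d *m refl a e = d.
Proof.
move=> da de; have dw : d *m (a - e)^t* = 0 by rewrite adjB mulmxBr da de subrr.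
by rewrite /refl mulmxBr mulmx1 -scalemxAr mulmxA dw mul0mx scaler0 subr0.
Qed.
End Reflection.

End RowVectors.

(** * Measurable matrices *)

Section MeasurableMatrices.
Context d (T : measurableType d) (R : realType).
Local Notation C := R[i].
Local Open Scope complex_scope.
Local Open Scope sesquilinear_scope.

(** Measurability is tested on real and imaginary parts, so that it reduces to
    that of real functions. *)
Definition cmeas (f : T -> C) :=
  measurable_fun setT (fun t => complex.Re (f t)) /\
  measurable_fun setT (fun t => complex.Im (f t)).

Lemma cmeas_ext f g : f =1 g -> cmeas f -> cmeas g.
Proof. by move=> /funext ->. Qed.

Lemma cmeas_cst c : cmeas (fun=> c).
Proof. by split; exact: measurable_cst. Qed.

Lemma cmeas_real (f : T -> R) : measurable_fun setT f ->
  cmeas (fun t => (f t)%:C).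
Proof. by split => //; exact: measurable_cst. Qed.

Lemma cmeasD f g : cmeas f -> cmeas g -> cmeas (fun t => f t + g t).
Proof.
move=> [f1 f2] [g1 g2]; split.
  have -> : (fun t => complex.Re (f t + g t)) =
      (fun t => complex.Re (f t)) \+ (fun t => complex.Re (g t)).
    by apply/funext => t /=; case: (f t) => ? ?; case: (g t).
  exact: measurable_funD.
have -> : (fun t => complex.Im (f t + g t)) =
    (fun t => complex.Im (f t)) \+ (fun t => complex.Im (g t)).
  by apply/funext => t /=; case: (f t) => ? ?; case: (g t).
exact: measurable_funD.
Qed.

Lemma cmeasM f g : cmeas f -> cmeas g -> cmeas (fun t => f t * g t).
Proof.
move=> [f1 f2] [g1 g2]; split.
  have -> : (fun t => complex.Re (f t * g t)) =
     ((fun t => complex.Re (f t)) \* (fun t => complex.Re (g t))) \-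
     ((fun t => complex.Im (f t)) \* (fun t => complex.Im (g t))).
    by apply/funext => t /=; case: (f t) => ? ?; case: (g t).
  by apply: measurable_funB; apply: measurable_funM.
have -> : (fun t => complex.Im (f t * g t)) =
   ((fun t => complex.Re (f t)) \* (fun t => complex.Im (g t))) \+
   ((fun t => complex.Im (f t)) \* (fun t => complex.Re (g t))).
  by apply/funext => t /=; case: (f t) => ? ?; case: (g t).
by apply: measurable_funD; apply: measurable_funM.
Qed.

Lemma cmeas_conj f : cmeas f -> cmeas (fun t => Num.conj (f t)).
Proof.
move=> [f1 f2]; split.
  suff -> : (fun t => complex.Re (Num.conj (f t))) = fun t => complex.Re (f t).
    by [].
  by apply/funext => t; rewrite conjCE; case: (f t).
suff -> : (fun t => complex.Im (Num.conj (f t))) = \- fun t => complex.Im (f t).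
  exact: measurable_funN.
by apply/funext => t; rewrite conjCE /=; case: (f t).
Qed.

Lemma measurable_invr_fun (f : T -> R) : measurable_fun setT f ->
  measurable_fun setT (fun t => (f t)^-1).
Proof.
move=> mf; have -> : (fun t => (f t)^-1) = (fun t => f t * (f t ^+ 2) `^ (-1)).
  apply/funext => t; have [->|f0] := eqVneq (f t) 0.
    by rewrite invr0 mul0r.
  rewrite powR_inv1 ?sqr_ge0 // expr2 invfM mulrA mulfV // mul1r //.
apply: measurable_funM => //.
apply: (measurableT_comp (measurable_powR _)).
exact: measurable_funX.
Qed.

Lemma cmeasV f : cmeas f -> cmeas (fun t => (f t)^-1).
Proof.
move=> [f1 f2]; have mn : measurable_fun setT
    (fun t => (complex.Re (f t) ^+ 2 + complex.Im (f t) ^+ 2)^-1).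
  apply: measurable_invr_fun.
  by apply: measurable_funD; apply: measurable_funX.
split.
  have -> : (fun t => complex.Re (f t)^-1) = (fun t => complex.Re (f t)) \*
      (fun t => (complex.Re (f t) ^+ 2 + complex.Im (f t) ^+ 2)^-1).
    by apply/funext => t /=; case: (f t).
  exact: measurable_funM.
have -> : (fun t => complex.Im (f t)^-1) = \- ((fun t => complex.Im (f t)) \*
    (fun t => (complex.Re (f t) ^+ 2 + complex.Im (f t) ^+ 2)^-1)).
  by apply/funext => t /=; case: (f t).
by apply: measurable_funN; apply: measurable_funM.
Qed.

Lemma cmeas_sum (I : Type) (s : seq I) (f : I -> T -> C) :
  (forall i, cmeas (f i)) -> cmeas (fun t => \sum_(i <- s) f i t).
Proof.
move=> hf; elim: s => [|i s ih].
  by apply: (cmeas_ext _ (cmeas_cst 0)) => t; rewrite big_nil.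
by apply: (cmeas_ext _ (cmeasD (hf i) ih)) => t; rewrite big_cons.
Qed.

Lemma cmeas_prod (I : Type) (s : seq I) (f : I -> T -> C) :
  (forall i, cmeas (f i)) -> cmeas (fun t => \prod_(i <- s) f i t).
Proof.
move=> hf; elim: s => [|i s ih].
  by apply: (cmeas_ext _ (cmeas_cst 1)) => t; rewrite big_nil.
by apply: (cmeas_ext _ (cmeasM (hf i) ih)) => t; rewrite big_cons.
Qed.

Definition mmeas m n (A : T -> 'M[C]_(m, n)) :=
  forall i j, cmeas (fun t => A t i j).

Lemma mmeas_ext m n (A B : T -> 'M[C]_(m, n)) : A =1 B -> mmeas A -> mmeas B.
Proof. by move=> /funext ->. Qed.

Lemma mmeas_cst m n (A : 'M[C]_(m, n)) : mmeas (fun=> A).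
Proof. by move=> i j; exact: cmeas_cst. Qed.

Lemma mmeasD m n (A B : T -> 'M[C]_(m, n)) : mmeas A -> mmeas B ->
  mmeas (fun t => A t + B t).
Proof.
by move=> hA hB i j; apply: (cmeas_ext _ (cmeasD (hA i j) (hB i j))) => t; rewrite !mxE.
Qed.

Lemma mmeasZ m n (c : T -> C) (A : T -> 'M[C]_(m, n)) : cmeas c -> mmeas A ->
  mmeas (fun t => c t *: A t).
Proof.
by move=> hc hA i j; apply: (cmeas_ext _ (cmeasM hc (hA i j))) => t; rewrite !mxE.
Qed.

Lemma mmeasB m n (A B : T -> 'M[C]_(m, n)) : mmeas A -> mmeas B ->
  mmeas (fun t => A t - B t).
Proof.
move=> hA hB; apply: (mmeas_ext _ (mmeasD hA (mmeasZ (cmeas_cst (-1)) hB))) => t.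
by rewrite scaleN1r.
Qed.

Lemma mmeasM m n p (A : T -> 'M[C]_(m, n)) (B : T -> 'M[C]_(n, p)) :
  mmeas A -> mmeas B -> mmeas (fun t => A t *m B t).
Proof.
move=> hA hB i j; apply: (cmeas_ext _ (cmeas_sum (index_enum 'I_n)
  (fun k => cmeasM (hA i k) (hB k j)))) => t.
by rewrite !mxE.
Qed.

Lemma mmeas_adj m n (A : T -> 'M[C]_(m, n)) : mmeas A ->
  mmeas (fun t => (A t)^t*).
Proof.
by move=> hA i j; apply: (cmeas_ext _ (cmeas_conj (hA j i))) => t; rewrite !mxE.
Qed.

Lemma measurable_sqn n (v : T -> 'rV[C]_n) : mmeas v ->
  measurable_fun setT (fun t => sqn (v t)).
Proof.
move=> hv; have [+ _] := mmeasM hv (mmeas_adj hv) 0 0.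
rewrite [X in measurable_fun _ X](_ : _ = fun t => sqn (v t)) //.
by apply/funext => t; rewrite sqnE mxE eqxx mulr1n.
Qed.

Lemma mmeas_refl n (a e : T -> 'rV[C]_n) : mmeas a -> mmeas e ->
  mmeas (fun t => refl (a t) (e t)).
Proof.
move=> ha he; have hw := mmeasB ha he; apply: mmeasB (mmeas_cst _) _.
apply: mmeasZ (mmeasM (mmeas_adj hw) hw).
by apply: cmeasV; apply: mmeasM ha (mmeas_adj hw) 0 0.
Qed.

Lemma mmeas_prs n (s : seq (T -> 'rV[C]_n)) :
  (forall v, List.In v s -> mmeas v) ->
  mmeas (fun t => prs [seq v t | v <- s]).
Proof.
elim: s => [_|v s ih h] /=; first exact: mmeas_cst.
have hP : mmeas (fun t => prs [seq v t | v <- s]).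
  by apply: ih => u us; apply: h; right.
have hy := mmeasM (h v (or_introl erefl)) (mmeasB (mmeas_cst 1%:M) hP).
apply: (mmeasD hP); apply: mmeasZ (mmeasM (mmeas_adj hy) hy).
by apply: cmeas_real; apply: measurable_invr_fun; apply: measurable_sqn.
Qed.

Lemma cmeas_det n (A : T -> 'M[C]_n) : mmeas A -> cmeas (fun t => \det (A t)).
Proof.
move=> hA; rewrite /determinant; apply: cmeas_sum => s.
by apply: cmeasM (cmeas_cst _) _; apply: cmeas_prod.
Qed.
End MeasurableMatrices.

Lemma cmeas_comp d d' (T : measurableType d) (T' : measurableType d')
    (R : realType) (f : T' -> R[i]) (g : T -> T') :
  measurable_fun setT g -> cmeas f -> cmeas (f \o g).
Proof. by move=> mg [f1 f2]; split; [exact: (measurableT_comp f1 mg)|exact: (measurableT_comp f2 mg)]. Qed.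

Lemma mmeas_comp d d' (T : measurableType d) (T' : measurableType d')
    (R : realType) m n (A : T' -> 'M[R[i]]_(m, n)) (g : T -> T') :
  measurable_fun setT g -> mmeas A -> mmeas (fun t => A (g t)).
Proof. by move=> mg hA i j; exact: cmeas_comp mg (hA i j). Qed.

(** ** The Borel structure of the unitary group *)

Section BorelUnitary.
Variables (R : realType) (n : nat).
Local Notation C := R[i].
Local Notation U := (unitary R n).
Local Open Scope complex_scope.

Lemma open_unitaryP (W : set 'M[C]_n) : open W ->
  measurable [set g : U | W (unitary_mx g)].
Proof. by move=> oW; apply: sub_sigma_algebra; exists W. Qed.

Lemma Re_le_norm (z : C) : (`|complex.Re z|%:C <= `|z|).
Proof.
rewrite normc_def lecR -sqrtr_sqr ler_wsqrtr //.
by rewrite lerDl sqr_ge0.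
Qed.

Lemma Im_le_norm (z : C) : (`|complex.Im z|%:C <= `|z|).
Proof.
rewrite normc_def lecR -sqrtr_sqr ler_wsqrtr //.
by rewrite lerDr sqr_ge0.
Qed.

Lemma norm_le_ReIm (z : C) : `|z| <= (`|complex.Re z| + `|complex.Im z|)%:C.
Proof.
rewrite normc_def lecR.
rewrite -[leRHS]ger0_norm ?addr_ge0 // -sqrtr_sqr ler_wsqrtr //.
rewrite sqrrD !real_normK ?num_real // -addrA lerD2l lerDr mulrn_wge0 // mulr_ge0.
Qed.

Let measurable_coord (f : C -> R) i j :
  (forall z z', `|f z - f z'|%:C <= `|z - z'|) ->
  measurable_fun setT (fun g : U => f (g i j)).
Proof.
move=> hf; apply: (measurability _ (RGenOInfty.measurableE R)).
move=> _ [_ [x ->] <-]; rewrite setTI.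
rewrite (_ : _ @^-1` _ =
    [set g : U | [set M : 'M[C]_n | x < f (M i j)] (unitary_mx g)]); last first.
  by apply/seteqP; split => g /=; rewrite in_itv /= andbT.
apply: open_unitaryP.
rewrite openE => M /= xM.
pose B := [set z | x < f z].
have nB : nbhs (M i j) B.
  apply/nbhs_ballP; exists (f (M i j) - x)%:C; first by rewrite /= ltcR subr_gt0.
  move=> z; rewrite /ball /= => zM; have := le_lt_trans (hf _ _) zM.
  rewrite ltcR /B /= ltr_norml => /andP[_]; lra.
exists (fun k l => if (k == i) && (l == j) then B else setT).
  move=> k l; case: ifP => [/andP[/eqP -> /eqP ->]|_]; first exact: nB.
  exact: filterT.
by move=> N /(_ i j); rewrite !eqxx.
Qed.

Lemma mmeas_unitary : mmeas (fun g : U => unitary_mx g).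
Proof.
move=> i j; split; apply: measurable_coord => z z'.
  apply: le_trans (Re_le_norm (z - z')); rewrite lecR.
  by case: z z' => a b [].
apply: le_trans (Im_le_norm (z - z')); rewrite lecR.
by case: z z' => a b [].
Qed.

Let close_to (T : Type) (A : T -> 'M[C]_n)
    (q : 'M[(rat * rat)%type]_n) (k : nat) : set T :=
  \bigcap_(i in [set: 'I_n]) \bigcap_(j in [set: 'I_n])
    ([set t | `|complex.Re (A t i j) - ratr (q i j).1| < k.+1%:R^-1] `&`
     [set t | `|complex.Im (A t i j) - ratr (q i j).2| < k.+1%:R^-1]).

Let measurable_close_to d (T : measurableType d) (A : T -> 'M[C]_n) q k :
  mmeas A -> measurable (close_to A q k).
Proof.
move=> hA; apply: fin_bigcap_measurable => [|i _]; first exact: finite_finset.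
apply: fin_bigcap_measurable => [|j _]; first exact: finite_finset.
have [h1 h2] := hA i j.
have h (f : T -> R) (x e : R) : measurable_fun setT f ->
    measurable [set t | `|f t - x| < e].
  move=> mf; have -> : [set t | `|f t - x| < e] = f @^-1` ball x e.
    by apply/seteqP; split => t; rewrite /ball /= distrC.
  by rewrite -[X in measurable X]setTI; apply: mf => //; exact: measurable_ball.
by apply: measurableI; apply: h.
Qed.

(** Every open set of matrices is a countable union of boxes with rational
    centres, and membership in a box is a condition on the entries. *)
Lemma measurable_unitary d (T : measurableType d) (f : T -> U) :
  mmeas (fun t => unitary_mx (f t)) -> measurable_fun setT f.
Proof.
move=> hf; apply: (@measurability _ _ _ _ _ _ (@open U)) => //.
move=> _ [_ [W oW <-] <-]; rewrite setTI.
pose ok (q : 'M[(rat * rat)%type]_n * nat) :=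
  close_to (id : 'M[C]_n -> 'M[C]_n) q.1 q.2 `<=` W.
have -> : f @^-1` (val @^-1` W) =
    \bigcup_q (if asbool (ok q) then close_to (fun t => unitary_mx (f t)) q.1 q.2 else set0).
  apply/seteqP; split => t /=.
    move=> Wt; have : W° (val (f t)) by move: oW; rewrite openE; exact.
    rewrite /interior => -[P nP PW].
    have hk i j : {k : nat | ball (val (f t) i j) (4 * k.+1%:R^-1)%:C `<=` P i j}.
      apply: cid; have /nbhs_ballP[e /= e0 eP] := nP i j.
      case: e e0 eP => e e'; rewrite ltcE /= => /andP[/eqP -> e0] eP.
      have e4 : 0 < e / 4 by lra.
      have [k] := ltr_add_invr e4.
      rewrite add0r => ke; exists k; apply: subset_trans eP.
      by apply: le_ball; rewrite lecR mulrC -ler_pdivlMr // ltW.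
    pose K := (\max_i \max_j sval (hk i j))%N.
    have hK i j : ball (val (f t) i j) (4 * K.+1%:R^-1)%:C `<=` P i j.
      apply: subset_trans (svalP (hk i j)); apply: le_ball; rewrite lecR.
      rewrite ler_pM2l // lef_pV2 ?posrE ?ltr0Sn // ler_nat ltnS.
      apply: leq_trans (leq_bigmax i).
      exact: (@leq_bigmax _ (fun j => sval (hk i j)) j).
    have hq (x : R) : {q : rat | `|x - ratr q| < K.+1%:R^-1}.
      have : (0 : R) < K.+1%:R^-1 by rewrite invr_gt0 ltr0Sn.
      move: K.+1%:R^-1 => e e0; apply: cid; have h : x - e < x + e by lra.
      have [q] := rat_in_itvoo h; rewrite in_itv /= => /andP[h1 h2].
      by exists q; rewrite ltr_norml; apply/andP; split; lra.
    pose q := \matrix_(i < n, j < n) (sval (hq (complex.Re (val (f t) i j))),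
                              sval (hq (complex.Im (val (f t) i j)))).
    exists (q, K) => //; case: asboolP => [_|nok] /=.
      by move=> i _ j _; rewrite /q mxE /=; split; exact: (svalP (hq _)).
    exfalso; apply: nok => M /= hM; apply: PW => i j; apply: hK.
    rewrite /ball /=; apply: le_lt_trans (norm_le_ReIm _) _; rewrite ltcR.
    have [] := hM i I j I; rewrite /q mxE /= => m1 m2.
    have := svalP (hq (complex.Re (val (f t) i j))).
    have := svalP (hq (complex.Im (val (f t) i j))).
    move: m1 m2; move: (sval _) (sval _) => q1 q2.
    case: (val (f t) i j) => a b; case: (M i j) => a' b' /=.
    move: K.+1%:R^-1 => e; rewrite !ltr_norml => /andP[? ?] /andP[? ?] /andP[? ?] /andP[? ?].
    have : `|a - a'| < 2 * e by rewrite ltr_norml; apply/andP; split; lra.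
    have : `|b - b'| < 2 * e by rewrite ltr_norml; apply/andP; split; lra.
    by lra.
  move=> [q _]; case: asboolP => // okq h.
  by apply: okq => i _ j _; exact: h.
apply: countable_bigcupT_measurable => [|q]; first exact: countableP.
by case: ifP => _; [exact: measurable_close_to | exact: measurable0].
Qed.

End BorelUnitary.

(** * Tuples of unitary matrices *)

Definition utuple (R : realType) (n r : nat) := r.-tuple (unitary R n).

Section UnitaryTuples.
Variables (R : realType) (n r : nat).
Local Notation C := R[i].
Local Notation U := (unitary R n).
Local Notation GG := (utuple R n r).
Local Open Scope sesquilinear_scope.

HB.instance Definition _ := Measurable.copy GG (r.-tuple U).
HB.instance Definition _ := Choice.copy GG (r.-tuple U).

Definition utuple_one : GG := [tuple (1%g : U) | _ < r].
Definition utuple_mul (g h : GG) : GG := [tuple (tnth g i * tnth h i)%g | i < r].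
Definition utuple_inv (g : GG) : GG := [tuple (tnth g i)^-1%g | i < r].

Fact utuple_mulA : associative utuple_mul.
Proof. by move=> g h k; apply: eq_from_tnth => i; rewrite !tnth_mktuple mulgA. Qed.
Fact utuple_mul1 : left_id utuple_one utuple_mul.
Proof. by move=> g; apply: eq_from_tnth => i; rewrite !tnth_mktuple mul1g. Qed.
Fact utuple_mulr1 : right_id utuple_one utuple_mul.
Proof. by move=> g; apply: eq_from_tnth => i; rewrite !tnth_mktuple mulg1. Qed.
Fact utuple_mulV : left_inverse utuple_one utuple_inv utuple_mul.
Proof. by move=> g; apply: eq_from_tnth => i; rewrite !tnth_mktuple mulVg. Qed.
Fact utuple_mulrV : right_inverse utuple_one utuple_inv utuple_mul.
Proof. by move=> g; apply: eq_from_tnth => i; rewrite !tnth_mktuple mulgV. Qed.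

HB.instance Definition _ := isGroup.Build GG utuple_mulA utuple_mul1
  utuple_mulr1 utuple_mulV utuple_mulrV.

Definition mx (g : GG) (i : 'I_r) : 'M[C]_n := unitary_mx (tnth g i).

Lemma unitary_mxV (u : U) : unitary_mx (u^-1)%g = (unitary_mx u)^t*.
Proof. by rewrite -[LHS]/(invmx _) invmx_unitary ?unitary_mxP. Qed.

Lemma mxM g h i : mx (g * h)%g i = mx g i *m mx h i.
Proof. by rewrite /mx tnth_mktuple. Qed.

Lemma mxV g i : mx g^-1%g i = (mx g i)^t*.
Proof. by rewrite /mx tnth_mktuple unitary_mxV. Qed.

Lemma mx1 i : mx 1%g i = 1%:M.
Proof. by rewrite /mx tnth_mktuple. Qed.

Lemma mx_unitary g i : mx g i \is unitarymx.
Proof. exact: unitary_mxP. Qed.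

Lemma mx_adjK g i : (mx g i)^t* *m mx g i = 1%:M.
Proof. by rewrite -mxV -mxM mulVg mx1. Qed.

Lemma mx_mulK g i : mx g i *m (mx g i)^t* = 1%:M.
Proof. by rewrite -mxV -mxM mulgV mx1. Qed.

Lemma mmeas_mx i : mmeas (fun g : GG => mx g i).
Proof.
exact: (@mmeas_comp _ _ _ _ R n n (fun u : U => unitary_mx u) (fun g : GG => tnth g i)
  (measurable_tnth i) (@mmeas_unitary R n)).
Qed.

Lemma measurable_utuple d (T : measurableType d) (f : T -> GG) :
  (forall i, mmeas (fun t => mx (f t) i)) -> measurable_fun setT f.
Proof.
move=> hf; apply/measurable_fun_tnthP => i; apply: measurable_unitary.
exact: hf.
Qed.

Lemma mmeas_mx_comp d (T : measurableType d) (f : T -> GG) i :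
  measurable_fun setT f -> mmeas (fun t => mx (f t) i).
Proof. by move=> mf; exact: (mmeas_comp mf (@mmeas_mx i)). Qed.

Lemma measurable_mulg d (T : measurableType d) (f g : T -> GG) :
  measurable_fun setT f -> measurable_fun setT g ->
  measurable_fun setT (fun t => (f t * g t)%g).
Proof.
move=> mf mg; apply: measurable_utuple => i.
apply: (mmeas_ext _ (mmeasM (mmeas_mx_comp i mf) (mmeas_mx_comp i mg))) => t.
by rewrite mxM.
Qed.

Lemma measurable_invg d (T : measurableType d) (f : T -> GG) :
  measurable_fun setT f -> measurable_fun setT (fun t => (f t)^-1%g).
Proof.
move=> mf; apply: measurable_utuple => i.
by apply: (mmeas_ext _ (mmeas_adj (mmeas_mx_comp i mf))) => t; rewrite mxV.
Qed.

(** ** Pointwise stabilizers *)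

Definition fixes (D : 'I_r -> seq 'rV[C]_n) (h : GG) :=
  forall i v, v \in D i -> v *m mx h i = v.

Lemma fixesV D g : fixes D g -> fixes D g^-1%g.
Proof.
by move=> fg i v vD; rewrite mxV -{1}(fg i v vD) -mulmxA mx_mulK mulmx1.
Qed.

Lemma fixes_prs D g i : fixes D g -> prs (D i) *m mx g i = prs (D i).
Proof. by move=> fg; apply: prs_fix => v; exact: fg. Qed.

(** A measurable map from the group of tuples onto the stabilizer of [D] that
    commutes with left translations by that stabilizer: it carries the
    Haar measure of the group to the Haar measure of the stabilizer, and thus
    stands for the latter. *)
Definition equivariant D (kappa : GG -> GG) := [/\ measurable_fun setT kappa,
  forall x, fixes D (kappa x) &
  forall h x, fixes D h -> kappa (h * x)%g = (h * kappa x)%g].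

(** The vectors of [s] are put back in place one at a time: the residual [y] of
    the new vector is orthogonal to the earlier ones, and so is its image, so the
    reflection that carries the image back to [y] does not disturb them. *)
Fixpoint kapmx (s : seq 'rV[C]_n) (g : 'M[C]_n) : 'M[C]_n :=
  if s is v :: s' then
    let y := v *m (1%:M - prs s') in
    kapmx s' g *m refl (y *m kapmx s' g) y
  else g.

Lemma kapmx_unitary s g : g \is unitarymx -> kapmx s g \is unitarymx.
Proof.
move=> gU; elim: s => [|v s ih]; first exact: gU.
apply: mul_unitarymx; first exact: ih.
by apply: refl_unitary; apply: sqn_unitary.
Qed.

Lemma kapmx_equivariant s h g : (forall v, v \in s -> v *m h = v) ->
  kapmx s (h *m g) = h *m kapmx s g.
Proof.
elim: s => //= v s ih hs; have hs' w : w \in s -> w *m h = w.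
  by move=> ws; apply: hs; rewrite inE ws orbT.
rewrite ih //; set y := v *m _.
suff yh : y *m h = y by rewrite [y *m (h *m _)]mulmxA yh -mulmxA.
by rewrite /y mulmxBr mulmx1 mulmxBl hs ?mem_head // -mulmxA prs_fix.
Qed.

Lemma kapmx_fix s g v : g \is unitarymx -> v \in s -> v *m kapmx s g = v.
Proof.
move=> gU; elim: s v => //= v s ih w.
set P := prs s in ih *; set K := kapmx s g in ih *; set y := v *m _.
have KU : K \is unitarymx by exact: kapmx_unitary.
have [PP Ps] : projector P by exact: prs_projector.
have PK : P *m K = P by apply: prs_fix.
have yP : y *m P = 0 by rewrite /y -mulmxA mulmxBl mul1mx PP subrr mulmx0.
have Py : P *m y^t* = 0 by rewrite -{1}Ps -adjM yP adj0.
have PyK : P *m (y *m K)^t* = 0.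
  by rewrite adjM -{1}PK -mulmxA [K *m _]mulmxA (unitarymxP KU) mul1mx Py.
have fixP (x : 'rV[C]_n) : x *m P = x -> x *m (K *m refl (y *m K) y) = x.
  move=> xP; have xK : x *m K = x by rewrite -xP -mulmxA PK.
  rewrite mulmxA xK; apply: refl_id.
    by rewrite -xP -mulmxA PyK mulmx0.
  by rewrite -xP -mulmxA Py mulmx0.
rewrite inE => /predU1P[->|ws]; last first.
  by apply: fixP; apply: mul_prs.
have -> : v = v *m P + y by rewrite /y mulmxBr mulmx1 addrC subrK.
rewrite mulmxDl fixP; last by rewrite -mulmxA PP.
by rewrite [y *m (_ *m _)]mulmxA mul_refl // sqn_unitary.
Qed.

Lemma mmeas_kapmx d (T : measurableType d) s (f : T -> 'M[C]_n) :
  mmeas f -> mmeas (fun t => kapmx s (f t)).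
Proof.
move=> mf; elim: s => //= v s ih; apply: mmeasM => //.
by apply: mmeas_refl; [apply: mmeasM => //|]; apply: mmeas_cst.
Qed.

Definition kap D (g : GG) : GG :=
  [tuple Unitary (kapmx_unitary (D i) (mx_unitary g i)) | i < r].

Lemma mx_kap D g i : mx (kap D g) i = kapmx (D i) (mx g i).
Proof. by rewrite /mx tnth_mktuple. Qed.

Lemma kap_equivariant D : equivariant D (kap D).
Proof.
split.
- apply: measurable_utuple => i.
  by apply: (mmeas_ext _ (mmeas_kapmx (D i) (@mmeas_mx i))) => g; rewrite mx_kap.
- by move=> x i v vD; rewrite mx_kap kapmx_fix ?mx_unitary.
- move=> h x fh; apply: eq_from_tnth => i; apply: val_inj => /=.
  rewrite -[LHS]/(mx _ i) -[RHS]/(mx _ i) mxM !mx_kap mxM kapmx_equivariant //.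
  by move=> v vD; exact: fh.
Qed.

Lemma kap_nil g : kap (fun=> [::]) g = g.
Proof.
by apply: eq_from_tnth => i; apply: val_inj; rewrite /= -[LHS]/(mx _ i) mx_kap.
Qed.

End UnitaryTuples.

(** * Haar measure and the Haar measures of the stabilizers *)

Section HaarMeasure.
Variables (R : realType) (n r : nat).
Local Notation C := R[i].
Local Notation GG := (utuple R n r).
Variable Lam : probability GG R.
Hypothesis Lam_inv : forall (h : GG) (A : set GG), measurable A ->
  Lam ((fun g => (h * g)%g) @^-1` A) = Lam A.
Local Open Scope sesquilinear_scope.
Local Open Scope ereal_scope.

Implicit Types (phi : GG -> \bar R) (D : 'I_r -> seq 'rV[C]_n).

Lemma int_cst (c : \bar R) : \int[Lam]_x c = c.
Proof. by rewrite -[RHS]mule1 -(probability_setT Lam) -integral_cst. Qed.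

Lemma int_mulg h phi : measurable_fun setT phi -> (forall x, 0 <= phi x) ->
  \int[Lam]_x phi (h * x)%g = \int[Lam]_x phi x.
Proof.
move=> mphi phi0; have mh : measurable_fun setT (fun g : GG => (h * g)%g).
  by apply: measurable_mulg; [exact: measurable_cst|exact: measurable_id].
have := ge0_integral_pushforward mh Lam measurableT mphi (fun y _ => phi0 y).
rewrite preimage_setT => <-; apply: eq_measure_integral => A mA _.
exact: Lam_inv.
Qed.

Lemma int_swap (F : GG * GG -> \bar R) : measurable_fun setT F ->
  (forall x, 0 <= F x) ->
  \int[Lam]_x \int[Lam]_y F (x, y) = \int[Lam]_y \int[Lam]_x F (x, y).
Proof. by move=> mF F0; exact: fubini_tonelli. Qed.

Lemma measurable_fst_comp (f : GG -> GG) : measurable_fun setT f ->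
  measurable_fun setT (fun z : GG * GG => f z.1).
Proof. by move=> mf; apply: (measurableT_comp mf); exact: measurable_fst. Qed.

Lemma measurable_snd_comp (f : GG -> GG) : measurable_fun setT f ->
  measurable_fun setT (fun z : GG * GG => f z.2).
Proof. by move=> mf; apply: (measurableT_comp mf); exact: measurable_snd. Qed.

(** The two sides are the integrals of [phi] for a left invariant and for a
    right invariant probability on the stabilizer; both equal the integral of
    [phi (kappa' y ^-1 * kappa x)] over independent [x] and [y]. *)
Lemma int_equivariantV D kappa kappa' phi :
  equivariant D kappa -> equivariant D kappa' ->
  measurable_fun setT phi -> (forall x, 0 <= phi x) ->
  \int[Lam]_x phi (kappa x) = \int[Lam]_x phi (kappa' x)^-1%g.
Proof.
move=> [mk fk ek] [mk' fk' ek'] mphi phi0.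
pose F (z : GG * GG) := phi ((kappa' z.2)^-1 * kappa z.1)%g.
have mF : measurable_fun setT F.
  apply: (measurableT_comp mphi); apply: measurable_mulg.
    by apply: measurable_invg; exact: measurable_snd_comp.
  exact: measurable_fst_comp.
have -> : \int[Lam]_x phi (kappa x) = \int[Lam]_y \int[Lam]_x F (x, y).
  rewrite -[LHS]int_cst; apply: eq_integral => y _; rewrite /F /=.
  have fy : fixes D (kappa' y)^-1%g by apply: fixesV; exact: fk'.
  under [RHS]eq_integral do rewrite -ek //.
  rewrite (int_mulg _ (measurableT_comp mphi mk)) // => x; exact: phi0.
rewrite -int_swap //; last by move=> z; exact: phi0.
have -> : \int[Lam]_x phi (kappa' x)^-1%g = \int[Lam]_x \int[Lam]_y phi (kappa' y)^-1%g.
  by rewrite int_cst.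
apply: eq_integral => x _; rewrite /F /=.
have fx : fixes D (kappa x)^-1%g by apply: fixesV; exact: fk.
under eq_integral => y _.
  rewrite -[X in (_ * X)%g]invgK -invgM -ek' //.
  over.
have mpsi : measurable_fun setT (fun y => phi (kappa' y)^-1%g).
  by apply: (measurableT_comp mphi); exact: measurable_invg.
by rewrite (int_mulg _ mpsi).
Qed.

Lemma int_equivariant D kappa kappa' phi :
  equivariant D kappa -> equivariant D kappa' ->
  measurable_fun setT phi -> (forall x, 0 <= phi x) ->
  \int[Lam]_x phi (kappa x) = \int[Lam]_x phi (kappa' x).
Proof.
move=> ek ek' mphi phi0.
by rewrite (int_equivariantV ek ek') // -(int_equivariantV ek' ek').
Qed.

Lemma measurable_rmul phi h : measurable_fun setT phi ->
  measurable_fun setT (fun x : GG => phi (x * h)%g).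
Proof.
move=> mphi; apply: (measurableT_comp mphi).
by apply: measurable_mulg; [exact: measurable_id|exact: measurable_cst].
Qed.

Lemma measurable_lmul phi h : measurable_fun setT phi ->
  measurable_fun setT (fun x : GG => phi (h * x)%g).
Proof.
move=> mphi; apply: (measurableT_comp mphi).
by apply: measurable_mulg; [exact: measurable_cst|exact: measurable_id].
Qed.

Lemma measurable_kap D : measurable_fun setT (@kap R n r D).
Proof. by case: (kap_equivariant D). Qed.

Lemma fixes_kap D x : fixes D (kap D x).
Proof. by case: (kap_equivariant D). Qed.

Lemma kapM D h x : fixes D h -> kap D (h * x)%g = (h * kap D x)%g.
Proof. by case: (kap_equivariant D) => _ _; apply. Qed.

Lemma int_kapV D phi : measurable_fun setT phi -> (forall x, 0 <= phi x) ->
  \int[Lam]_x phi (kap D x)^-1%g = \int[Lam]_x phi (kap D x).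
Proof.
move=> mphi phi0; apply/esym.
exact: int_equivariantV (kap_equivariant D) (kap_equivariant D) mphi phi0.
Qed.

Lemma int_kap_mull D h phi : fixes D h ->
  measurable_fun setT phi -> (forall x, 0 <= phi x) ->
  \int[Lam]_x phi (h * kap D x)%g = \int[Lam]_x phi (kap D x).
Proof.
move=> fh mphi phi0; under eq_integral do rewrite -kapM //.
rewrite (int_mulg _ (measurableT_comp mphi (measurable_kap D))) // => x.
exact: phi0.
Qed.

Lemma int_kap_mulr D h phi : fixes D h ->
  measurable_fun setT phi -> (forall x, 0 <= phi x) ->
  \int[Lam]_x phi (kap D x * h)%g = \int[Lam]_x phi (kap D x).
Proof.
move=> fh mphi phi0.
rewrite -(int_kapV D (measurable_rmul h mphi)) //.
have mpsi : measurable_fun setT (fun y : GG => phi (kap D y)^-1%g).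
  by apply: (measurableT_comp mphi); apply: measurable_invg; exact: measurable_kap.
transitivity (\int[Lam]_x phi (kap D (h^-1 * x))^-1%g).
  apply: eq_integral => x _; rewrite kapM ?invgM ?invgK //; exact: fixesV.
by rewrite (int_mulg _ mpsi) // int_kapV.
Qed.

(** [u * kap D (u^-1 * x) * u^-1] is again equivariant, for the stabilizer of
    [D'], and equivariant maps all have the same law. *)
Lemma int_kap_conj D D' u phi :
  (forall h, fixes D' h <-> fixes D (u^-1 * h * u)%g) ->
  measurable_fun setT phi -> (forall x, 0 <= phi x) ->
  \int[Lam]_x phi (u * kap D x)%g = \int[Lam]_x phi (kap D' x * u)%g.
Proof.
move=> DD' mphi phi0; pose kappa x := (u * kap D (u^-1 * x) * u^-1)%g.
have ek : equivariant D' kappa.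
  split.
  - apply: measurable_mulg; last exact: measurable_cst.
    apply: measurable_mulg; first exact: measurable_cst.
    apply: (measurableT_comp (measurable_kap D)).
    by apply: measurable_mulg; [exact: measurable_cst|exact: measurable_id].
  - move=> x; apply/DD'; rewrite /kappa !mulgA mulVg mul1g -mulgA mulVg mulg1.
    exact: fixes_kap.
  - move=> h x /DD' fh; rewrite /kappa.
    rewrite (_ : (u^-1 * (h * x) = (u^-1 * h * u) * (u^-1 * x))%g).
      by rewrite kapM // !mulgA mulgV mul1g.
    by rewrite !mulgA mulgK.
have mphi' := measurable_rmul u mphi.
rewrite -(int_equivariant ek (kap_equivariant D') mphi') //.
have mpsi : measurable_fun setT (fun x : GG => phi (u * kap D x)%g).
  exact: (measurableT_comp (measurable_lmul u mphi) (measurable_kap D)).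
rewrite -(int_mulg u^-1%g mpsi) //; apply: eq_integral => x _.
by rewrite /kappa -[in RHS]mulgA mulVg mulg1.
Qed.

(** ** Revealing one more vector

    Under the law of [kap D x], the stabilizer of a longer list can be
    resampled: on the left when the new vectors are known beforehand, on the
    right when they move with [kap D x]. *)

Lemma int_kap_reveal_left D D' phi : (forall h, fixes D' h -> fixes D h) ->
  measurable_fun setT phi -> (forall x, 0 <= phi x) ->
  \int[Lam]_x phi (kap D x) =
  \int[Lam]_x \int[Lam]_y phi (kap D' y * kap D x)%g.
Proof.
move=> DD' mphi phi0.
pose F (z : GG * GG) := phi (kap D' z.2 * kap D z.1)%g.
have mF : measurable_fun setT F.
  apply: (measurableT_comp mphi); apply: measurable_mulg.
    by apply: measurable_snd_comp; exact: measurable_kap.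
  by apply: measurable_fst_comp; exact: measurable_kap.
rewrite (int_swap mF); last by move=> z; exact: phi0.
rewrite -[LHS]int_cst; apply: eq_integral => y _; rewrite /F /=.
by rewrite int_kap_mull //; apply: DD'; exact: fixes_kap.
Qed.

Lemma int_kap_reveal_right D D' phi : (forall h, fixes D' h -> fixes D h) ->
  measurable_fun setT phi -> (forall x, 0 <= phi x) ->
  \int[Lam]_x phi (kap D x) =
  \int[Lam]_x \int[Lam]_y phi (kap D x * kap D' y)%g.
Proof.
move=> DD' mphi phi0.
pose F (z : GG * GG) := phi (kap D z.1 * kap D' z.2)%g.
have mF : measurable_fun setT F.
  apply: (measurableT_comp mphi); apply: measurable_mulg.
    by apply: measurable_fst_comp; exact: measurable_kap.
  by apply: measurable_snd_comp; exact: measurable_kap.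
rewrite (int_swap mF); last by move=> z; exact: phi0.
rewrite -[LHS]int_cst; apply: eq_integral => y _; rewrite /F /=.
by rewrite int_kap_mulr //; apply: DD'; exact: fixes_kap.
Qed.

End HaarMeasure.

(** * Stein's identity on the sphere *)

Section BoundedMean.
Context d (T : measurableType d) (R : realType) (P : probability T R).
Implicit Types f g : T -> R.

Definition bounded_meas f :=
  measurable_fun setT f /\ exists M, forall x, `|f x| <= M.

Lemma bm_cst c : bounded_meas (fun=> c).
Proof. by split; [exact: measurable_cst|exists `|c|]. Qed.

Lemma bmD f g : bounded_meas f -> bounded_meas g ->
  bounded_meas (fun x => f x + g x).
Proof.
move=> [mf [M fM]] [mg [N gN]]; split; first exact: measurable_funD.
by exists (M + N) => x; apply: le_trans (ler_normD _ _) _; apply: lerD.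
Qed.

Lemma bmM f g : bounded_meas f -> bounded_meas g ->
  bounded_meas (fun x => f x * g x).
Proof.
move=> [mf [M fM]] [mg [N gN]]; split; first exact: measurable_funM.
by exists (M * N) => x; rewrite normrM ler_pM.
Qed.

Lemma bmZ c f : bounded_meas f -> bounded_meas (fun x => c * f x).
Proof. by apply: bmM; exact: bm_cst. Qed.

Lemma bmB f g : bounded_meas f -> bounded_meas g ->
  bounded_meas (fun x => f x - g x).
Proof.
move=> bf /(bmZ (-1)) bg; have := bmD bf bg; congr bounded_meas.
by apply/funext => x; rewrite mulN1r.
Qed.

Lemma bmX f k : bounded_meas f -> bounded_meas (fun x => f x ^+ k).
Proof.
move=> bf; elim: k => [|k ih]; first exact: bm_cst.
have := bmM bf ih; congr bounded_meas.
by apply/funext => x; rewrite exprS.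
Qed.

Lemma bm_sum (I : Type) (s : seq I) (p : pred I) (F : I -> T -> R) :
  (forall i, bounded_meas (F i)) ->
  bounded_meas (fun x => \sum_(i <- s | p i) F i x).
Proof.
move=> bF; elim: s => [|i s ih].
  have := bm_cst 0; congr bounded_meas.
  by apply/funext => x; rewrite big_nil.
case pi : (p i); last first.
  move: ih; congr bounded_meas.
  by apply/funext => x; rewrite big_cons pi.
have := bmD (bF i) ih; congr bounded_meas.
by apply/funext => x; rewrite big_cons pi.
Qed.

Lemma bm_integrable f : bounded_meas f -> P.-integrable setT (EFin \o f).
Proof.
move=> [mf [M fM]]; apply: (le_integrable measurableT (g := EFin \o cst M)).
- exact/measurable_EFinP.
- by move=> x _ /=; rewrite lee_fin (le_trans (fM x)) // ler_norm.
- exact: finite_measure_integrable_cst.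
Qed.

Definition mean f : R := \int[P]_x f x.

Lemma mean_cst c : mean (fun=> c) = c.
Proof.
rewrite /mean Rintegral_cst // [X in fine X](_ : _ = 1%E) ?mulr1 //.
exact: probability_setT.
Qed.

Lemma meanD f g : bounded_meas f -> bounded_meas g ->
  mean (fun x => f x + g x) = mean f + mean g.
Proof. by move=> bf bg; apply: RintegralD => //; exact: bm_integrable. Qed.

Lemma meanB f g : bounded_meas f -> bounded_meas g ->
  mean (fun x => f x - g x) = mean f - mean g.
Proof. by move=> bf bg; apply: RintegralB => //; exact: bm_integrable. Qed.

Lemma meanZ c f : bounded_meas f -> mean (fun x => c * f x) = c * mean f.
Proof. by move=> bf; apply: RintegralZl => //; exact: bm_integrable. Qed.

Lemma mean_le f g : bounded_meas f -> bounded_meas g ->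
  (forall x, f x <= g x) -> mean f <= mean g.
Proof.
by move=> bf bg fg; apply: le_Rintegral => //; exact: bm_integrable.
Qed.

Lemma mean_ext f g : f =1 g -> mean f = mean g.
Proof. by move=> /funext ->. Qed.

Lemma mean_sum (I : Type) (s : seq I) (p : pred I) (F : I -> T -> R) :
  (forall i, bounded_meas (F i)) ->
  mean (fun x => \sum_(i <- s | p i) F i x) = \sum_(i <- s | p i) mean (F i).
Proof.
move=> bF; elim: s => [|i s ih].
  rewrite big_nil -[RHS]mean_cst; apply: mean_ext => x.
  by rewrite big_nil.
rewrite big_cons; case: ifP => pi; rewrite -ih.
  rewrite -meanD //; last exact: bm_sum.
  by apply: mean_ext => x; rewrite big_cons pi.
by apply: mean_ext => x; rewrite big_cons pi.
Qed.

Lemma mean_abs f K : bounded_meas f -> (forall x, `|f x| <= K) ->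
  `|mean f| <= K.
Proof.
move=> bf fK; rewrite ler_norml; apply/andP; split.
  rewrite -(mean_cst (- K)); apply: mean_le (bm_cst _) bf _ => x.
  by have := fK x; rewrite ler_norml => /andP[].
rewrite -[leRHS](mean_cst K); apply: mean_le bf (bm_cst _) _ => x.
by have := fK x; rewrite ler_norml => /andP[].
Qed.

Lemma mean_EFin f : bounded_meas f -> (\int[P]_x (f x)%:E)%E = (mean f)%:E.
Proof.
move=> bf; rewrite /mean /Rintegral fineK //.
by apply: integrable_fin_num => //; exact: bm_integrable.
Qed.

(** [apx f_ f]: uniform approximation, at a linear rate, by bounded
    functions, as the parameter tends to 0. *)
Definition apx (f_ : R -> T -> R) f := exists2 K : R, 0 <= K & forall tau x,
  0 < tau <= 1 -> [/\ `|f_ tau x - f x| <= K * tau, `|f_ tau x| <= K & `|f x| <= K].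

Lemma apx_cst f M : (forall x, `|f x| <= M) -> apx (fun=> f) f.
Proof.
move=> fM; exists `|M| => // tau x /andP[t0 _]; rewrite subrr normr0.
by rewrite mulr_ge0 ?(ltW t0) // !(le_trans (fM x)) // ler_norm.
Qed.

Lemma apxD (f_ g_ : R -> T -> R) f g : apx f_ f -> apx g_ g ->
  apx (fun tau x => f_ tau x + g_ tau x) (fun x => f x + g x).
Proof.
move=> [K K0 fK] [L L0 gL]; exists (K + L); first exact: addr_ge0.
move=> tau x ht; have [h1 h2 h3] := fK _ x ht; have [h4 h5 h6] := gL _ x ht.
split; try by apply: le_trans (ler_normD _ _) _; apply: lerD.
rewrite opprD addrACA mulrDl.
by apply: le_trans (ler_normD _ _) _; apply: lerD.
Qed.

Lemma apxM (f_ g_ : R -> T -> R) f g : apx f_ f -> apx g_ g ->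
  apx (fun tau x => f_ tau x * g_ tau x) (fun x => f x * g x).
Proof.
move=> [K K0 fK] [L L0 gL]; exists (K * L + K * L); first by rewrite addr_ge0 ?mulr_ge0.
move=> tau x ht; have [h1 h2 h3] := fK _ x ht; have [h4 h5 h6] := gL _ x ht.
have KL : 0 <= K * L by rewrite mulr_ge0.
split; last 2 first.
- by rewrite normrM (le_trans (ler_pM _ _ h2 h5)) // lerDl.
- by rewrite normrM (le_trans (ler_pM _ _ h3 h6)) // lerDl.
have -> : f_ tau x * g_ tau x - f x * g x =
  (f_ tau x - f x) * g_ tau x + f x * (g_ tau x - g x) by ring.
apply: le_trans (ler_normD _ _) _; rewrite !normrM mulrDl; apply: lerD.
  by rewrite mulrAC ler_pM.
by rewrite -mulrA ler_pM.
Qed.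

Lemma apxX (f_ : R -> T -> R) f k : apx f_ f ->
  apx (fun tau x => f_ tau x ^+ k) (fun x => f x ^+ k).
Proof.
move=> af; elim: k => [|k ih].
  exact: (@apx_cst (fun=> 1) `|1|).
have := apxM af ih; congr apx.
  by apply/funext => tau; apply/funext => x; rewrite exprS.
by apply/funext => x; rewrite exprS.
Qed.

Lemma apx_sum (I : Type) (s : seq I) (F_ : I -> R -> T -> R) (F : I -> T -> R) :
  (forall i, apx (F_ i) (F i)) ->
  apx (fun tau x => \sum_(i <- s) F_ i tau x) (fun x => \sum_(i <- s) F i x).
Proof.
move=> aF; elim: s => [|i s ih].
  have := @apx_cst (fun=> 0) `|0| (fun=> lexx _); congr apx.
    by apply/funext => tau; apply/funext => x; rewrite big_nil.
  by apply/funext => x; rewrite big_nil.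
have := apxD (aF i) ih; congr apx.
  by apply/funext => tau; apply/funext => x; rewrite big_cons.
by apply/funext => x; rewrite big_cons.
Qed.

Lemma apx_mean (f_ : R -> T -> R) f : apx f_ f -> bounded_meas f ->
  (forall tau, 0 < tau <= 1 -> bounded_meas (f_ tau)) ->
  (forall tau, 0 < tau <= 1 -> mean (f_ tau) = 0) -> mean f = 0.
Proof.
move=> [K K0 fK] bf bf_ f_0; apply/eqP; rewrite -normr_le0.
apply/ler_addgt0Pl => e e0; rewrite addr0.
pose tau := Num.min 1 (e / (K + 1)).
have K1 : 0 < K + 1 by rewrite ltr_wpDl.
have ht : 0 < tau <= 1.
  by rewrite /tau lt_min ltr01 divr_gt0 //= ge_min lexx.
have -> : mean f = - mean (fun x => f_ tau x - f x).
  by rewrite (meanB (bf_ _ ht) bf) (f_0 _ ht) sub0r opprK.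
rewrite normrN; apply: mean_abs; first by apply: bmB => //; exact: bf_.
move=> x; have [h _ _] := fK _ x ht; apply: le_trans h _.
apply: le_trans (_ : (K + 1) * (e / (K + 1)) <= _); last first.
  by rewrite mulrC divfK // gt_eqF.
rewrite ler_pM ?(ltW (proj1 (andP ht))) // ?lerDl //.
by rewrite /tau ge_min lexx orbT.
Qed.
End BoundedMean.

Section SteinLimit.
Context d (T : measurableType d) (R : realType) (P : probability T R).
Variables (b D s : T -> R) (eta : R) (a : nat).
Hypotheses (bb : bounded_meas b) (bD : bounded_meas D) (bs : bounded_meas s).
Hypotheses (eta0 : 0 < eta) (s0 : forall x, 0 <= s x).

(** A rational parametrization of the unit circle near (1, 0), thanks to which
    the identities below are identities between rational functions. *)
Definition circ_cos (tau : R) := (1 - tau ^+ 2) / (1 + tau ^+ 2).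
Definition circ_sin (tau : R) := 2 * tau / (1 + tau ^+ 2).

(** What becomes of the squared length [s] of a projection under the reflection
    of two coordinates, one inside the projection and one outside: [D] is the
    difference of their squared moduli and [b] the real part of their hermitian
    product, up to a phase. *)
Definition moved (tau : R) x := s x + circ_sin tau *
  (circ_sin tau * D x + 2 * circ_cos tau * b x).

Hypothesis moved_ge0 : forall tau x, 0 <= moved tau x.
Hypothesis moved_mean : forall tau, mean P (fun x =>
  (b x + circ_sin tau * (- 2 * circ_sin tau * b x + circ_cos tau * D x)) *
  ((moved tau x + eta)^-1) ^+ a) = 0.

Let w x := (s x + eta)^-1.
Let w_ tau x := (moved tau x + eta)^-1.

Lemma norm_inv_le (u : R) : 0 <= u -> `|(u + eta)^-1| <= eta^-1.
Proof.
move=> u0; rewrite ger0_norm ?invr_ge0 ?addr_ge0 ?(ltW eta0) //.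
by rewrite lef_pV2 ?posrE ?ltr_wpDl // lerDr.
Qed.

Lemma bm_inv (f : T -> R) : bounded_meas f -> (forall x, 0 <= f x) ->
  bounded_meas (fun x => (f x + eta)^-1).
Proof.
move=> [mf [M fM]] f0; split.
  apply: measurable_invr_fun; apply: measurable_funD => //.
by exists eta^-1 => x; exact: norm_inv_le.
Qed.

Let bw : bounded_meas w. Proof. exact: bm_inv. Qed.

Let b_moved tau : bounded_meas (moved tau).
Proof.
by apply: bmD => //; apply: bmZ; apply: bmD; apply: bmZ.
Qed.

Let bw_ tau : bounded_meas (w_ tau). Proof. exact: bm_inv. Qed.

Let apx_b : apx (fun=> b) b. Proof. by case: bb => _ [M]; exact: apx_cst. Qed.
Let apx_D : apx (fun=> D) D. Proof. by case: bD => _ [M]; exact: apx_cst. Qed.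
Let apx_w1 : apx (fun=> w) w. Proof. by case: bw => _ [M]; exact: apx_cst. Qed.

Let apx_real c : apx (fun _ (_ : T) => c : R) (fun=> c).
Proof. exact: (@apx_cst _ _ _ (fun=> c) `|c|). Qed.

Let apx_sin : apx (fun tau (_ : T) => circ_sin tau) (fun=> 0).
Proof.
exists 2 => // tau _ /andP[t0 t1]; rewrite normr0 subr0 /circ_sin.
have h : 0 < 1 + tau ^+ 2 by rewrite ltr_wpDr ?sqr_ge0.
have h2 : 2 * tau / (1 + tau ^+ 2) <= 2 * tau.
  by rewrite ler_pdivrMr // ler_peMr ?mulr_ge0 ?(ltW t0) // lerDl sqr_ge0.
rewrite ger0_norm; last by rewrite divr_ge0 ?(ltW h) // mulr_ge0 ?(ltW t0).
by split => //; lra.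
Qed.

Let apx_cos : apx (fun tau (_ : T) => circ_cos tau) (fun=> 1).
Proof.
exists 2 => // tau _ /andP[t0 t1]; rewrite normr1 /circ_cos.
have h : 0 < 1 + tau ^+ 2 by rewrite ltr_wpDr ?sqr_ge0.
have t2 : tau ^+ 2 <= tau by rewrite expr2 ler_piMr ?(ltW t0).
have t3 : 0 <= tau ^+ 2 by exact: sqr_ge0.
split; last by rewrite ler1n.
  have -> : (1 - tau ^+ 2) / (1 + tau ^+ 2) - 1 = - (2 * tau ^+ 2 / (1 + tau ^+ 2)).
    by field; rewrite gt_eqF.
  rewrite normrN ger0_norm; last by rewrite divr_ge0 ?(ltW h) // mulr_ge0.
  rewrite ler_pdivrMr //; nra.
rewrite ger0_norm; last by rewrite divr_ge0 ?(ltW h) //; lra.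
by rewrite ler_pdivrMr //; lra.
Qed.

Let w_diff tau x : w_ tau x - w x = circ_sin tau *
  (- (circ_sin tau * D x + 2 * circ_cos tau * b x) * (w_ tau x * w x)).
Proof.
have h1 : s x + eta != 0 by rewrite gt_eqF // ltr_wpDl.
have h2 : moved tau x + eta != 0 by rewrite gt_eqF // ltr_wpDl.
rewrite /w_ /w; rewrite /moved in h2 *.
by field; rewrite h1 h2.
Qed.

Let apx_w : apx w_ w.
Proof.
have [K K0 hK] : apx (fun tau x => - (circ_sin tau * D x + 2 * circ_cos tau * b x) * w x)
    (fun x => - (0 * D x + 2 * 1 * b x) * w x).
  apply: apxM apx_w1.
  have := apxM (apx_real (-1)) (apxD (apxM apx_sin apx_D)
    (apxM (apxM (apx_real 2) apx_cos) apx_b)).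
  congr apx; first by apply/funext => tau; apply/funext => x; rewrite mulN1r.
  by apply/funext => x; rewrite mulN1r.
have w_le tau x : `|w_ tau x| <= eta^-1 by exact: norm_inv_le.
have w_le0 x : `|w x| <= eta^-1 by exact: norm_inv_le.
have eta'0 : 0 <= eta^-1 by rewrite invr_ge0 ltW.
exists (eta^-1 + 2 * (K * eta^-1)).
  by rewrite addr_ge0 ?mulr_ge0.
have KE : 0 <= K * eta^-1 by rewrite mulr_ge0.
move=> tau x ht; split; last 2 first.
- by apply: le_trans (w_le _ _) _; rewrite lerDl mulr_ge0.
- by apply: le_trans (w_le0 _) _; rewrite lerDl mulr_ge0.
rewrite w_diff; set Y := - _.
have -> : circ_sin tau * (Y * (w_ tau x * w x)) =
  circ_sin tau * ((Y * w x) * w_ tau x) by ring.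
move: (ht) => /andP[t0 t1]; have [_ h2 _] := hK _ x ht.
have hs : `|circ_sin tau| <= 2 * tau.
  have hh : 0 < 1 + tau ^+ 2 by rewrite ltr_wpDr ?sqr_ge0.
  rewrite /circ_sin ger0_norm; last by rewrite divr_ge0 ?(ltW hh) // mulr_ge0 ?(ltW t0).
  by rewrite ler_pdivrMr // ler_peMr ?mulr_ge0 ?(ltW t0) // lerDl sqr_ge0.
apply: le_trans (_ : 2 * tau * (K * eta^-1) <= _); last first.
  have -> : 2 * tau * (K * eta^-1) = 2 * (K * eta^-1) * tau by ring.
  by rewrite ler_wpM2r ?(ltW t0) // lerDr.
rewrite normrM; apply: ler_pM => //.
by rewrite normrM; apply: ler_pM.
Qed.

(** The derivative at [tau = 0] of [moved_mean], a function of [tau] that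
    vanishes identically.  The difference quotients are bounded functions that
    converge uniformly, so their means converge. *)
Lemma stein_limit :
  mean P (fun x => D x * w x ^+ a) =
  (2 * a%:R) * mean P (fun x => b x ^+ 2 * w x ^+ a.+1).
Proof.
have mean_b : mean P (fun x => b x * w x ^+ a) = 0.
  have := moved_mean 0; congr (_ = _); apply: mean_ext => x.
  by rewrite /w /moved /circ_sin /circ_cos !mulr0 !mul0r !addr0.
pose H tau x := (- 2 * circ_sin tau * b x + circ_cos tau * D x) * w_ tau x ^+ a
  + b x * ((- (circ_sin tau * D x + 2 * circ_cos tau * b x) * (w_ tau x * w x)) *
    \sum_(i < a) w_ tau x ^+ (a.-1 - i) * w x ^+ i).
pose H0 x := (- 2 * 0 * b x + 1 * D x) * w x ^+ a
  + b x * ((- (0 * D x + 2 * 1 * b x) * (w x * w x)) *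
    \sum_(i < a) w x ^+ (a.-1 - i) * w x ^+ i).
have bD0 c1 c2 : bounded_meas (fun x => c1 * D x + c2 * b x).
  by apply: bmD; apply: bmZ.
have bH0 : bounded_meas H0.
  apply: bmD; apply: bmM => //.
  - by have := bD0 1 (- 2 * 0); congr bounded_meas; apply/funext => x; rewrite addrC.
  - exact: bmX.
  - apply: bmM; last first.
      by apply: bm_sum => i; apply: bmM; apply: bmX.
    apply: bmM; last exact: bmM.
    have := bmZ (-1) (bD0 0 (2 * 1)); congr bounded_meas.
    by apply/funext => x; rewrite mulN1r.
have bH tau : bounded_meas (H tau).
  apply: bmD; apply: bmM => //.
  - by have := bD0 (circ_cos tau) (- 2 * circ_sin tau); congr bounded_meas; apply/funext => x; rewrite addrC.
  - exact: bmX.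
  - apply: bmM; last first.
      by apply: bm_sum => i; apply: bmM; apply: bmX.
    apply: bmM; last exact: bmM.
    have := bmZ (-1) (bD0 (circ_sin tau) (2 * circ_cos tau)); congr bounded_meas.
    by apply/funext => x; rewrite mulN1r.
have aH : apx H H0.
  have a1 : apx (fun tau x => - (circ_sin tau * D x + 2 * circ_cos tau * b x))
      (fun x => - (0 * D x + 2 * 1 * b x)).
    have := apxM (apx_real (-1)) (apxD (apxM apx_sin apx_D)
      (apxM (apxM (apx_real 2) apx_cos) apx_b)).
    congr apx; first by apply/funext => tau; apply/funext => x; rewrite mulN1r.
    by apply/funext => x; rewrite mulN1r.
  apply: apxD; apply: apxM.
  - apply: apxD; apply: apxM => //; exact: apxM (apx_real (-2)) apx_sin.
  - exact: apxX apx_w.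
  - exact: apx_b.
  - apply: apxM; first exact: apxM a1 (apxM apx_w apx_w1).
    by apply: apx_sum => i; apply: apxM; [exact: apxX apx_w|exact: apxX apx_w1].
have mH tau : 0 < tau <= 1 -> mean P (H tau) = 0.
  move=> /andP[t0 t1]; have s_neq0 : circ_sin tau != 0.
    rewrite /circ_sin mulf_neq0 ?invr_neq0 ?mulf_neq0 ?gt_eqF //.
    by rewrite ltr_wpDr ?sqr_ge0.
  apply: (mulfI s_neq0); rewrite mulr0 -meanZ //.
  rewrite -[RHS](subrr 0) -{1}(moved_mean tau) -mean_b -meanB; last 2 first.
  - apply: bmM; last by apply: bmX; exact: bw_.
    apply: bmD => //; apply: bmZ.
    by have := bD0 (circ_cos tau) (- 2 * circ_sin tau); congr bounded_meas; apply/funext => x; rewrite addrC.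
  - by apply: bmM => //; exact: bmX.
  apply: mean_ext => x; rewrite -/(w_ tau x) /H.
  have -> : circ_sin tau * ((- 2 * circ_sin tau * b x + circ_cos tau * D x) * w_ tau x ^+ a +
    b x * (- (circ_sin tau * D x + 2 * circ_cos tau * b x) * (w_ tau x * w x) *
     (\sum_(i < a) w_ tau x ^+ (a.-1 - i) * w x ^+ i))) =
     circ_sin tau * (- 2 * circ_sin tau * b x + circ_cos tau * D x) * w_ tau x ^+ a
     + b x * ((circ_sin tau * (- (circ_sin tau * D x + 2 * circ_cos tau * b x) * (w_ tau x * w x))) *
     (\sum_(i < a) w_ tau x ^+ (a.-1 - i) * w x ^+ i)) by ring.
  by rewrite -w_diff -subrXX; ring.
have H00 : mean P H0 = 0 by exact: apx_mean aH bH0 (fun tau _ => bH tau) mH.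
apply/eqP; rewrite -subr_eq0 -[X in _ == X]H00 -meanZ; last by apply: bmM; apply: bmX.
rewrite -meanB; last 2 first.
- by apply: bmM => //; exact: bmX.
- by apply: bmZ; apply: bmM; apply: bmX.
apply/eqP; apply: mean_ext => x; rewrite /H0.
have -> : \sum_(i < a) w x ^+ (a.-1 - i) * w x ^+ i = a%:R * w x ^+ a.-1.
  rewrite (eq_bigr (fun=> w x ^+ a.-1)); last first.
    move=> i _; rewrite -exprD subnK // -ltnS prednK ?ltn_ord //.
    exact: leq_trans (ltn_ord i).
  by rewrite sumr_const card_ord -[LHS]mulr_natl.
case: (a) => [|k]; first by rewrite !mul0r; ring.
by rewrite [k.+1.-1]/= ![w x ^+ k.+2]exprS ![w x ^+ k.+1]exprS; ring.
Qed.

End SteinLimit.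

Section SteinSphere.
Context d (T : measurableType d) (R : realType) (P : probability T R).
Local Notation C := R[i].
Local Open Scope complex_scope.
Local Open Scope sesquilinear_scope.

Definition nsq (z : C) : R := complex.Re z ^+ 2 + complex.Im z ^+ 2.

Lemma nsq_ge0 z : 0 <= nsq z.
Proof. by rewrite /nsq addr_ge0 ?sqr_ge0. Qed.

Lemma nsqM z z' : nsq (z * z') = nsq z * nsq z'.
Proof. by case: z z' => a b [c e]; rewrite /nsq /=; ring. Qed.

Lemma nsq_conj z : nsq (Num.conj z) = nsq z.
Proof. by rewrite conjCE /nsq; case: z => a b /=; ring. Qed.

Definition cross (p m : C) : R :=
  complex.Re p * complex.Re m + complex.Im p * complex.Im m.

Lemma cross_sqr_le (p m : C) : (cross p m) ^+ 2 <= nsq p * nsq m.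
Proof.
rewrite /cross /nsq -subr_ge0; case: p m => a b [c e] /=.
have -> : (a ^+ 2 + b ^+ 2) * (c ^+ 2 + e ^+ 2) - (a * c + b * e) ^+ 2 =
  (a * e - b * c) ^+ 2 by ring.
exact: sqr_ge0.
Qed.

(** Here [(p, m)] is mapped to [(cos p - sin m, - (cos m + sin p))] for the
    angle whose half has the tangent [tau]. *)
Lemma reflected_nsq (tau : R) (p m : C) :
  let m' := m - (2 / (1 + tau ^+ 2))%:C * (tau%:C * p + m) in
  nsq m' = nsq m + circ_sin tau * (circ_sin tau * (nsq p - nsq m) +
    2 * circ_cos tau * cross p m).
Proof.
have h : 1 + tau ^+ 2 != 0 by rewrite gt_eqF // ltr_wpDr ?sqr_ge0.
case: p m => a b [c e]; rewrite /nsq /cross /circ_sin /circ_cos /=.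
by field.
Qed.

Lemma reflected_cross (tau : R) (p m : C) :
  let t := (2 / (1 + tau ^+ 2))%:C * (tau%:C * p + m) in
  cross (p - tau%:C * t) (m - t) =
  - (cross p m + circ_sin tau * (- 2 * circ_sin tau * cross p m +
      circ_cos tau * (nsq p - nsq m))).
Proof.
have h : 1 + tau ^+ 2 != 0 by rewrite gt_eqF // ltr_wpDr ?sqr_ge0.
case: p m => a b [c e]; rewrite /nsq /cross /circ_sin /circ_cos /=.
by field.
Qed.

Section Pair.
Variables (n : nat) (i j : 'I_n) (v : C).
Hypotheses (ij : i != j) (v1 : nsq v = 1).

Definition pair_axis (tau : R) : 'rV[C]_n :=
  \row_k (if k == i then tau%:C else if k == j then v else 0).

(** The coordinates [i] and [j] are reflected in the line orthogonal to [(tau, v)];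
    the phase [v] selects which part of their product [stein_pair] sees. *)
Definition pair_reflection (tau : R) : 'M[C]_n :=
  1%:M - (2 / (1 + tau ^+ 2))%:C *: ((pair_axis tau)^t* *m pair_axis tau).

Lemma sqn_pair_axis tau : sqn (pair_axis tau) = 1 + tau ^+ 2.
Proof.
rewrite /sqn (bigD1 i) //= (bigD1 j) 1?eq_sym //= big1 => [|k].
  rewrite !mxE eqxx [j == i]eq_sym (negbTE ij) eqxx /= -/(nsq v) v1.
  by ring.
by move=> /andP[/negbTE ki /negbTE kj]; rewrite mxE ki kj /= expr0n /= addr0.
Qed.

Lemma pair_reflection_unitary tau : pair_reflection tau \is unitarymx.
Proof.
have h : 1 + tau ^+ 2 != 0 by rewrite gt_eqF // ltr_wpDr ?sqr_ge0.
have := @rank1_unitary _ _ (pair_axis tau) ((1 + tau ^+ 2) / 2)%:C.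
rewrite -fmorphV /= invf_div; apply.
by rewrite conjC_real -rmorphD /= sqn_pair_axis -splitr.
Qed.

Lemma pair_reflection_id (x : 'rV[C]_n) tau : x 0 i = 0 -> x 0 j = 0 ->
  x *m pair_reflection tau = x.
Proof.
move=> xi xj; rewrite /pair_reflection mulmxBr mulmx1 -scalemxAr mulmxA.
suff -> : x *m (pair_axis tau)^t* = 0 by rewrite mul0mx scaler0 subr0.
apply/rowP => k; rewrite !mxE big1 // => l _; rewrite !mxE.
by case: eqP => [->|_]; [rewrite xi mul0r|case: eqP => [->|_];
  rewrite ?xj ?mul0r // conjC0 mulr0].
Qed.

Lemma pair_reflectionE (x : 'rV[C]_n) tau k :
  (x *m pair_reflection tau) 0 k = x 0 k - (2 / (1 + tau ^+ 2))%:C *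
    (tau%:C * x 0 i + conjc v * x 0 j) * pair_axis tau 0 k.
Proof.
rewrite /pair_reflection mulmxBr mulmx1 -scalemxAr mulmxA.
have -> : x *m (pair_axis tau)^t* = (tau%:C * x 0 i + conjc v * x 0 j)%:M.
  apply/rowP => l; rewrite !ord1 !mxE eqxx mulr1n.
  rewrite (bigD1 i) //= (bigD1 j) 1?eq_sym //= big1 ?addr0 => [|l'].
    rewrite !mxE eqxx [j == i]eq_sym (negbTE ij) eqxx conjC_real conjCE.
    by rewrite mulrC [x 0 j * _]mulrC.
  by move=> /andP[/negbTE ki /negbTE kj]; rewrite !mxE ki kj conjC0 mulr0.
by rewrite mul_scalar_mx !mxE mulrA.
Qed.
End Pair.

Variables (n : nat) (eta : T -> 'rV[C]_n) (IL IQ : {set 'I_n}).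
Hypothesis meas_eta : mmeas eta.
Hypothesis disj : forall k, k \in IL -> k \notin IQ.
Hypothesis norm1 : forall x,
  \sum_(i in IL) nsq (eta x 0 i) + \sum_(j in IQ) nsq (eta x 0 j) = 1.

(** Measurability of a function of a vector is tested on random vectors with
    measurable entries. *)
Definition vmeas (f : 'rV[C]_n -> R) := forall d' (T' : measurableType d')
  (u : T' -> 'rV[C]_n), mmeas u -> measurable_fun setT (fun x => f (u x)).

(** The law of [eta] is invariant under the reflections that mix a coordinate
    inside [IQ] with one outside. *)
Hypothesis reflection_inv : forall i j v tau, i \in IL -> j \in IQ ->
  nsq v = 1 -> forall f, vmeas f ->
  bounded_meas (fun x => f (eta x *m pair_reflection i j v tau)) ->
  bounded_meas (fun x => f (eta x)) ->
  mean P (fun x => f (eta x *m pair_reflection i j v tau)) =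
  mean P (fun x => f (eta x)).

Variable c : R.
Hypothesis c0 : 0 < c.

Let q (u : 'rV[C]_n) := \sum_(k in IQ) nsq (u 0 k).
Let s x := q (eta x).
Let w x := (s x + c)^-1.

Let q_ge0 u : 0 <= q u.
Proof. by apply: sumr_ge0 => k _; exact: nsq_ge0. Qed.

Let nsq_meas d' (T' : measurableType d') (f : T' -> C) : cmeas f ->
  measurable_fun setT (fun x => nsq (f x)).
Proof.
by move=> [f1 f2]; apply: measurable_funD; apply: measurable_funX.
Qed.

Let cross_meas d' (T' : measurableType d') (f g : T' -> C) : cmeas f -> cmeas g ->
  measurable_fun setT (fun x => cross (f x) (g x)).
Proof.
by move=> [f1 f2] [g1 g2]; apply: measurable_funD; apply: measurable_funM.
Qed.

Let q_meas : vmeas q.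
Proof.
move=> d' T' u mu; rewrite /q.
under eq_fun do rewrite big_mkcond.
apply: measurable_sum => k; case: (k \in IQ); last exact: measurable_cst.
exact: nsq_meas.
Qed.

Let le1_L x k : k \in IL -> nsq (eta x 0 k) <= 1.
Proof.
move=> kL; rewrite -(norm1 x) (bigD1 k) //= -addrA lerDl addr_ge0 ?q_ge0 //.
by apply: sumr_ge0 => l _; exact: nsq_ge0.
Qed.

Let le1_Q x k : k \in IQ -> nsq (eta x 0 k) <= 1.
Proof.
move=> kQ; rewrite -(norm1 x) [X in _ <= _ + X](bigD1 k) //= addrCA lerDl.
by rewrite addr_ge0 //; apply: sumr_ge0 => l _; exact: nsq_ge0.
Qed.

Let s_le1 x : s x <= 1.
Proof.
by rewrite -(norm1 x) lerDr; apply: sumr_ge0 => l _; exact: nsq_ge0.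
Qed.

Let bm_s : bounded_meas s.
Proof.
split; first exact: q_meas.
by exists 1 => x; rewrite ger0_norm ?q_ge0 ?s_le1.
Qed.

Let bm_nsq k : (k \in IL) || (k \in IQ) -> bounded_meas (fun x => nsq (eta x 0 k)).
Proof.
move=> kLQ; split; first exact: nsq_meas.
exists 1 => x; rewrite ger0_norm ?nsq_ge0 //.
by case/orP: kLQ; [exact: le1_L|exact: le1_Q].
Qed.

Let bm_w : bounded_meas w.
Proof. by apply: bm_inv => // x; exact: q_ge0. Qed.

Section StarredPair.
Variables (i j : 'I_n) (v : C) (a : nat).
Hypotheses (iL : i \in IL) (jQ : j \in IQ) (v1 : nsq v = 1).

Let ij : i != j.
Proof. by apply: contraTneq jQ => <-; exact: disj. Qed.

Let b x := cross (eta x 0 i) (conjc v * eta x 0 j).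
Let D x := nsq (eta x 0 i) - nsq (eta x 0 j).

Let nsq_m (z : C) : nsq (conjc v * z) = nsq z.
Proof. by rewrite nsqM -conjCE nsq_conj v1 mul1r. Qed.

Let conj_v : conjc v * v = 1.
Proof.
by rewrite mulrC -conjCE mul_conjC -/(nsq v) v1.
Qed.

Lemma bm_cross : bounded_meas b.
Proof.
split.
  by apply: cross_meas => //; apply: cmeasM => //; exact: cmeas_cst.
exists 1 => x; rewrite -(@ler_pXn2r _ 2) ?nnegrE // expr1n.
rewrite real_normK ?num_real //; apply: le_trans (cross_sqr_le _ _) _.
rewrite nsq_m -[leRHS]mulr1; apply: ler_pM; rewrite ?nsq_ge0 //.
  exact: le1_L.
exact: le1_Q.
Qed.

Let bm_b : bounded_meas b. Proof. exact: bm_cross. Qed.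

Let bm_D : bounded_meas D.
Proof. by apply: bmB; apply: bm_nsq; rewrite ?iL ?jQ ?orbT. Qed.

Let t tau x : C := (2 / (1 + tau ^+ 2))%:C *
  (tau%:C * eta x 0 i + conjc v * eta x 0 j).

Let reflect_i tau x : (eta x *m pair_reflection i j v tau) 0 i =
  eta x 0 i - tau%:C * t tau x.
Proof. by rewrite pair_reflectionE // mxE eqxx [_ * tau%:C]mulrC. Qed.

Let reflect_j tau x : conjc v * (eta x *m pair_reflection i j v tau) 0 j =
  conjc v * eta x 0 j - t tau x.
Proof.
rewrite pair_reflectionE // mxE [j == i]eq_sym (negbTE ij) eqxx -/(t tau x).
by rewrite mulrBr mulrCA conj_v mulr1.
Qed.

Let reflect_q tau x : q (eta x *m pair_reflection i j v tau) =
  moved b D s tau x.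
Proof.
rewrite /q /moved /s /q (bigD1 j) //= [in RHS](bigD1 j) //=.
rewrite -[nsq (_ 0 j)]nsq_m reflect_j reflected_nsq !nsq_m.
rewrite [X in _ + X = _](_ : _ =
    \sum_(k in IQ | k != j) nsq (eta x 0 k)); first by rewrite addrAC.
apply: eq_bigr => k /andP[kQ kj]; rewrite pair_reflectionE // mxE (negbTE kj).
case: eqP => [ki|_]; last by rewrite mulr0 subr0.
by move: (disj iL); rewrite -ki kQ.
Qed.

(** By invariance, the mean of [b / (s + c) ^ a] after a reflection does not
    depend on the angle; this is its derivative at the angle 0.  The mean itself
    vanishes, since the reflection at the angle 0 changes the sign of [b]. *)
Lemma stein_pair : mean P (fun x => D x * w x ^+ a) =
  (2 * a%:R) * mean P (fun x => b x ^+ 2 * w x ^+ a.+1).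
Proof.
have moved0 tau x : 0 <= moved b D s tau x by rewrite -reflect_q; exact: q_ge0.
pose f (u : 'rV[C]_n) := cross (u 0 i) (conjc v * u 0 j) * (q u + c)^-1 ^+ a.
have mf : vmeas f.
  move=> d' T' u mu; apply: measurable_funM.
    by apply: cross_meas => //; apply: cmeasM => //; exact: cmeas_cst.
  apply: measurable_funX; apply: measurable_invr_fun.
  by apply: measurable_funD; [exact: q_meas|exact: measurable_cst].
have fE tau x : f (eta x *m pair_reflection i j v tau) =
    - ((b x + circ_sin tau * (- 2 * circ_sin tau * b x + circ_cos tau * D x)) *
    (moved b D s tau x + c)^-1 ^+ a).
  rewrite /f reflect_i reflect_j reflected_cross reflect_q nsq_m.
  by rewrite -[RHS]mulNr.
have bm_moved tau : bounded_meas (moved b D s tau).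
  by apply: bmD => //; apply: bmZ; apply: bmD; apply: bmZ.
have bm_F tau : bounded_meas (fun x =>
    (b x + circ_sin tau * (- 2 * circ_sin tau * b x + circ_cos tau * D x)) *
    (moved b D s tau x + c)^-1 ^+ a).
  apply: bmM; last by apply: bmX; apply: bm_inv.
  by apply: bmD => //; apply: bmZ; apply: bmD; apply: bmZ.
have bm_f : bounded_meas (fun x => f (eta x)).
  by apply: bmM => //; apply: bmX.
have meanf tau : mean P (fun x =>
    (b x + circ_sin tau * (- 2 * circ_sin tau * b x + circ_cos tau * D x)) *
    (moved b D s tau x + c)^-1 ^+ a) = - mean P (fun x => f (eta x)).
  rewrite -(@reflection_inv i j v tau iL jQ v1 f mf _ bm_f); last first.
    have := bmZ (-1) (bm_F tau); congr bounded_meas; apply/funext => x.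
    by rewrite fE mulN1r.
  rewrite -[RHS]mulN1r -meanZ; last first.
    have := bmZ (-1) (bm_F tau); congr bounded_meas; apply/funext => x.
    by rewrite fE mulN1r.
  by apply: mean_ext => x; rewrite fE mulN1r opprK.
have f0 : mean P (fun x => f (eta x)) = 0.
  have := meanf 0; rewrite [LHS](_ : _ = mean P (fun x => f (eta x))).
    by lra.
  apply: mean_ext => x; rewrite /f /moved /circ_sin /circ_cos.
  by rewrite !mulr0 !mul0r !addr0.
apply: stein_limit => //; first by move=> x; exact: q_ge0.
by move=> tau; rewrite -[RHS]oppr0 -f0; exact: meanf.
Qed.
End StarredPair.

Let conj_i : nsq 'i = 1.
Proof. by rewrite /nsq /= expr0n /= add0r expr1n. Qed.

Let nsq1 : nsq 1 = 1.
Proof. by rewrite /nsq /= expr0n /= addr0 expr1n. Qed.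

(** The phases 1 and 'i give the squares of the real and of the imaginary part
    of a product, whose sum is the product of the squared moduli. *)
Lemma stein_pair_nsq i j a : i \in IL -> j \in IQ ->
  mean P (fun x => (nsq (eta x 0 i) - nsq (eta x 0 j)) * w x ^+ a) =
  a%:R * mean P (fun x => nsq (eta x 0 i) * nsq (eta x 0 j) * w x ^+ a.+1).
Proof.
move=> iL jQ.
have h1 := stein_pair a iL jQ nsq1; have h2 := stein_pair a iL jQ conj_i.
have -> : (fun x => nsq (eta x 0 i) * nsq (eta x 0 j) * w x ^+ a.+1) =
  (fun x => (cross (eta x 0 i) (conjc 1 * eta x 0 j)) ^+ 2 * w x ^+ a.+1 +
   (cross (eta x 0 i) (conjc 'i * eta x 0 j)) ^+ 2 * w x ^+ a.+1).
  apply/funext => x; rewrite -mulrDl; congr (_ * _); rewrite /cross /nsq.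
  by case: (eta x 0 i) (eta x 0 j) => a1 b1 [a2 b2] /=; ring.
have bmc v : nsq v = 1 -> bounded_meas (fun x =>
    (cross (eta x 0 i) (conjc v * eta x 0 j)) ^+ 2 * w x ^+ a.+1).
  by move=> v1; apply: bmM; apply: bmX => //; exact: bm_cross.
rewrite meanD; [lra|exact: bmc|exact: bmc].
Qed.

(** Summing over the pairs makes only [s] appear, since the coordinates outside
    [IQ] contribute [1 - s]. *)
Lemma stein_sphere a :
  #|IQ|%:R * mean P (fun x => w x ^+ a) -
  (#|IL| + #|IQ|)%:R * mean P (fun x => s x * w x ^+ a) =
  a%:R * mean P (fun x => s x * (1 - s x) * w x ^+ a.+1).
Proof.
have bmij i j : bounded_meas (fun x => if (i \in IL) && (j \in IQ) then
    (nsq (eta x 0 i) - nsq (eta x 0 j)) * w x ^+ a else 0).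
  case: (boolP ((i \in IL) && (j \in IQ))) => [/andP[iL jQ]|_]; last exact: bm_cst.
  by apply: bmM; [apply: bmB; apply: bm_nsq; rewrite ?iL ?jQ ?orbT|exact: bmX].
have bmij' i j : bounded_meas (fun x => if (i \in IL) && (j \in IQ) then
    nsq (eta x 0 i) * nsq (eta x 0 j) * w x ^+ a.+1 else 0).
  case: (boolP ((i \in IL) && (j \in IQ))) => [/andP[iL jQ]|_]; last exact: bm_cst.
  by apply: bmM; [apply: bmM; apply: bm_nsq; rewrite ?iL ?jQ ?orbT|exact: bmX].
have sumL x : \sum_(i in IL) nsq (eta x 0 i) = 1 - s x.
  by rewrite -(norm1 x) addrK.
have bwa : bounded_meas (fun x => w x ^+ a) by exact: bmX.
have bswa : bounded_meas (fun x => s x * w x ^+ a) by exact: bmM.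
have bss : bounded_meas (fun x => s x * (1 - s x) * w x ^+ a.+1).
  by apply: bmM; [apply: bmM => //; apply: bmB => //; exact: bm_cst|exact: bmX].
rewrite -(meanZ P _ bwa) -(meanZ P _ bswa) -(meanZ P _ bss).
rewrite -(meanB P (bmZ _ bwa) (bmZ _ bswa)).
transitivity (mean P (fun x => \sum_i \sum_j (if (i \in IL) && (j \in IQ) then
    (nsq (eta x 0 i) - nsq (eta x 0 j)) * w x ^+ a else 0))).
  apply: mean_ext => x.
  have -> : \sum_i \sum_j (if (i \in IL) && (j \in IQ) then
    (nsq (eta x 0 i) - nsq (eta x 0 j)) * w x ^+ a else 0) =
    \sum_(i in IL) \sum_(j in IQ) (nsq (eta x 0 i) - nsq (eta x 0 j)) * w x ^+ a.
    rewrite [RHS]big_mkcond; apply: eq_bigr => i _; case: (i \in IL) => /=.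
      by rewrite [RHS]big_mkcond.
    by rewrite big1.
  under eq_bigr do rewrite -mulr_suml sumrB sumr_const -mulr_natl.
  rewrite -mulr_suml sumrB -mulr_sumr sumL sumr_const -[_ *+ _]mulr_natl -/(q (eta x)) -/(s x).
  by rewrite natrD; ring.
transitivity (mean P (fun x => a%:R * \sum_i \sum_j (if (i \in IL) && (j \in IQ) then
    nsq (eta x 0 i) * nsq (eta x 0 j) * w x ^+ a.+1 else 0))); last first.
  apply: mean_ext => x; congr (_ * _).
  have -> : \sum_i \sum_j (if (i \in IL) && (j \in IQ) then
    nsq (eta x 0 i) * nsq (eta x 0 j) * w x ^+ a.+1 else 0) =
    \sum_(i in IL) \sum_(j in IQ) nsq (eta x 0 i) * nsq (eta x 0 j) * w x ^+ a.+1.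
    rewrite [RHS]big_mkcond; apply: eq_bigr => i _; case: (i \in IL) => /=.
      by rewrite [RHS]big_mkcond.
    by rewrite big1.
  under eq_bigr do rewrite -mulr_suml -mulr_sumr.
  by rewrite -mulr_suml -mulr_suml sumL [_ * q _]mulrC.
rewrite meanZ; last by apply: bm_sum => i; apply: bm_sum => j.
rewrite !mean_sum; [|by move=> i; apply: bm_sum => j|by move=> i; apply: bm_sum => j].
rewrite mulr_sumr; apply: eq_bigr => i _.
rewrite !mean_sum // mulr_sumr; apply: eq_bigr => j _.
case: (boolP ((i \in IL) && (j \in IQ))) => [/andP[iL jQ]|_].
  exact: stein_pair_nsq.
by rewrite mean_cst mulr0.
Qed.

Let M a := mean P (fun x => w x ^+ a).
Let N := (#|IL| + #|IQ|)%N.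
Let p := #|IQ|.

Let bm_wX a : bounded_meas (fun x => w x ^+ a). Proof. exact: bmX. Qed.
Let bm_swX k a : bounded_meas (fun x => s x ^+ k * w x ^+ a).
Proof. by apply: bmM; apply: bmX. Qed.

Let w_gt0 x : 0 < w x.
Proof. by rewrite invr_gt0 ltr_wpDl ?q_ge0. Qed.

Let sw x : s x * w x = 1 - c * w x.
Proof.
have h : s x + c != 0 by rewrite gt_eqF // ltr_wpDl ?q_ge0.
by rewrite /w; field.
Qed.

Let sw_le1 x : s x * w x <= 1.
Proof. by rewrite sw gerBl mulr_ge0 ?(ltW c0) ?(ltW (w_gt0 x)). Qed.

(** As [s * w = 1 - c * w], Stein's identity relates the negative moments of
    consecutive orders; the terms with an additional factor [s * w] are handled
    by [0 <= s * w <= 1]. *)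
Lemma negative_moment_upper a : (a < N)%N ->
  (p%:R - a.+1%:R) * M a.+1 <= (N%:R - a.+1%:R) * M a.
Proof.
move=> aN; have st := stein_sphere a.+1; rewrite -/p -/N -/(M a.+1) in st.
have h1 : mean P (fun x => s x * (1 - s x) * w x ^+ a.+2) <=
    M a.+1 - mean P (fun x => s x * w x ^+ a.+1).
  rewrite -meanB //; last exact: bm_swX 1 a.+1.
  apply: mean_le; first by apply: bmM; [apply: bmM => //; apply: bmB => //; exact: bm_cst|].
    by apply: bmB => //; exact: bm_swX 1 a.+1.
  move=> x; have -> : s x * (1 - s x) * w x ^+ a.+2 =
    (s x * w x) * ((1 - s x) * w x ^+ a.+1) by rewrite [w x ^+ a.+2]exprS; ring.
  have -> : w x ^+ a.+1 - s x * w x ^+ a.+1 = (1 - s x) * w x ^+ a.+1 by ring.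
  by rewrite ler_piMl // mulr_ge0 ?subr_ge0 // exprn_ge0 // ltW.
have h2 : mean P (fun x => s x * w x ^+ a.+1) <= M a.
  apply: mean_le => //; first exact: bm_swX 1 a.+1.
  by move=> x; rewrite exprS mulrA ler_piMl // exprn_ge0 // ltW.
have aN' : 0 <= N%:R - a.+1%:R :> R by rewrite subr_ge0 ler_nat.
have h3 := ler_wpM2l aN' h2.
have h4 := ler_wpM2l (ler0n R a.+1) h1.
by rewrite -st in h4; nra.
Qed.

Lemma negative_moment_lower a : (a <= N)%N ->
  (a%:R - p%:R) * M a <= a%:R * c * M a.+1.
Proof.
move=> aN; have st := stein_sphere a; rewrite -/p -/N -/(M a) in st.
have h1 : mean P (fun x => s x * (1 - s x) * w x ^+ a.+1) =
    M a - c * M a.+1 - mean P (fun x => s x ^+ 2 * w x ^+ a.+1).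
  rewrite -meanZ // -meanB //; last exact: bmZ.
  rewrite -meanB //; last by apply: bmB => //; exact: bmZ.
  apply: mean_ext => x; rewrite !exprS.
  have := sw x; move: (w x) (s x) => w' s' h.
  have -> : s' * (1 - s') * (w' * w' ^+ a) = (s' * w') * w' ^+ a - s' ^+ 2 * w' * w' ^+ a by ring.
  by rewrite h; ring.
have h2 : mean P (fun x => s x ^+ 2 * w x ^+ a.+1) <= mean P (fun x => s x * w x ^+ a).
  apply: mean_le => //; first exact: bm_swX 1 a.
  move=> x; have -> : s x ^+ 2 * w x ^+ a.+1 = (s x * w x) * (s x * w x ^+ a).
    by rewrite [w x ^+ a.+1]exprS; ring.
  by rewrite ler_piMl // mulr_ge0 ?q_ge0 // exprn_ge0 // ltW.
have h3 : 0 <= mean P (fun x => s x * w x ^+ a).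
  apply: Rintegral_ge0 => x _.
  by rewrite mulr_ge0 ?q_ge0 // exprn_ge0 // ltW.
have aN' : a%:R <= N%:R :> R by rewrite ler_nat.
have h4 := ler_wpM2l (ler0n R a) h2.
have h5 := ler_wpM2r h3 aN'.
by rewrite h1 in st; nra.
Qed.

End SteinSphere.

(** * Projections of a random unit vector *)

Section SplitBasis.
Variables (R : realType) (n : nat).
Local Notation C := R[i].
Local Open Scope complex_scope.
Local Open Scope sesquilinear_scope.

Lemma sqn_nsq (x : 'rV[C]_n) : sqn x = \sum_j nsq (x 0 j).
Proof. by []. Qed.

Definition coord_proj (I : {set 'I_n}) : 'M[C]_n :=
  diag_mx (\row_k (k \in I)%:R).

Lemma coord_projE m (A : 'M[C]_(m, n)) (I : {set 'I_n}) i k :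
  (A *m coord_proj I) i k = if k \in I then A i k else 0.
Proof.
rewrite mul_mx_diag !mxE; case: (k \in I); first by rewrite mulr1.
by rewrite mulr0.
Qed.

Lemma rank_coord_proj_le (I : {set 'I_n}) : (\rank (coord_proj I) <= #|I|)%N.
Proof.
have -> : coord_proj I = (\sum_(k in I) delta_mx k k)%R.
  apply/matrixP => i j; rewrite summxE !mxE.
  have [iI|iI] := boolP (i \in I); last first.
    rewrite mul0rn big1 // => k kI; rewrite !mxE; case: eqP => // ik.
    by move: iI; rewrite ik kI.
  rewrite (bigD1 i) //= big1 ?addr0 => [|k /andP[_ ki]]; rewrite !mxE ?eqxx ?[j == _]eq_sym.
    by case: (i == j).
  by rewrite [i == k]eq_sym (negbTE ki).
rewrite -sum1_card; elim/big_rec2: _ => [|k r A _ ih]; first by rewrite mxrank0.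
by apply: leq_trans (mxrank_add _ _) _; rewrite leq_add // mxrank_delta.
Qed.

Lemma rank_coord_proj (I : {set 'I_n}) : \rank (coord_proj I) = #|I|.
Proof.
apply/eqP; rewrite eqn_leq rank_coord_proj_le /=.
have h : coord_proj I + coord_proj (~: I) = 1%:M.
  apply/matrixP => i j; rewrite !mxE inE.
  by case: (i \in I); rewrite ?mul0rn ?addr0 ?add0r.
have := mxrank_add (coord_proj I) (coord_proj (~: I)).
rewrite h mxrank1 => le_n; have le_c := rank_coord_proj_le (~: I).
have := cardsC I; rewrite card_ord => ci; rewrite -(leq_add2r #|~: I|) ci.
by apply: leq_trans le_n _; rewrite leq_add2l.
Qed.

(** Orthogonal projectors with orthogonal ranges are simultaneously
    diagonalizable: [Q - P] is hermitian with eigenvalues 0, 1 and -1, and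
    both projectors are polynomials in it. *)
Lemma split_basis (P Q : 'M[C]_n) : projector P -> projector Q -> P *m Q = 0 ->
  exists (B : 'M[C]_n) (IP IQ : {set 'I_n}), [/\ B \is unitarymx,
    forall k, k \in IP -> k \notin IQ,
    P = B^t* *m coord_proj IP *m B & Q = B^t* *m coord_proj IQ *m B].
Proof.
move=> [PP Ps] [QQ Qs] PQ; have QP : Q *m P = 0 by rewrite -Ps -Qs -adjM PQ adj0.
pose S := Q - P.
have Sn : S \is normalmx.
  apply/normalmxP; rewrite -[S ^t _ _]/(S^t*) /S adjB Ps Qs //.
have /orthomx_spectralP SE := Sn.
set B := spectralmx S in SE; set lam := spectral_diag S in SE.
have BU : B \is unitarymx by exact: spectral_unitarymx.
rewrite invmx_unitary // in SE.
have BB : B *m B^t* = 1%:M by exact/unitarymxP.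
have BB' : B^t* *m B = 1%:M by apply/mulmx1C.
have conjE A : S = B^t* *m A *m B -> A = B *m S *m B^t*.
  by move=> ->; rewrite !mulmxA BB mul1mx -mulmxA BB mulmx1.
have SS : S *m S = Q + P.
  by rewrite /S mulmxBl !mulmxBr QQ PP PQ QP subr0 sub0r opprK.
have SSS : S *m S *m S = S.
  by rewrite SS /S mulmxBr !mulmxDl QQ PP PQ QP addr0 add0r.
have dl : diag_mx lam = B *m S *m B^t* by exact: conjE.
have d2 : diag_mx lam *m diag_mx lam = B *m (S *m S) *m B^t*.
  by rewrite dl !mulmxA -[_ *m B^t* *m B]mulmxA BB' mulmx1.
have d3 : diag_mx lam *m diag_mx lam *m diag_mx lam = diag_mx lam.
  have e X : B *m X *m B^t* *m (B *m S *m B^t*) = B *m (X *m S) *m B^t*.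
    by rewrite !mulmxA -[_ *m B^t* *m B]mulmxA BB' mulmx1.
  by rewrite d2 dl e SSS.
have lam3 k : lam 0 k * lam 0 k * lam 0 k = lam 0 k.
  move/matrixP: d3 => /(_ k k); rewrite !mulmx_diag !mxE eqxx !mulr1n //.
have lamP k : [\/ lam 0 k = 0, lam 0 k = 1 | lam 0 k = -1].
  have : lam 0 k * (lam 0 k - 1) * (lam 0 k + 1) = 0.
    have := lam3 k; move: (lam 0 k) => z h.
    have -> : z * (z - 1) * (z + 1) = z * z * z - z by ring.
    by rewrite h subrr.
  move/eqP; rewrite !mulf_eq0 subr_eq0 addr_eq0 => /orP[/orP[]|] /eqP h.
  - by constructor 1.
  - by constructor 2.
  - by constructor 3.
have m1 : (-1 == 1 :> C) = false.
  by rewrite eq_sym -addr_eq0 -(natrD _ 1 1) pnatr_eq0.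
exists B, (finset (fun k => lam 0 k == -1)), (finset (fun k => lam 0 k == 1)).
split => //.
- by move=> k; rewrite !inE => /eqP ->; rewrite m1.
- transitivity (B^t* *m (2^-1 *: (diag_mx lam *m diag_mx lam - diag_mx lam)) *m B).
    rewrite -scalemxAr -scalemxAl.
    rewrite mulmxBr mulmxBl -SE d2 !mulmxA BB' mul1mx.
    rewrite -[_ *m B^t* *m B]mulmxA BB' mulmx1 SS /S.
    by apply/matrixP => i j; rewrite !mxE; field.
  apply: (congr1 (fun X => B^t* *m X *m B)).
  apply/matrixP => i j; rewrite mulmx_diag !mxE inE.
  case: (i == j); rewrite ?mulr1n ?mulr0n ?subr0 ?mulr0 //.
  case: (lamP i) => ->.
  + by rewrite mul0r subr0 mulr0 eq_sym oppr_eq0 oner_eq0.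
  + by rewrite mulr1 subrr mulr0 eq_sym m1.
  + by rewrite mulrNN mulr1 eqxx opprK -[1 + 1]/(2%:R) mulVf // pnatr_eq0.
- transitivity (B^t* *m (2^-1 *: (diag_mx lam *m diag_mx lam + diag_mx lam)) *m B).
    rewrite -scalemxAr -scalemxAl.
    rewrite mulmxDr mulmxDl -SE d2 !mulmxA BB' mul1mx.
    rewrite -[_ *m B^t* *m B]mulmxA BB' mulmx1 SS /S.
    by apply/matrixP => i j; rewrite !mxE; field.
  apply: (congr1 (fun X => B^t* *m X *m B)).
  apply/matrixP => i j; rewrite mulmx_diag !mxE inE.
  case: (i == j); rewrite ?mulr1n ?mulr0n ?addr0 ?mulr0 //.
  case: (lamP i) => ->.
  + by rewrite mul0r addr0 mulr0 eq_sym oner_eq0.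
  + by rewrite mulr1 eqxx -[1 + 1]/(2%:R) mulVf // pnatr_eq0.
  + by rewrite mulrNN mulr1 subrr mulr0 m1.
Qed.
End SplitBasis.

Section NegativePower.
Variable R : realType.

(** [x ^ - al] as an extended real, infinite at 0. *)
Definition negpow (al : nat) (x : R) : \bar R :=
  if x <= 0 then +oo%E else (x^-1 ^+ al)%:E.

Lemma negpow_ge0 al x : (0 <= negpow al x)%E.
Proof.
rewrite /negpow; case: (leP x 0) => x0; first exact: le0y.
by rewrite lee_fin exprn_ge0 // invr_ge0 ltW.
Qed.

Lemma negpow_pos al x : 0 < x -> negpow al x = (x^-1 ^+ al)%:E.
Proof. by rewrite /negpow ltNge; case: leP. Qed.

Lemma le_negpow al x y : x <= y -> (negpow al y <= negpow al x)%E.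
Proof.
move=> xy; rewrite /negpow; case: (leP x 0) => x0; first by rewrite leey.
have y0 : 0 < y by exact: lt_le_trans x0 xy.
rewrite [y <= 0]leNgt y0 /= lee_fin lerXn2r ?nnegrE ?invr_ge0 ?(ltW x0) ?(ltW y0) //.
by rewrite lef_pV2.
Qed.

Lemma negpowM al x y : 0 < x -> negpow al (x * y) = (negpow al x * negpow al y)%E.
Proof.
move=> x0; rewrite [in RHS]negpow_pos // /negpow pmulr_rle0 //.
case: leP => y0; last by rewrite -EFinM invfM exprMn.
by rewrite gt0_muley // lte_fin exprn_gt0 // invr_gt0.
Qed.

Lemma measurable_negpow d (T : measurableType d) al (f : T -> R) :
  measurable_fun setT f -> measurable_fun setT (fun t => negpow al (f t)).
Proof.
move=> mf; apply: measurable_fun_ifT => //.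
- by apply: measurable_fun_ler => //; exact: measurable_cst.
- by apply/measurable_EFinP; apply: measurable_funX; exact: measurable_invr_fun.
Qed.

(** Both recursions telescope to ratios of binomial coefficients. *)
Lemma iterate_upper (M : nat -> R) (N p : nat) : (p <= N)%N -> M 0%N = 1 ->
  (forall a, (a < N)%N ->
    (p%:R - a.+1%:R) * M a.+1 <= (N%:R - a.+1%:R) * M a) ->
  forall a, (a < p)%N -> 'C(p.-1, a)%:R * M a <= 'C(N.-1, a)%:R.
Proof.
move=> pN M0 h; elim => [|a ih] ap; first by rewrite !bin0 M0 mulr1.
have aN : (a < N)%N by apply: leq_trans pN; exact: ltnW.
have := ih (ltnW ap) => {}ih; have ha := h a aN.
rewrite -(@ler_pM2l _ a.+1%:R) ?ltr0Sn // mulrA -!natrM !mul_bin_left.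
have -> : (p.-1 - a)%N = (p - a.+1)%N by lia.
have -> : (N.-1 - a)%N = (N - a.+1)%N by lia.
rewrite !natrM (natrB _ (ltnW ap)) (natrB _ aN) [_ * 'C(p.-1, a)%:R]mulrC -mulrA.
have NA : (0 : R) <= N%:R - a.+1%:R by rewrite subr_ge0 ler_nat.
apply: le_trans (ler_wpM2l (ler0n _ _) ha) _.
by rewrite mulrCA; apply: ler_wpM2l.
Qed.

Lemma iterate_lower (M : nat -> R) (N p : nat) (c : R) : 0 < c ->
  (forall a, (a <= N)%N -> (a%:R - p%:R) * M a <= a%:R * c * M a.+1) ->
  forall a, (p <= a)%N -> (a <= N)%N ->
  M p.+1 <= 'C(a, p)%:R * c ^+ (a - p) * M a.+1.
Proof.
move=> c0 h; elim => [|a ih].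
  by rewrite leqn0 => /eqP -> _; rewrite bin0 subnn !mul1r.
rewrite leq_eqVlt => /predU1P[-> _|]; first by rewrite binn subnn !mul1r.
rewrite ltnS => pa aN; have := ih pa (ltnW aN) => {}ih.
apply: le_trans ih _; have ha := h _ aN.
have pa0 : (0 : R) < a.+1%:R - p%:R by rewrite subr_gt0 ltr_nat ltnS.
rewrite -(ler_pM2l pa0).
have -> : (a.+1%:R - p%:R) * ('C(a.+1, p)%:R * c ^+ (a.+1 - p) * M a.+2) =
   'C(a, p)%:R * c ^+ (a - p) * (a.+1%:R * c * M a.+2).
  have := mul_bin_down a.+1 p; rewrite /= => /(congr1 (fun k => k%:R : R)).
  rewrite !natrM natrB ?(leq_trans pa) // => hb.
  by rewrite subSn // exprS !mulrA -hb; ring.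
rewrite mulrCA; apply: ler_wpM2l => //.
by rewrite mulr_ge0 ?ler0n // exprn_ge0 // ltW.
Qed.

Lemma leq_bin_exp2 n m : ('C(n, m) <= 2 ^ n)%N.
Proof.
have [mn|nm] := leqP m n; last by rewrite bin_small.
have := Pascal 1 1 n; rewrite addn1 => ->.
rewrite (bigD1 (Ordinal (mn : (m < n.+1)%N))) //= !exp1n !muln1.
exact: leq_addr.
Qed.
End NegativePower.

Section RandomProjection.
Variables (R : realType) (n r : nat).
Local Notation C := R[i].
Local Notation GG := (utuple R n r).
Variable Lam : probability GG R.
Hypothesis Lam_inv : forall (h : GG) (A : set GG), measurable A ->
  Lam ((fun g => (h * g)%g) @^-1` A) = Lam A.
Local Open Scope sesquilinear_scope.

(** Adding a constant makes a bounded function nonnegative, which is what the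
    invariance of integrals asks for. *)
Lemma mean_kap_mulr (D : 'I_r -> seq 'rV[C]_n) h (F : GG -> R) : fixes D h ->
  measurable_fun setT F ->
  bounded_meas (fun x => F (kap D x * h)%g) ->
  bounded_meas (fun x => F (kap D x)) ->
  mean Lam (fun x => F (kap D x * h)%g) = mean Lam (fun x => F (kap D x)).
Proof.
move=> fh mF b1 b2; have [_ [M1 hM1]] := b1; have [_ [M2 hM2]] := b2.
pose K := Num.max M1 M2; pose phi g := (Num.max (F g + K) 0)%:E.
have mphi : measurable_fun setT phi.
  apply/measurable_EFinP; apply: measurable_maxr; last exact: measurable_cst.
  by apply: measurable_funD => //; exact: measurable_cst.
have phi0 g : (0 <= phi g)%E by rewrite lee_fin le_max lexx orbT.
have := int_kap_mulr Lam_inv fh mphi phi0.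
have e1 x : phi (kap D x * h)%g = (F (kap D x * h)%g + K)%:E.
  rewrite /phi max_l //; have := hM1 x; rewrite ler_norml => /andP[h1 _].
  have : M1 <= K by rewrite le_max lexx.
  by lra.
have e2 x : phi (kap D x) = (F (kap D x) + K)%:E.
  rewrite /phi max_l //; have := hM2 x; rewrite ler_norml => /andP[h1 _].
  have : M2 <= K by rewrite le_max lexx orbT.
  by lra.
under eq_integral do rewrite e1.
under [in RHS]eq_integral do rewrite e2.
rewrite (mean_EFin Lam (bmD b1 (bm_cst _ K))) (mean_EFin Lam (bmD b2 (bm_cst _ K))).
move=> [] /eqP; rewrite meanD //; last exact: bm_cst.
rewrite meanD //; last exact: bm_cst.
by rewrite (inj_eq (addIr _)) => /eqP.
Qed.

Variables (D : 'I_r -> seq 'rV[C]_n) (i0 : 'I_r) (y : 'rV[C]_n) (Q : 'M[C]_n).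
Hypotheses (y1 : sqn y = 1) (yP : y *m prs (D i0) = 0).
Hypotheses (Q_proj : projector Q) (PQ : prs (D i0) *m Q = 0).

Let s x := sqn (y *m mx (kap D x) i0 *m Q).
Let N := (n - \rank (prs (D i0)))%N.

Lemma measurable_projection : measurable_fun setT s.
Proof.
apply: measurable_sqn; apply: mmeasM; last exact: mmeas_cst.
apply: mmeasM; first exact: mmeas_cst.
by apply: mmeas_mx_comp; exact: measurable_kap.
Qed.

(** In a basis where both projectors are diagonal, the random vector is a unit
    vector with no coordinate in the range of [prs (D i0)], and the reflections of
    pairs of other coordinates belong to the stabilizer of [D]. *)
Let negative_moments (c : R) (M := fun a => mean Lam (fun x => (s x + c)^-1 ^+ a)) :
  0 < c -> (\rank Q <= N)%N /\ (forall a, (a < N)%N ->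
    ((\rank Q)%:R - a.+1%:R) * M a.+1 <= (N%:R - a.+1%:R) * M a) /\
   (forall a, (a <= N)%N ->
    (a%:R - (\rank Q)%:R) * M a <= a%:R * c * M a.+1).
Proof.
move=> c0; pose P := prs (D i0); have hP : projector P by exact: prs_projector.
have [B [IP [IQ [BU IPQ PE QE]]]] := split_basis hP Q_proj PQ.
have BB : B *m B^t* = 1%:M by exact/unitarymxP.
have BB' : B^t* *m B = 1%:M by apply/mulmx1C.
have rank_conj I : \rank (B^t* *m coord_proj R I *m B) = #|I|.
  have B_free : row_free B by rewrite row_free_unit unitarymx_unit.
  have B'_full : row_full (B^t*).
    by rewrite row_full_unit; apply: unitarymx_unit; rewrite trmxC_unitary.
  by rewrite (mxrankMfree _ B_free) (eqmxMfull _ B'_full) rank_coord_proj.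
have rP : \rank P = #|IP| by rewrite PE rank_conj.
have rQ : \rank Q = #|IQ| by rewrite QE rank_conj.
pose IL := ~: (IP :|: IQ).
have IPUQ : (#|IP :|: IQ| = #|IP| + #|IQ|)%N.
  rewrite cardsU (_ : IP :&: IQ = finset.set0) ?cards0 ?subn0 //.
  by apply/setP => k; rewrite !inE; apply/negP => /andP[/IPQ/negP].
have cardL : (#|IL| + #|IQ| = N)%N.
  have := cardsC (IP :|: IQ); rewrite card_ord /N rP -/IL IPUQ; lia.
have disj k : k \in IL -> k \notin IQ.
  by rewrite !inE negb_or => /andP[].
pose eta x := y *m mx (kap D x) i0 *m B^t*.
have m_eta : mmeas eta.
  apply: mmeasM; last exact: mmeas_cst.
  apply: mmeasM; first exact: mmeas_cst.
  by apply: mmeas_mx_comp; exact: measurable_kap.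
have sE x : s x = \sum_(k in IQ) nsq (eta x 0 k).
  rewrite /s QE -/(eta x) !mulmxA -/(eta x) sqn_unitary // sqn_nsq.
  rewrite [RHS]big_mkcond; apply: eq_bigr => k _; rewrite coord_projE.
  by case: ifP => // _; rewrite /nsq /= expr0n /= addr0.
have yKP x : y *m mx (kap D x) i0 *m P = 0.
  have [_ Ps] := hP.
  have PK := fixes_prs i0 (@fixes_kap R n r D x); rewrite -/P in PK.
  rewrite -[X in _ *m X]Ps -PK adjM Ps mulmxA -[y *m _ *m _]mulmxA mx_mulK.
  by rewrite mulmx1; exact: yP.
have eta_IP x k : k \in IP -> eta x 0 k = 0.
  move=> kP; have /rowP/(_ k) : eta x *m coord_proj R IP = 0.
    have := yKP x; rewrite PE !mulmxA -/(eta x) => h.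
    by rewrite -[LHS]mulmx1 -BB mulmxA h mul0mx.
  by rewrite coord_projE kP => ->; rewrite mxE.
have norm1 x : \sum_(k in IL) nsq (eta x 0 k) + \sum_(k in IQ) nsq (eta x 0 k) = 1.
  have e1 : sqn (eta x) = 1.
    by rewrite /eta !sqn_unitary ?trmxC_unitary ?mx_unitary.
  rewrite -e1 sqn_nsq [RHS](bigID (mem IQ)) /= addrC; congr (_ + _).
  rewrite [RHS](bigID (mem IP)) /= [X in _ = X + _]big1 ?add0r.
    by apply: eq_bigl => k; rewrite !inE negb_or andbC.
  by move=> k /andP[_ kP]; rewrite eta_IP // /nsq /= expr0n /= addr0.
have inv i j v tau : i \in IL -> j \in IQ -> nsq v = 1 -> forall f, vmeas f ->
  bounded_meas (fun x => f (eta x *m pair_reflection i j v tau)) ->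
  bounded_meas (fun x => f (eta x)) ->
  mean Lam (fun x => f (eta x *m pair_reflection i j v tau)) =
  mean Lam (fun x => f (eta x)).
  move=> iL jQ v1 f mf b1 b2.
  have ij : i != j by apply: contraTneq jQ => <-; exact: disj.
  set rho := pair_reflection _ _ _ _ in b1 *.
  have rhoU : rho \is unitarymx by exact: pair_reflection_unitary.
  have hU : B^t* *m rho *m B \is unitarymx.
    have BU' : B^t* \is unitarymx by rewrite trmxC_unitary.
    exact: mul_unitarymx (mul_unitarymx BU' rhoU) BU.
  pose h : GG := [tuple (if i == i0 then Unitary hU else 1%g) | i < r].
  have hi0 : mx h i0 = B^t* *m rho *m B by rewrite /mx tnth_mktuple eqxx.
  have fh : fixes D h.
    move=> k u uD; rewrite /mx tnth_mktuple; case: eqP => [k0|_]; last by rewrite mulmx1.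
    rewrite k0 in uD; have uP := mul_prs uD; rewrite -/P in uP.
    rewrite /= !mulmxA; have u0 l : l \notin IP -> (u *m B^t*) 0 l = 0.
      move=> lP; rewrite -uP PE -!mulmxA BB mulmx1 mulmxA coord_projE.
      by rewrite (negbTE lP).
    rewrite pair_reflection_id ?u0 -?mulmxA ?BB' ?mulmx1 //.
      by move: iL; rewrite !inE negb_or => /andP[].
    by apply: contraTN jQ => /IPQ.
  pose F (g : GG) := f (y *m mx g i0 *m B^t*).
  have mF : measurable_fun setT F.
    apply: mf; apply: mmeasM; last exact: mmeas_cst.
    by apply: mmeasM; [exact: mmeas_cst|exact: mmeas_mx].
  have Fh x : F (kap D x * h)%g = f (eta x *m rho).
    by rewrite /F mxM hi0 /eta -!mulmxA BB mulmx1.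
  have bF1 : bounded_meas (fun x => F (kap D x * h)%g).
    by move: b1; congr bounded_meas; apply/funext => x; rewrite Fh.
  rewrite -(mean_kap_mulr fh mF bF1 b2).
  by apply: mean_ext => x; rewrite Fh.
rewrite rQ -cardL; split; first exact: leq_addl.
have ME a : M a = mean Lam (fun x => (\sum_(k in IQ) nsq (eta x 0 k) + c)^-1 ^+ a).
  by apply: mean_ext => x; rewrite sE.
split=> a aN; rewrite !ME.
  exact: (negative_moment_upper m_eta disj norm1 inv).
exact: (negative_moment_lower m_eta disj norm1 inv).
Qed.

Let s_ge0 x : 0 <= s x. Proof. exact: sqn_ge0. Qed.

Let bm_sV c k : 0 < c -> bounded_meas (fun x => (s x + c)^-1 ^+ k).
Proof.
move=> c0; apply: bmX; apply: bm_inv => //; split; first exact: measurable_projection.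
exists 1 => x; rewrite ger0_norm //; apply: le_trans (sqn_projector_le _ Q_proj) _.
by rewrite sqn_unitary ?y1 // mx_unitary.
Qed.

(** For a projector of rank [q], the moment of order [q + 1] is at least
    [2 ^ - (q + 1)] because [s + c <= 2]; beyond that order each step of the
    recursion gains a factor [1 / c], up to binomial coefficients. *)
Lemma projection_lower (al p : nat) (c : R) : 0 < c -> c <= 1 ->
  (\rank Q <= p)%N -> (p < al)%N -> (al <= N)%N ->
  (2^-1) ^+ (2 * n) * c^-1 ^+ (al - p.+1) <=
  mean Lam (fun x => (s x + c)^-1 ^+ al).
Proof.
move=> c0 c1 Qp pal alN; have [_ [_ low]] := negative_moments c0.
case: al pal alN => // a; rewrite ltnS => pa aN.
have h := iterate_lower c0 low (leq_trans Qp pa) (ltnW aN).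
set q := \rank Q in Qp h; set M := mean _ _.
have M1 : (2^-1) ^+ q.+1 <= mean Lam (fun x => (s x + c)^-1 ^+ q.+1).
  rewrite -[leLHS](mean_cst Lam); apply: mean_le (bm_cst _ _) (bm_sV _ c0) _ => x.
  have s1 : s x <= 1.
    apply: le_trans (sqn_projector_le _ Q_proj) _.
    by rewrite sqn_unitary ?y1 // mx_unitary.
  have sc : 0 < s x + c by rewrite ltr_wpDl.
  rewrite lerXn2r ?nnegrE ?invr_ge0 ?(ltW sc) // lef_pV2 ?posrE //.
  by apply: le_trans (lerD s1 c1) _.
have {h} h := le_trans M1 h; rewrite -/M in h.
have M0 : 0 <= M.
  by apply: Rintegral_ge0 => x _; rewrite exprn_ge0 // invr_ge0 addr_ge0 // ltW.
have nN : (N <= n)%N by exact: leq_subr.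
have two0 : (0 : R) < 2 by [].
have hb : ('C(a, q)%:R : R) <= 2 ^+ n.
  rewrite -natrX ler_nat; apply: leq_trans (leq_bin_exp2 _ _) _.
  by rewrite leq_exp2l //; lia.
have cX k : 0 < c ^+ k by exact: exprn_gt0.
rewrite subSS -(ler_pM2r (cX (a - p)%N)) -mulrA -exprMn mulVf ?gt_eqF // expr1n mulr1.
have h1 : (2^-1) ^+ n <= (2^-1 : R) ^+ q.+1.
  rewrite ler_wiXn2l ?invr_ge0 ?invf_le1 ?ler1n //; lia.
have h2 : c ^+ (a - q) <= c ^+ (a - p) by rewrite ler_wiXn2l ?(ltW c0) //; lia.
rewrite mul2n -addnn exprD.
have h3 : (2^-1 : R) ^+ n * 2 ^+ n = 1 by rewrite -exprMn mulVf ?expr1n ?gt_eqF.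
have p2 : (0 : R) < 2^-1 ^+ n by rewrite exprn_gt0 // invr_gt0.
apply: le_trans (_ : 2^-1 ^+ n * ('C(a, q)%:R * c ^+ (a - q) * M) <= _).
  by rewrite ler_pM2l // (le_trans h1).
apply: le_trans (_ : 2^-1 ^+ n * (2 ^+ n * c ^+ (a - p) * M) <= _).
  rewrite ler_pM2l // ler_wpM2r // ler_pM // ?ler0n // ltW //.
by rewrite !mulrA h3 mul1r mulrC.
Qed.

(** Below the rank of the projector the moments stay bounded as [c] tends to 0,
    which by monotone convergence bounds the moment of [s] itself. *)
Lemma projection_upper (al : nat) : (0 < al)%N -> (al < \rank Q)%N ->
  (\int[Lam]_x negpow al (s x) <= (2 ^+ n)%:E)%E.
Proof.
move=> al0 alQ.
pose c k : R := k.+1%:R^-1.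
have c0 k : 0 < c k by rewrite invr_gt0 ltr0Sn.
pose f k x := ((s x + c k)^-1 ^+ al)%:E.
have bound k : (\int[Lam]_x f k x <= (2 ^+ n)%:E)%E.
  have [QN [up _]] := negative_moments (c0 k).
  rewrite (mean_EFin Lam (bm_sV _ (c0 k))) lee_fin.
  have M0 : mean Lam (fun x => (s x + c k)^-1 ^+ 0) = 1.
    by rewrite -(mean_cst Lam 1); apply: mean_ext => x; rewrite expr0.
  have h := iterate_upper QN M0 up alQ.
  have Mge0 : 0 <= mean Lam (fun x => (s x + c k)^-1 ^+ al).
    by apply: Rintegral_ge0 => x _; rewrite exprn_ge0 // invr_ge0 addr_ge0 // ltW.
  apply: le_trans (_ : 'C(N.-1, al)%:R <= _).
    apply: le_trans h; rewrite ler_peMl // ler1n bin_gt0; lia.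
  rewrite -natrX ler_nat; apply: leq_trans (leq_bin_exp2 _ _) _.
  rewrite leq_exp2l // /N; lia.
have mf k : measurable_fun setT (f k).
  by apply/measurable_EFinP; case: (bm_sV al (c0 k)).
have f0 k x : setT x -> (0 <= f k x)%E.
  by move=> _; rewrite lee_fin exprn_ge0 // invr_ge0 addr_ge0 // ltW.
have nd x : setT x -> nondecreasing_seq (f^~ x).
  move=> _ k l kl; rewrite lee_fin lerXn2r ?nnegrE ?invr_ge0 ?addr_ge0 ?(ltW (c0 _)) //.
  rewrite lef_pV2 ?posrE ?ltr_wpDl // lerD2l lef_pV2 ?posrE ?ltr0Sn //.
  by rewrite ler_nat.
have fE x : limn (f^~ x) = negpow al (s x).
  apply/cvg_lim => //; rewrite /negpow; case: (leP (s x) 0) => sx.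
    have s0 : s x = 0 by apply/eqP; rewrite eq_le sx s_ge0.
    apply/cvgeyPge => A; near=> k; rewrite /f s0 add0r invrK lee_fin.
    apply: le_trans (_ : k%:R <= _).
      by near: k; exact: nbhs_infty_ger.
    apply: le_trans (_ : k.+1%:R <= _); first by rewrite ler_nat.
    by rewrite -natrX ler_nat -{1}[k.+1]expn1 leq_pexp2l.
  apply: cvg_EFin; first by near=> k.
  have -> : fine \o f^~ x = (fun k => (s x + c k)^-1 ^+ al) by [].
  have cv : (fun k => (s x + c k)^-1) @ \oo --> (s x)^-1.
    apply: cvgV; first by rewrite gt_eqF.
    rewrite -[X in _ --> X]addr0; apply: cvgD; first exact: cvg_cst.
    exact: cvg_harmonic.
  exact: (cvg_comp _ _ cv (@exprn_continuous R al _)).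
have := @cvg_monotone_convergence _ _ _ Lam _ measurableT _ mf f0 nd.
rewrite (_ : (fun x => limn (f^~ x)) = (fun x => negpow al (s x))); last exact/funext.
move=> /cvg_lim <- //; apply: lime_le; last by near=> k; exact: bound.
apply: ereal_nondecreasing_is_cvgn => k l kl.
by apply: ge0_le_integral => //; [exact: f0|move=> x _; exact: nd].
Unshelve. all: by end_near.
Qed.

End RandomProjection.

(** * Exploring the trajectories of a word *)

Section Exploration.
Variables (R : realType) (n r : nat).
Local Notation C := R[i].
Local Notation GG := (utuple R n r).
Local Open Scope sesquilinear_scope.

Definition letter_mx (g : GG) (c : 'I_r * bool) : 'M[C]_n :=
  if c.2 then (mx g c.1)^t* else mx g c.1.

Definition word_mx (g : GG) (w : word r) : 'M[C]_n :=
  foldl (fun A c => A *m letter_mx g c) 1%:M w.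

Lemma letter_mx_unitary g c : letter_mx g c \is unitarymx.
Proof.
by rewrite /letter_mx; case: ifP => _; rewrite ?trmxC_unitary mx_unitary.
Qed.

Lemma word_mx_unitary g w : word_mx g w \is unitarymx.
Proof.
elim/last_ind: w => [|w c ih]; first by apply/unitarymxP; rewrite adj1 mulmx1.
by rewrite /word_mx foldl_rcons mul_unitarymx ?letter_mx_unitary.
Qed.

Lemma word_mx_eval g (w : word r) :
  word_mx g w = unitary_mx (eval_word w (fun i => tnth g i)).
Proof.
elim/last_ind: w => [|w c ih]; first by rewrite /eval_word big_nil.
rewrite /word_mx foldl_rcons -/(word_mx g w) ih /eval_word big_rcons /=.
by congr (_ *m _); rewrite /letter_mx; case: (c.2); rewrite ?unitary_mxV.
Qed.

Lemma word_mxJ (h g : GG) (w : word r) (u : 'M[C]_n) : u \is unitarymx ->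
  (forall i, mx h i = u *m mx g i *m u^t*) ->
  word_mx h w = u *m word_mx g w *m u^t*.
Proof.
move=> uU hg; have uu : u^t* *m u = 1%:M by apply/mulmx1C/unitarymxP.
elim/last_ind: w => [|w c ih].
  by rewrite /word_mx /= mulmx1; apply/esym/unitarymxP.
rewrite /word_mx !foldl_rcons -!/(word_mx _ _) ih.
have -> : letter_mx h c = u *m letter_mx g c *m u^t*.
  by rewrite /letter_mx hg; case: ifP => // _; rewrite !adjM trmxCK mulmxA.
by rewrite !mulmxA -[_ *m u^t* *m u]mulmxA uu mulmx1.
Qed.

Lemma mmeas_letter d (T : measurableType d) (f : T -> GG) c :
  measurable_fun setT f -> mmeas (fun t => letter_mx (f t) c).
Proof.
move=> mf; rewrite /letter_mx; case: (c.2).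
  by apply: mmeas_adj; exact: mmeas_mx_comp.
exact: mmeas_mx_comp.
Qed.

Lemma mmeas_word d (T : measurableType d) (f : T -> GG) w :
  measurable_fun setT f -> mmeas (fun t => word_mx (f t) w).
Proof.
move=> mf; elim/last_ind: w => [|w c ih]; first exact: mmeas_cst.
rewrite /word_mx; under eq_fun do rewrite foldl_rcons.
by apply: mmeasM; [exact: ih|exact: mmeas_letter].
Qed.

(** Indexed by natural numbers, so that the first [k] vectors need no cast. *)
Definition basis_vec (j : nat) : 'rV[C]_n := \row_c (c == j :> nat)%:R.

Lemma basis_vec_mul m (j : 'I_n) (A : 'M[C]_(n, m)) : basis_vec j *m A = row j A.
Proof.
apply/rowP => c; rewrite !mxE (bigD1 j) //= mxE eqxx mul1r big1 ?addr0 //.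
by move=> i ij; rewrite mxE -val_eqE in ij *; rewrite (negbTE ij) mul0r.
Qed.

Lemma basis_vec_orth (i j : nat) : (i < n)%N -> (j < n)%N ->
  basis_vec i *m (basis_vec j)^t* = (i == j)%:R%:M.
Proof.
move=> ilt jlt; rewrite (basis_vec_mul (Ordinal ilt)); apply/rowP => a.
by rewrite !ord1 !mxE eqxx mulr1n /= conjC_nat.
Qed.

Lemma sqn_basis_vec (j : nat) : (j < n)%N -> sqn (basis_vec j) = 1.
Proof.
move=> jn; apply: scalar1_inj; rewrite -sqnE basis_vec_orth // eqxx.
by congr (_%:M).
Qed.

Variables (w : word r) (c0 : 'I_r * bool) (k : nat).
Hypothesis k0 : (0 < k)%N.
Let l := size w.
Let T := (k * l.+1)%N.

(** The trajectories of the first [k] basis vectors under the successive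
    letters of the word, one letter after the other: the vector numbered
    [s * k + j] is the image of the basis vector [j] under the first [s]
    letters. *)
Definition traj (g : GG) (t : nat) : 'rV[C]_n :=
  basis_vec (t %% k) *m word_mx g (take (t %/ k) w).

(** The letter that produces the vector number [t], for [t >= k]. *)
Definition letter_at (t : nat) := nth c0 w ((t - k) %/ k).

Lemma traj_start g t : (t < k)%N -> traj g t = basis_vec t.
Proof. by move=> tk; rewrite /traj divn_small // modn_small // take0 mulmx1. Qed.

Lemma traj_step g t : (k <= t)%N -> (t < T)%N ->
  traj g t = traj g (t - k) *m letter_mx g (letter_at t).
Proof.
move=> kt tT; rewrite /traj /letter_at -mulmxA.
have e : (t %/ k = ((t - k) %/ k).+1)%N.
  by rewrite -{1}(subnK kt) divnDr ?dvdnn // divnn k0 addn1.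
have em : (t %% k = (t - k) %% k)%N by rewrite -{1}(subnK kt) modnDr.
have lt : ((t - k) %/ k < size w)%N.
  by rewrite -ltnS -e ltn_divLR // mulnC.
by rewrite e em (take_nth c0 lt) /word_mx foldl_rcons.
Qed.

Lemma traj_step_inv g t : (k <= t)%N -> (t < T)%N -> (letter_at t).2 = false ->
  traj g t = traj g (t - k) *m mx g (letter_at t).1.
Proof. by move=> kt tT b; rewrite traj_step // /letter_mx b. Qed.

Lemma traj_back g t : (k <= t)%N -> (t < T)%N -> (letter_at t).2 = true ->
  traj g t *m mx g (letter_at t).1 = traj g (t - k).
Proof.
by move=> kt tT b; rewrite traj_step // /letter_mx b -mulmxA mx_adjK mulmx1.
Qed.

(** The vector on which the vector number [t] reveals a matrix: a positive
    letter reveals the image of the vector number [t - k], and an inverse letter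
    reveals that the matrix maps the vector number [t] to it.  Accordingly
    [domain g t i] lists the vectors on which the matrix number [i] is known once
    the first [t] vectors of the trajectories are. *)
Definition query (g : GG) (t : nat) :=
  if (letter_at t).2 then traj g t else traj g (t - k).

Definition domain (g : GG) (t : nat) (i : 'I_r) : seq 'rV[C]_n :=
  [seq query g t' | t' <- iota k (t - k) & (letter_at t').1 == i].

Definition seen (g : GG) (t : nat) : seq 'rV[C]_n :=
  [seq traj g t' | t' <- iota 0 t].

Lemma domainP g t i v : (k <= t)%N -> reflect
  (exists2 t', [/\ (k <= t')%N, (t' < t)%N & (letter_at t').1 = i] &
     v = query g t') (v \in domain g t i).
Proof.
move=> kt; apply: (iffP mapP) => -[t'].
  by rewrite mem_filter mem_iota subnKC // => /andP[/eqP ? /andP[? ?]] ->; exists t'.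
move=> [h1 h2 h3] ->; exists t' => //.
by rewrite mem_filter mem_iota subnKC // h1 h2 h3 eqxx.
Qed.

Lemma traj_seen g t t' : (t' < t)%N -> traj g t' \in seen g t.
Proof. by move=> h; apply/mapP; exists t' => //; rewrite mem_iota. Qed.

Lemma domain_nil g i : domain g k i = [::].
Proof. by rewrite /domain subnn. Qed.

Lemma domainS g t i : (k <= t)%N -> domain g t.+1 i =
  domain g t i ++ (if (letter_at t).1 == i then [:: query g t] else [::]).
Proof.
move=> kt; rewrite /domain subSn // -[(t - k).+1]addn1 iotaD filter_cat map_cat subnKC //=.
by case: ifP.
Qed.

Lemma query_mul g t : (k <= t)%N -> (t < T)%N ->
  query g t *m mx g (letter_at t).1 =
  if (letter_at t).2 then traj g (t - k) else traj g t.
Proof.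
move=> kt tT; rewrite /query; case b : (letter_at t).2.
  exact: traj_back.
by rewrite (traj_step_inv _ kt tT b).
Qed.

(** What is already known is not affected by a translation that fixes the
    domains. *)
Lemma traj_history g h t : (t <= T)%N -> fixes (domain g t) h ->
  forall t', (t' < t)%N -> traj (h * g)%g t' = traj g t'.
Proof.
move=> tT fh t'; have [m] := ubnP t'; elim: m t' => // m ih t' t'm t't.
have [t'k|kt'] := ltnP t' k; first by rewrite !traj_start.
have kt : (k <= t)%N by apply: leq_trans kt' (ltnW t't).
have t'T : (t' < T)%N by apply: leq_trans tT.
have e : traj (h * g)%g (t' - k) = traj g (t' - k).
  by apply: ih; lia.
have q : query g t' \in domain g t (letter_at t').1 by apply/domainP => //; exists t'.
have := fh _ _ q; rewrite /query; case b : (letter_at t').2 => qh.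
  have bk := traj_back g kt' t'T b.
  rewrite traj_step // e /letter_mx b mxM adjM mulmxA.
  rewrite -bk -[traj g t' *m _ *m _]mulmxA mx_mulK mulmx1 -[in LHS]qh.
  by rewrite -mulmxA mx_mulK mulmx1.
by rewrite !(traj_step_inv _ kt' t'T b) e mxM mulmxA qh.
Qed.

Lemma seen_history g h t t' : (t <= T)%N -> fixes (domain g t) h -> (t' <= t)%N ->
  seen (h * g)%g t' = seen g t'.
Proof.
move=> tT fh t't; apply/eq_in_map => t''; rewrite mem_iota add0n => /andP[_ h''].
by apply: (traj_history tT fh); apply: leq_trans t't.
Qed.

Lemma domain_history g h t : (k <= t)%N -> (t <= T)%N -> fixes (domain g t) h ->
  domain (h * g)%g t = domain g t.
Proof.
move=> kt tT fh; apply/funext => i; apply/eq_in_map => t'.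
rewrite mem_filter mem_iota subnKC // => /andP[_ /andP[h1 h2]].
rewrite /query !(traj_history tT fh) //.
by apply: leq_ltn_trans h2; exact: leq_subr.
Qed.

Definition seen_proj g t := prs (seen g t).

Lemma domain_sub_seen g t i : (k <= t)%N ->
  prs (domain g t i) *m seen_proj g t = prs (domain g t i).
Proof.
move=> kt; apply: prs_fix => v /domainP [] // t' [h1 h2 _] ->.
apply: mul_prs; rewrite /query; case: ifP => _; apply: traj_seen => //.
by apply: leq_ltn_trans h2; exact: leq_subr.
Qed.

Lemma range_sub_seen g t i : (k <= t)%N -> (t <= T)%N ->
  prs (domain g t i) *m (mx g i *m (1%:M - seen_proj g t)) = 0.
Proof.
move=> kt tT; apply: prs_annihilate => v /domainP [] // t' [h1 h2 <-] ->.
rewrite mulmxA query_mul ?(leq_trans h2) // mulmxBr mulmx1.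
rewrite mul_prs ?subrr //; case: ifP => _; apply: traj_seen => //.
by apply: leq_ltn_trans h2; exact: leq_subr.
Qed.

(** The squared distance from a vector to the span of the previous ones. *)
Definition dist2 g t := sqn (traj g t *m (1%:M - seen_proj g t)).

(** The potential: the squared volume of the last [k] vectors modulo the
    previous ones. *)
Definition potential g t : R := \prod_(t - k <= t' < t) dist2 g t'.

Lemma dist2_ge0 g t : 0 <= dist2 g t. Proof. exact: sqn_ge0. Qed.

Lemma dist2_history g h t t' : (t <= T)%N -> fixes (domain g t) h -> (t' < t)%N ->
  dist2 (h * g)%g t' = dist2 g t'.
Proof.
move=> tT fh t't; rewrite /dist2 /seen_proj (traj_history tT fh t't).
by rewrite (seen_history tT fh (ltnW t't)).
Qed.

Lemma potential_history g h t : (t <= T)%N -> fixes (domain g t) h ->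
  potential (h * g)%g t = potential g t.
Proof.
move=> tT fh; apply: eq_big_nat => t' /andP[_ t't].
exact: dist2_history tT fh t't.
Qed.

Lemma potential_split g t : (k <= t)%N -> potential g t =
  dist2 g (t - k) * \prod_((t - k).+1 <= t' < t) dist2 g t'.
Proof. by move=> kt; rewrite /potential big_ltn //; lia. Qed.

Lemma potentialS g t : (k <= t)%N -> potential g t.+1 =
  \prod_((t - k).+1 <= t' < t) dist2 g t' * dist2 g t.
Proof. by move=> kt; rewrite /potential subSn // big_nat_recr //=; lia. Qed.

(** Distinct basis vectors are orthogonal. *)
Lemma potential_start g : (k <= n)%N -> potential g k = 1.
Proof.
move=> kn; rewrite /potential subnn big_nat big1 // => t /andP[_ tk].
rewrite /dist2 traj_start // -[RHS](sqn_basis_vec (leq_trans tk kn)).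
rewrite mulmxBr mulmx1 -[basis_vec t *m _]trmxCK adjM.
have [_ ->] := prs_projector (seen g t).
rewrite prs_annihilate ?adj0 ?subr0 // => v /mapP[t']; rewrite mem_iota add0n.
move=> /andP[_ t't] ->; rewrite traj_start ?(ltn_trans t't) //.
rewrite basis_vec_orth ?(leq_trans _ kn) ?(ltn_trans t't) //.
by rewrite (ltn_eqF t't) raddf0.
Qed.

Lemma mmeas_traj t : mmeas (fun g => traj g t).
Proof.
apply: mmeasM; first exact: mmeas_cst.
by apply: mmeas_word; exact: measurable_id.
Qed.

Lemma measurable_dist2 t : measurable_fun setT (fun g => dist2 g t).
Proof.
apply: measurable_sqn; apply: mmeasM; first exact: mmeas_traj.
apply: mmeasB; first exact: mmeas_cst.
have -> : (fun g => seen_proj g t) =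
    (fun g => prs [seq v g | v <- [seq (fun g => traj g t') | t' <- iota 0 t]]).
  by apply/funext => g; rewrite -map_comp.
apply: mmeas_prs => v.
by elim: (iota 0 t) => //= a s ih [<-|/ih //]; exact: mmeas_traj.
Qed.

Lemma measurable_potential t : measurable_fun setT (fun g => potential g t).
Proof. by apply: measurable_prod => t' _; exact: measurable_dist2. Qed.

(** The last [k] vectors are the images of the basis vectors under the whole
    word.  Subtracting [z] times the basis vector from its image does not change
    the distance to a span that contains all the basis vectors. *)
Lemma potential_end g (z : C) : (0 < l)%N ->
  potential g T <= \prod_(0 <= j < k) sqn (basis_vec j *m (word_mx g w - z%:M)).
Proof.
move=> l0; rewrite /potential /T mulnS addKn.
have -> : \prod_(k * l <= t' < k + k * l) dist2 g t' =
    \prod_(0 <= j < k) dist2 g (j + k * l).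
  by rewrite -{1}[(k * l)%N]add0n big_addn addnK.
rewrite big_nat [leRHS]big_nat; apply: ler_prod => j /andP[_ jk].
rewrite dist2_ge0 /= /dist2.
have jW : traj g (j + k * l) = basis_vec j *m word_mx g w.
  have e1 : ((j + k * l) %% k = j)%N by rewrite addnC mulnC modnMDl modn_small.
  have e2 : ((j + k * l) %/ k = l)%N.
    by rewrite addnC mulnC divnMDl // divn_small // addn0.
  by rewrite /traj e1 e2 take_size.
set P := seen_proj g (j + k * l).
have Pp : projector (1%:M - P) by apply: projectorC; exact: prs_projector.
have jP : basis_vec j *m (1%:M - P) = 0.
  rewrite mulmxBr mulmx1 mul_prs ?subrr // -(traj_start g jk).
  apply: traj_seen; apply: leq_trans jk _; apply: leq_trans (leq_addl _ _).
  by rewrite leq_pmulr.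
have -> : traj g (j + k * l) *m (1%:M - P) =
    (basis_vec j *m (word_mx g w - z%:M)) *m (1%:M - P).
  rewrite jW [X in _ = X *m _]mulmxBr mul_mx_scalar [RHS]mulmxBl -scalemxAl jP.
  by rewrite scaler0 subr0.
exact: sqn_projector_le.
Qed.

Hypothesis w_red : reduced w.

(** Since the word is reduced, a letter and its inverse are at least two
    letters apart: the vectors that were obtained by the inverse of the current
    letter come before the vector to which the letter is applied. *)
Lemma opposite_letters t t' : (k <= t')%N -> (t' < t)%N -> (t < T)%N ->
  (letter_at t').1 = (letter_at t).1 -> (letter_at t').2 != (letter_at t).2 ->
  (t' < t - k)%N.
Proof.
move=> kt' t't tT l1 l2; rewrite ltnNge; apply/negP => t_le.
have kt : (k <= t)%N by lia.
set s := ((t - k) %/ k)%N; set s' := ((t' - k) %/ k)%N.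
have s's : (s' <= s)%N by apply: leq_div2r; lia.
have ss' : (s <= s'.+1)%N.
  have -> : (s'.+1 = t' %/ k)%N.
    by rewrite -{1}(subnK kt') divnDr ?dvdnn // divnn k0 addn1.
  by apply: leq_div2r.
have slt : (s < size w)%N.
  rewrite -ltnS -(_ : (t %/ k = s.+1)%N) ?ltn_divLR // 1?mulnC //.
  by rewrite -{1}(subnK kt) divnDr ?dvdnn // divnn k0 addn1.
have [es|ns] := eqVneq s s'; first by move: l2; rewrite /letter_at -/s -/s' es eqxx.
have es : s = s'.+1 by apply/eqP; rewrite eqn_leq ss' ltn_neqAle eq_sym ns s's.
have /(sortedP c0) /(_ s') := w_red; rewrite -es => /(_ slt).
by rewrite /letter_at -/s -/s' in l1 l2 *; rewrite l1 eqxx l2.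
Qed.

(** The next two lemmas locate the vectors on which the next matrix, or its
    inverse, is already known: all of them precede the vector number [t - k], to
    which it is now applied. *)
Lemma fresh_domain g t : (k <= t)%N -> (t < T)%N -> (letter_at t).2 = false ->
  prs (domain g t (letter_at t).1) *m seen_proj g (t - k) =
  prs (domain g t (letter_at t).1).
Proof.
move=> kt tT b; apply: prs_fix => v /domainP [] // t' [h1 h2 h3] ->.
apply: mul_prs; rewrite /query; case b' : (letter_at t').2; apply: traj_seen.
  by apply: opposite_letters => //; rewrite b b'.
by lia.
Qed.

Lemma fresh_range g t (i := (letter_at t).1) :
  (k <= t)%N -> (t < T)%N -> (letter_at t).2 = true ->
  prs (domain g t i) *m mx g i *m seen_proj g (t - k) =
  prs (domain g t i) *m mx g i.
Proof.
move=> kt tT b; apply/eqP; rewrite -subr_eq0 -{2}[_ *m mx g i]mulmx1 -mulmxBr -mulmxA.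
rewrite -oppr_eq0 -!mulmxN opprB; apply/eqP.
apply: prs_annihilate => v /domainP [] // t' [h1 h2 h3] ->.
have t'T : (t' < T)%N by exact: ltn_trans tT.
rewrite mulmxA -h3 query_mul // mulmxBr mulmx1.
rewrite mul_prs ?subrr //; case b' : (letter_at t').2; apply: traj_seen.
  by lia.
by apply: opposite_letters => //; rewrite b b'.
Qed.

End Exploration.

(** * The negative moment of the potential *)

Section Moment.
Variables (R : realType) (n r : nat).
Local Notation C := R[i].
Local Notation GG := (utuple R n r).
Variable Lam : probability GG R.
Hypothesis Lam_inv : forall (h : GG) (A : set GG), measurable A ->
  Lam ((fun g => (h * g)%g) @^-1` A) = Lam A.
Local Open Scope sesquilinear_scope.
Local Open Scope ereal_scope.

Variables (w : word r) (c0 : 'I_r * bool) (k : nat).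
Hypotheses (k0 : (0 < k)%N) (w_red : reduced w).
Let l := size w.
Let T := (k * l.+1)%N.
Let al := (n - T)%N.
Hypothesis al0 : (0 < al)%N.

Local Notation domain := (domain w c0 k).
Local Notation traj := (traj w k).
Local Notation letter_at := (letter_at w c0 k).
Local Notation potential := (potential w k).
Local Notation dist2 := (dist2 w k).
Local Notation seen_proj := (seen_proj w k).

(** [projection_upper], by homogeneity. *)
Lemma projection_upper_scaled (D : 'I_r -> seq 'rV[C]_n) i (y : 'rV[C]_n) (Q : 'M[C]_n) :
  y *m prs (D i) = 0%R -> projector Q -> prs (D i) *m Q = 0%R -> (al < \rank Q)%N ->
  \int[Lam]_x negpow al (sqn (y *m mx (kap D x) i *m Q)) <=
  (2 ^+ n)%:E * negpow al (sqn y).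
Proof.
move=> yP Qp PQ alQ; have [y0|y0] := eqVneq y 0%R.
  by rewrite y0 sqn0 /negpow lexx gt0_muley ?leey // lte_fin exprn_gt0.
have sy : (0 < sqn y)%R by rewrite lt_neqAle sqn_ge0 eq_sym sqn_eq0 y0.
pose c : C := ((Num.sqrt (sqn y))^-1)%:C%C; pose u := c *: y.
have cc : ((Num.sqrt (sqn y))^-1 ^+ 2 = (sqn y)^-1)%R.
  by rewrite exprVn sqr_sqrtr // ltW.
have u1 : sqn u = 1%R by rewrite sqnZ /= expr0n /= addr0 cc mulVf // gt_eqF.
have uP : u *m prs (D i) = 0%R by rewrite -scalemxAl yP scaler0.
have e x : negpow al (sqn (y *m mx (kap D x) i *m Q)) =
    negpow al (sqn y) * negpow al (sqn (u *m mx (kap D x) i *m Q)).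
  rewrite -negpowM // -!scalemxAl sqnZ /= expr0n /= addr0 cc mulrA mulfV ?mul1r //.
  by rewrite gt_eqF.
under eq_integral do rewrite e.
rewrite ge0_integralZl //; last 3 first.
- apply: measurable_negpow; exact: measurable_projection.
- by move=> x _; exact: negpow_ge0.
- exact: negpow_ge0.
rewrite muleC; apply: lee_wpmul2r; first exact: negpow_ge0.
exact: projection_upper.
Qed.

Section Step.
Variables (t : nat) (g0 : GG).
Hypotheses (kt : (k <= t)%N) (tT : (t < T)%N).
Let D := domain g0 t.
Let i := (letter_at t).1.
Let g1 x := (kap D x * g0)%g.

Let g1_fix x : fixes D (kap D x). Proof. exact: fixes_kap. Qed.

Let domain_g1 x : domain (g1 x) t = D.
Proof. exact: (domain_history k0 kt (ltnW tT) (g1_fix x)). Qed.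

Let traj_g1 x t' : (t' < t)%N -> traj (g1 x) t' = traj g0 t'.
Proof. exact: (traj_history k0 (ltnW tT) (g1_fix x)). Qed.

Let tk_t : (t - k < t)%N. Proof. by rewrite ltn_subrL k0 (leq_trans k0). Qed.

(** Given what is known at time [t], the law of the tuple is obtained by
    revealing the vector number [t], then sampling the rest.  For a positive
    letter the new element of the domain is known in advance and the rest is
    sampled on the left.  For an inverse letter it depends on the matrix that is
    being revealed; the rest is then sampled on the right, and a conjugation
    brings it back to the left. *)
Lemma int_reveal (phi : GG -> \bar R) :
  measurable_fun setT phi -> (forall x, 0 <= phi x) ->
  exists2 G : GG -> \bar R, measurable_fun setT G /\ (forall x, 0 <= G x) &
  \int[Lam]_x phi (g1 x) = \int[Lam]_x G x /\
  forall x, G x = \int[Lam]_y phi (kap (domain (g1 x) t.+1) y * g1 x)%g.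
Proof.
move=> mphi phi0; pose D' := domain g0 t.+1.
have D'D h : fixes D' h -> fixes D h.
  by move=> fh j v vD; apply: fh; rewrite /D' (domainS _ _ _ _ kt) mem_cat vD.
have mphi' := measurable_rmul g0 mphi; have phi0' x := phi0 (x * g0)%g.
case b : (letter_at t).2.
  pose F (z : GG * GG) := phi (kap D z.1 * kap D' z.2 * g0)%g.
  have mF : measurable_fun setT F.
    apply: (measurableT_comp mphi'); apply: measurable_mulg.
      by apply: measurable_fst_comp; exact: measurable_kap.
    by apply: measurable_snd_comp; exact: measurable_kap.
  exists (fun x => \int[Lam]_y F (x, y)).
    split; last by move=> x; apply: integral_ge0 => y _; exact: phi0.
    exact: (measurable_fun_fubini_tonelli_F F mF (fun z => phi0 _)).
  split; first exact: (int_kap_reveal_right Lam_inv D'D mphi' phi0').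
  move=> x; rewrite /F /g1 /=.
  under [RHS]eq_integral do rewrite mulgA.
  apply: (int_kap_conj Lam_inv _ mphi' phi0') => h; set u := kap D x.
  have conjE j v : v *m mx (u^-1 * h * u)%g j = v *m (mx u j)^t* *m mx h j *m mx u j.
    by rewrite !mxM mxV !mulmxA.
  have zt : traj (g1 x) t = traj g0 t *m (mx u i)^t*.
    rewrite !(traj_step c0 k0 _ kt tT) (traj_g1 x tk_t) /letter_mx b mxM adjM.
    by rewrite mulmxA.
  have fixu j v : v \in D j -> v *m (mx u j)^t* = v.
    by move=> vD; rewrite -{1}(fixes_kap x vD) -mulmxA mx_mulK mulmx1.
  split=> fh j v.
    rewrite /D' (domainS _ _ _ _ kt) mem_cat => /orP[vD|].
      have := fh j v; rewrite (domainS _ _ _ _ kt) mem_cat domain_g1 vD => /(_ isT) vh.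
      by rewrite conjE fixu // vh (fixes_kap x vD).
    case: eqP => // <-; rewrite mem_seq1 /query b => /eqP ->.
    have := fh i (traj (g1 x) t); rewrite (domainS _ _ _ _ kt) mem_cat eqxx /query b.
    rewrite mem_seq1 eqxx orbT => /(_ isT); rewrite zt conjE => ->.
    by rewrite -mulmxA mx_adjK mulmx1.
  rewrite (domainS _ _ _ _ kt) mem_cat domain_g1 => /orP[vD|].
    have := fh j v; rewrite /D' (domainS _ _ _ _ kt) mem_cat vD => /(_ isT).
    rewrite conjE fixu // => vhu.
    by rewrite -[LHS]mulmx1 -(mx_mulK u j) mulmxA vhu fixu.
  case: eqP => // <-; rewrite mem_seq1 /query b => /eqP ->.
  have := fh i (traj g0 t); rewrite /D' (domainS _ _ _ _ kt) mem_cat eqxx /query b.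
  rewrite mem_seq1 eqxx orbT => /(_ isT); rewrite conjE zt => vhu.
  by rewrite -[LHS]mulmx1 -(mx_mulK u i) mulmxA vhu.
pose F (z : GG * GG) := phi (kap D' z.2 * kap D z.1 * g0)%g.
have mF : measurable_fun setT F.
  apply: (measurableT_comp mphi'); apply: measurable_mulg.
    by apply: measurable_snd_comp; exact: measurable_kap.
  by apply: measurable_fst_comp; exact: measurable_kap.
exists (fun x => \int[Lam]_y F (x, y)).
  split; last by move=> x; apply: integral_ge0 => y _; exact: phi0.
  exact: (measurable_fun_fubini_tonelli_F F mF (fun z => phi0 _)).
split; first exact: (int_kap_reveal_left Lam_inv D'D mphi' phi0').
move=> x; have -> : domain (g1 x) t.+1 = D'.
  apply/funext => j; rewrite /D' !(domainS _ _ _ _ kt) domain_g1 /query b.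
  by rewrite (traj_g1 x tk_t).
by rewrite /F /g1 /=; under [RHS]eq_integral do rewrite mulgA.
Qed.

(** The new vector is the image of the vector number [t - k].  Its component
    in the known domain contributes nothing to the distance; the image of the rest
    has a uniform direction.  That rest is at least as long as the distance at time
    [t - k], because the known domain is spanned by earlier vectors. *)
Lemma int_dist2 :
  \int[Lam]_x negpow al (dist2 (g1 x) t) <=
  (2 ^+ n)%:E * negpow al (dist2 g0 (t - k)).
Proof.
set P := prs (D i); have [PP Ps] : projector P by exact: prs_projector.
pose Q := (1%:M - seen_proj g0 t)%R.
have Qp : projector Q by apply: projectorC; exact: prs_projector.
have PQ : P *m Q = 0%R.
  by rewrite mulmxBr mulmx1 /P /D domain_sub_seen // subrr.
have rankQ : (n - t <= \rank Q)%N.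
  have : (\rank (seen_proj g0 t) <= t)%N.
    by apply: leq_trans (rank_prs _) _; rewrite size_map size_iota.
  have := mxrank_add Q (seen_proj g0 t); rewrite /Q subrK mxrank1; lia.
have alQ : (al < \rank Q)%N by apply: leq_trans rankQ; rewrite /al; lia.
have d_g1 x : dist2 (g1 x) t = sqn (traj (g1 x) t *m Q).
  rewrite /dist2 /seen_proj.
  by rewrite (seen_history k0 (ltnW tT) (g1_fix x) (leqnn t)).
have d_ge : (0 <= dist2 g0 (t - k))%R by exact: sqn_ge0.
case b : (letter_at t).2.
  pose y := (traj g0 t *m (1%:M - P))%R.
  have yP : y *m P = 0%R by rewrite /y -mulmxA mulmxBl mul1mx PP subrr mulmx0.
  have bound := projection_upper_scaled yP Qp PQ alQ.
  have dist_y x : dist2 (g1 x) t = sqn (y *m mx (kap D x)^-1%g i *m Q).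
    rewrite d_g1 (traj_step c0 k0 _ kt tT) (traj_g1 x tk_t) /letter_mx b mxM adjM mxV.
    rewrite [_ *m (_ *m _)]mulmxA.
    have -> : traj g0 (t - k) *m (mx g0 i)^t* = traj g0 t.
      by rewrite (traj_step c0 k0 _ kt tT) /letter_mx b.
    have -> : traj g0 t = (traj g0 t *m P + y)%R.
      by rewrite /y mulmxBr mulmx1 addrC subrK.
    have Pu : P *m (mx (kap D x) i)^t* = P.
      have Pu := fixes_prs i (g1_fix x); rewrite -/P in Pu.
      by rewrite -{1}Pu -mulmxA mx_mulK mulmx1.
    by rewrite !mulmxDl -[_ *m P *m _]mulmxA Pu -[_ *m P *m _]mulmxA PQ mulmx0 add0r.
  under eq_integral do rewrite dist_y.
  have mphi : measurable_fun setT (fun g : GG => negpow al (sqn (y *m mx g i *m Q))).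
    apply: measurable_negpow; apply: measurable_sqn; apply: mmeasM.
      by apply: mmeasM; [exact: mmeas_cst|exact: mmeas_mx].
    exact: mmeas_cst.
  rewrite (int_kapV Lam_inv D mphi); last by move=> x; exact: negpow_ge0.
  apply: le_trans bound _; apply: lee_wpmul2l.
    by rewrite lee_fin exprn_ge0.
  apply: le_negpow.
  pose P' := ((mx g0 i)^t* *m P *m mx g0 i)%R.
  have P'p : projector P'.
    have := projector_conj (_ : (mx g0 i)^t* \is unitarymx) (prs_projector (D i)).
    by rewrite trmxCK; apply; rewrite trmxC_unitary mx_unitary.
  have P'P : P' *m seen_proj g0 (t - k) = P'.
    by rewrite /P' -!mulmxA; congr (_ *m _); rewrite mulmxA fresh_range.
  have e : y *m mx g0 i = (traj g0 (t - k) *m (1%:M - P'))%R.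
    rewrite -(traj_back k0 g0 kt tT b) -/i -[RHS]mulmxA -[LHS]mulmxA; congr (_ *m _).
    by rewrite mulmxBl mul1mx mulmxBr mulmx1 /P' !mulmxA mx_mulK mul1mx.
  rewrite -(sqn_unitary y (mx_unitary g0 i)) e.
  exact: (sqn_residual_le _ (prs_projector (seen w k g0 (t - k))) P'P).
pose y := (traj g0 (t - k) *m (1%:M - P))%R.
have yP : y *m P = 0%R by rewrite /y -mulmxA mulmxBl mul1mx PP subrr mulmx0.
pose Q' := (mx g0 i *m Q *m (mx g0 i)^t*)%R.
have Q'p : projector Q' by apply: projector_conj => //; exact: mx_unitary.
have PQ' : P *m Q' = 0%R.
  rewrite /Q' !mulmxA -[P *m _ *m _]mulmxA.
  by rewrite (range_sub_seen c0 k0 _ _ kt (ltnW tT)) mul0mx.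
have alQ' : (al < \rank Q')%N.
  suff -> : \rank Q' = \rank Q by [].
  have full : row_full (mx g0 i) by rewrite row_full_unit unitarymx_unit ?mx_unitary.
  have free : row_free ((mx g0 i)^t*).
    by rewrite row_free_unit unitarymx_unit // trmxC_unitary mx_unitary.
  by rewrite /Q' (mxrankMfree _ free) (eqmxMfull _ full).
have bound := projection_upper_scaled yP Q'p PQ' alQ'.
have dist_y x : dist2 (g1 x) t = sqn (y *m mx (kap D x) i *m Q').
  rewrite d_g1 (traj_step_inv k0 _ kt tT b) (traj_g1 x tk_t) mxM.
  have -> : traj g0 (t - k) = (traj g0 (t - k) *m P + y)%R.
    by rewrite /y mulmxBr mulmx1 addrC subrK.
  rewrite mulmxA !mulmxDl -[_ *m P *m mx (kap D x) i]mulmxA (fixes_prs i (g1_fix x)).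
  rewrite -[_ *m P *m mx g0 i *m Q]mulmxA -[_ *m P *m _]mulmxA.
  rewrite (range_sub_seen c0 k0 _ _ kt (ltnW tT)) mulmx0 add0r.
  have mU : (mx g0 i)^t* \is unitarymx by rewrite trmxC_unitary mx_unitary.
  by rewrite /Q' !mulmxA (sqn_unitary _ mU).
under eq_integral do rewrite dist_y.
apply: le_trans bound _; apply: lee_wpmul2l; first by rewrite lee_fin exprn_ge0.
apply: le_negpow; apply: sqn_residual_le; first exact: prs_projector.
exact: fresh_domain.
Qed.
End Step.

(** Backward induction on the number of known vectors.  From [t] to [t + 1] the
    factor [dist2 (t - k)] of the potential is replaced by [dist2 t], whose
    negative moment is larger by a factor of at most [2 ^ n]. *)
Lemma int_potential_step t g0 : (k <= t)%N -> (t <= T)%N ->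
  \int[Lam]_x negpow al (potential (kap (domain g0 t) x * g0)%g T) <=
  ((2 ^+ n) ^+ (T - t))%:E * negpow al (potential g0 t).
Proof.
have mphi t' : measurable_fun setT (fun g : GG => negpow al (potential g t')).
  by apply: measurable_negpow; exact: measurable_potential.
move=> kt tT; have [m] := ubnP (T - t)%N; elim: m t g0 kt tT => // m ih t g0 kt.
rewrite leq_eqVlt => /predU1P[->|tT] tm.
  under eq_integral => x _.
    rewrite (potential_history k0 (leqnn T) (fixes_kap x)); over.
  by rewrite int_cst subnn expr0 mul1e.
have [le0|p0] := leP (potential g0 t) 0%R.
  by rewrite [in leRHS]/negpow le0 gt0_muley ?leey // lte_fin !exprn_gt0.
pose g1 x := (kap (domain g0 t) x * g0)%g.
pose phi (g : GG) := negpow al (potential g T).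
have phi0 g : 0 <= phi g by exact: negpow_ge0.
have [G [mG G0] [intG GE]] := @int_reveal t g0 kt tT phi (mphi T) phi0.
rewrite [leLHS]intG.
pose c := (\prod_((t - k).+1 <= t' < t) dist2 g0 t')%R.
have d0 : (0 <= dist2 g0 (t - k))%R by exact: sqn_ge0.
have pc : potential g0 t = (dist2 g0 (t - k) * c)%R by exact: potential_split.
have c_gt0 : (0 < c)%R.
  have c_ge0 : (0 <= c)%R by apply: prodr_ge0 => t' _; exact: sqn_ge0.
  rewrite lt_neqAle c_ge0 andbT; apply: contraTneq p0 => c00.
  by rewrite pc -c00 mulr0 ltxx.
have d_gt0 : (0 < dist2 g0 (t - k))%R.
  by move: p0; rewrite pc pmulr_lgt0.
have pot_g1 x : potential (g1 x) t.+1 = (c * dist2 (g1 x) t)%R.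
  rewrite [LHS](potentialS w k0 (g1 x) kt).
  suff -> : (\prod_((t - k).+1 <= t' < t) dist2 (g1 x) t')%R = c by [].
  apply: eq_big_nat => t' /andP[_ t't].
  exact: (dist2_history k0 (ltnW tT) (fixes_kap x)).
pose K := ((2 ^+ n) ^+ (T - t.+1) : R)%R.
have K0 : (0 <= K)%R by rewrite !exprn_ge0.
have mdist : measurable_fun setT (fun x => dist2 (g1 x) t).
  apply: (measurableT_comp (measurable_dist2 w k t)).
  by apply: measurable_mulg; [exact: measurable_kap|exact: measurable_cst].
apply: le_trans (_ : \int[Lam]_x (K%:E * negpow al c * negpow al (dist2 (g1 x) t)) <= _).
  apply: ge0_le_integral => //.
  - by apply: measurable_funeM; exact: measurable_negpow.
  - move=> x _; rewrite GE -muleA -negpowM // -pot_g1.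
    by apply: ih => //; [exact: leqW|lia].
rewrite ge0_integralZl //; last 3 first.
- exact: measurable_negpow.
- by move=> x _; exact: negpow_ge0.
- by apply: mule_ge0; [rewrite lee_fin|exact: negpow_ge0].
apply: le_trans (lee_wpmul2l _ (int_dist2 g0 kt tT)) _.
  by apply: mule_ge0; [rewrite lee_fin|exact: negpow_ge0].
have -> : ((2 ^+ n) ^+ (T - t) = 2 ^+ n * K :> R)%R by rewrite /K -exprS subnSK.
rewrite pc (negpow_pos _ c_gt0) (negpow_pos _ d_gt0) negpow_pos; last exact: mulr_gt0.
by rewrite -!EFinM lee_fin invfM exprMn le_eqVlt; apply/orP; left; apply/eqP; ring.
Qed.

(** At time [k] only the basis vectors are known, so nothing is known of the
    matrices. *)
Theorem int_potential : (T <= n)%N ->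
  \int[Lam]_g negpow al (potential g T) <= ((2 ^+ n) ^+ (k * l))%:E.
Proof.
move=> Tn; have kT : (k <= T)%N by rewrite leq_pmulr.
have bound := int_potential_step 1%g (leqnn k) kT.
have kn : (k <= n)%N by exact: leq_trans Tn.
have start : negpow al (potential (1%g : GG) k) = 1.
  by rewrite (potential_start w _ kn) negpow_pos // invr1 expr1n.
have Tk : (T - k = k * l)%N by rewrite /T mulnS addKn.
have full x : (kap (domain (1%g : GG) k) x * 1)%g = x.
  have -> : domain (1%g : GG) k = fun=> [::] by apply/funext => i; rewrite domain_nil.
  by rewrite kap_nil mulg1.
apply: le_trans (_ : ((2 ^+ n) ^+ (T - k))%:E * negpow al (potential (1%g : GG) k) <= _).
  rewrite [leLHS](_ : _ = \int[Lam]_x negpow al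
    (potential (kap (domain (1%g : GG) k) x * 1)%g T)); first exact: bound.
  by apply: eq_integral => x _; rewrite full.
by rewrite start mule1 Tk.
Qed.
End Moment.

(** * Random frames and nearly null spaces *)

Section Frames.
Variables (R : realType) (n r : nat).
Local Notation C := R[i].
Local Notation GG := (utuple R n r).
Variable Lam : probability GG R.
Hypothesis Lam_inv : forall (h : GG) (A : set GG), measurable A ->
  Lam ((fun g => (h * g)%g) @^-1` A) = Lam A.
Local Open Scope sesquilinear_scope.

(** At least [m] singular values of [B] have a square of at most [a], in
    variational form. *)
Definition nearly_null (m : nat) (a : R) (B : 'M[C]_n) :=
  exists2 V : 'M[C]_n, (m <= \rank V)%N &
  forall v : 'rV[C]_n, (v <= V)%MS -> sqn (v *m B) <= a * sqn v.

(** The nearly null space is carried along by [u^-1]. *)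
Lemma nearly_null_mull m a (B u : 'M[C]_n) : u \is unitarymx ->
  nearly_null m a B -> nearly_null m a (u *m B).
Proof.
move=> uU [V mV hV]; have uadj : u^t* \is unitarymx by rewrite trmxC_unitary.
have uu : u^t* *m u = 1%:M := mulmx1C (unitarymxP uU).
exists (V *m u^t*).
  rewrite mxrankMfree // row_free_unit unitarymx_unit //.
move=> v /submxP[x ->]; rewrite !mulmxA -[_ *m u^t* *m u]mulmxA uu mulmx1.
by rewrite (sqn_unitary _ uadj) hV // submxMl.
Qed.

Lemma sqnD_le (v v' : 'rV[C]_n) : sqn (v + v') <= 2 * sqn v + 2 * sqn v'.
Proof.
rewrite /sqn !mulr_sumr -big_split /=; apply: ler_sum => j _; rewrite mxE.
case: (v 0 j) (v' 0 j) => a b [c d] /=; rewrite -subr_ge0.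
have -> : 2 * (a ^+ 2 + b ^+ 2) + 2 * (c ^+ 2 + d ^+ 2) -
  ((a + c) ^+ 2 + (b + d) ^+ 2) = (a - c) ^+ 2 + (b - d) ^+ 2 by ring.
by rewrite addr_ge0 ?sqr_ge0.
Qed.

Lemma prs_sub p (s : seq 'rV[C]_n) (V : 'M[C]_(p, n)) :
  (forall v, v \in s -> (v <= V)%MS) -> (prs s <= V)%MS.
Proof.
by move=> sV; rewrite submxE prs_annihilate // => v /sV; rewrite submxE => /eqP.
Qed.

(** Each known vector costs at most one dimension of [V] and one dimension of
    the ambient space, so the rank of the projector that measures the distance
    to [V] inside the orthogonal complement of [s] does not grow with [s]. *)
Lemma residual_projector (s : seq 'rV[C]_n) (V : 'M[C]_n) :
  exists Q, [/\ projector Q, prs s *m Q = 0, (\rank Q <= n - \rank V)%N &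
    forall v : 'rV[C]_n, v *m prs s = 0 -> (v *m (1%:M - Q) <= V)%MS].
Proof.
set P := prs s; have [PP Ps] : projector P by exact: prs_projector.
pose V' := (V :&: kermx P)%MS; have V'P : V' *m P = 0.
  by apply/eqP; rewrite -sub_kermx capmxSr.
pose s' := [seq row i V' | i <- enum 'I_n]; pose P' := prs s'.
have [P'P' P's] : projector P' by exact: prs_projector.
have in_s' v : v \in s' -> (v <= V')%MS.
  by move=> /mapP[i _ ->]; exact: row_sub.
have P'P : P' *m P = 0.
  by apply: prs_annihilate => v /in_s' /submxP[x ->]; rewrite -mulmxA V'P mulmx0.
have PP' : P *m P' = 0 by rewrite -Ps -P's -adjM P'P adj0.
have V'P' : V' *m P' = V'.
  apply/row_matrixP => i; rewrite row_mul mul_prs //.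
  by apply: map_f; rewrite mem_enum.
have PQ : P *m (1%:M - (P + P')) = 0.
  by rewrite mulmxBr mulmx1 mulmxDr PP PP' addr0 subrr.
exists (1%:M - (P + P')); split => //.
- apply: projectorC; split; last by rewrite adjD Ps P's.
  by rewrite mulmxDl !mulmxDr PP PP' P'P P'P' addr0 add0r.
- have sub : (P + V' <= kermx (1%:M - (P + P')))%MS.
    rewrite addsmx_sub !sub_kermx PQ eqxx /=.
    by rewrite mulmxBr mulmx1 mulmxDr V'P V'P' add0r subrr.
  have := mxrankS sub; rewrite mxrank_ker mxrank_disjoint_sum; last first.
    apply/eqP; rewrite -submx0; apply/rV_subP => v; rewrite sub_capmx.
    move=> /andP[/submxP[x ->] /submxP[x' e]].
    have -> : x *m P = x *m P *m P by rewrite -mulmxA PP.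
    by rewrite e -mulmxA V'P mulmx0 sub0mx.
  have := mxrank_sum_cap V (kermx P); rewrite mxrank_ker -/V'.
  have := rank_leq_row (V + kermx P)%MS; have := rank_leq_row P.
  have := rank_leq_row (1%:M - (P + P')).
  by lia.
- move=> v vP; rewrite opprB addrCA subrr addr0 mulmxDr vP add0r.
  have P'V : (P' <= V)%MS.
    by apply: prs_sub => w /in_s' h; apply: submx_trans h (capmxSl _ _).
  by apply: submx_trans P'V; exact: submxMl.
Qed.

Lemma measurable_sqn_mx d (X : measurableType d) (f : X -> GG) i (v : 'rV[C]_n) (B : 'M[C]_n) :
  measurable_fun setT f -> measurable_fun setT (fun x => sqn (v *m mx (f x) i *m B)).
Proof.
move=> mf; apply: measurable_sqn; apply: mmeasM; last exact: mmeas_cst.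
by apply: mmeasM; [exact: mmeas_cst|exact: mmeas_mx_comp].
Qed.

Section Gain.
Variables (i0 : 'I_r) (m al k : nat) (a : R).
Hypotheses (a0 : 0 < a) (a4 : a <= 4) (nm_al : (n - m < al)%N) (al_n : (al + k <= n)%N).

(** The lower bound for the negative moment contributed by one vector [xi] of the
    frame.  Its square after multiplication by [B] is at most
    [2 * a + 8 * s = 8 * (s + a / 4)], where [s] is its squared distance from the
    nearly null space; then [projection_lower] applies with [p = n - m]. *)
Definition gain : R :=
  8^-1 ^+ al * ((2^-1) ^+ (2 * n) * (a / 4)^-1 ^+ (al - (n - m).+1)).

Lemma gain_gt0 : 0 < gain.
Proof. by rewrite /gain !mulr_gt0 // !exprn_gt0 // !invr_gt0 ?divr_gt0. Qed.

Lemma int_nearly_null (D : 'I_r -> seq 'rV[C]_n) (y : 'rV[C]_n) (B : 'M[C]_n) :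
  (size (D i0) <= k)%N -> sqn y = 1 -> y *m prs (D i0) = 0 ->
  (forall v : 'rV[C]_n, sqn (v *m B) <= 4 * sqn v) -> nearly_null m a B ->
  (gain%:E <= \int[Lam]_x negpow al (sqn (y *m mx (kap D x) i0 *m B)))%E.
Proof.
move=> Dk y1 yP B4 [V mV hV]; set P := prs (D i0) in yP *.
have [Q [Qp PQ rQ Qv]] := residual_projector (D i0) V.
have [QQ Qs] := Qp.
pose s x := sqn (y *m mx (kap D x) i0 *m Q).
have c0 : 0 < a / 4 by rewrite divr_gt0.
have c1 : a / 4 <= 1 by rewrite ler_pdivrMr // mul1r.
have Qnm : (\rank Q <= n - m)%N by apply: leq_trans rQ _; rewrite leq_sub2l.
have alN : (al <= n - \rank P)%N.
  have : (\rank P <= k)%N by apply: leq_trans (rank_prs _) Dk.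
  by lia.
have low := projection_lower Lam_inv y1 yP Qp PQ c0 c1 Qnm nm_al alN.
have s0 x : 0 <= s x by exact: sqn_ge0.
(* The component of [xi] in the nearly null space is shrunk; the length of the
   other one is at most doubled. *)
have sB x : sqn (y *m mx (kap D x) i0 *m B) <= 8 * (s x + a / 4).
  set xi := y *m mx (kap D x) i0.
  have xiP : xi *m P = 0.
    have fx := fixes_prs i0 (fixes_kap (D := D) x).
    have [PP Ps] : projector P by exact: prs_projector.
    have Pu : mx (kap D x) i0 *m P = P.
      rewrite -{2}[P]mulmx1 -(mx_adjK (kap D x) i0).
      have PuT : (mx (kap D x) i0)^t* *m mx (kap D x) i0 = 1%:M by exact: mx_adjK.
      have : (P *m mx (kap D x) i0)^t* = P^t* by rewrite fx.
      rewrite adjM Ps => PE.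
      by rewrite -{1}PE mulmxA mx_mulK mul1mx PuT mulmx1.
    by rewrite /xi -mulmxA Pu.
  have xi1 : sqn xi = 1 by rewrite /xi sqn_unitary // mx_unitary.
  have -> : xi *m B = xi *m (1%:M - Q) *m B + xi *m Q *m B.
    by rewrite -mulmxDl mulmxBr mulmx1 subrK.
  apply: le_trans (sqnD_le _ _) _.
  have h1 : sqn (xi *m (1%:M - Q) *m B) <= a.
    apply: le_trans (hV _ (Qv _ xiP)) _; rewrite -[leRHS]mulr1 ler_pM2l // -xi1.
    by apply: sqn_projector_le; exact: projectorC.
  have h2 : sqn (xi *m Q *m B) <= 4 * s x by exact: B4.
  by lra.
have bs : bounded_meas s.
  split; first exact: measurable_projection.
  exists 1 => x; rewrite ger0_norm // -y1 -(sqn_unitary y (mx_unitary (kap D x) i0)).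
  exact: sqn_projector_le.
have bsi : bounded_meas (fun x => (s x + a / 4)^-1 ^+ al).
  by apply: bmX; apply: bm_inv.
have -> : (gain%:E = (8^-1 ^+ al)%:E * ((2^-1) ^+ (2 * n) * (a / 4)^-1 ^+ (al - (n - m).+1))%:E)%E.
  by rewrite -EFinM.
apply: le_trans (_ : (8^-1 ^+ al)%:E * \int[Lam]_x ((s x + a / 4)^-1 ^+ al)%:E <= _)%E.
  rewrite (mean_EFin Lam bsi) -!EFinM lee_fin ler_pM2l // exprn_gt0 // invr_gt0 //.
have sx0 x : 0 < s x + a / 4 by exact: ltr_wpDl.
rewrite -ge0_integralZl //; last 2 first.
- by apply/measurable_EFinP; case: bsi.
- by move=> x _; rewrite lee_fin exprn_ge0 // invr_ge0 ltW.
apply: ge0_le_integral => //.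
- by move=> x _; rewrite -EFinM lee_fin mulr_ge0 ?exprn_ge0 ?invr_ge0 // ltW.
- by apply: measurable_funeM; apply/measurable_EFinP; case: bsi.
- apply: measurable_negpow; apply: measurable_sqn_mx; exact: measurable_kap.
- move=> x _; apply: le_trans (le_negpow al (sB x)).
  by rewrite negpow_pos ?mulr_gt0 // -EFinM lee_fin invfM exprMn.
Qed.

(** The vectors of a random frame are revealed one at a time; each of them
    contributes a factor [gain]. *)
Lemma int_frame (B : 'M[C]_n) :
  (forall v : 'rV[C]_n, sqn (v *m B) <= 4 * sqn v) -> nearly_null m a B ->
  ((gain ^+ k)%:E <=
   \int[Lam]_x negpow al (\prod_(0 <= j < k) sqn (basis_vec R n j *m mx x i0 *m B)))%E.
Proof.
move=> B4 hB; pose D j : 'I_r -> seq 'rV[C]_n :=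
  fun=> [seq basis_vec R n i | i <- iota 0 j].
pose F j (g : GG) := negpow al (\prod_(j <= i < k) sqn (basis_vec R n i *m mx g i0 *m B)).
have mF j : measurable_fun setT (F j).
  apply: measurable_negpow; apply: measurable_prod => i _.
  exact: (measurable_sqn_mx i0 (basis_vec R n i) B (@measurable_id _ GG setT)).
have F0 j g : (0 <= F j g)%E by exact: negpow_ge0.
have claim j g0 : (j <= k)%N ->
    ((gain ^+ (k - j))%:E <= \int[Lam]_x F j (kap (D j) x * g0)%g)%E.
  have [p] := ubnP (k - j)%N; elim: p j g0 => // p ih j g0 kjp.
  rewrite leq_eqVlt => /predU1P[jk|jk].
    rewrite jk subnn expr0 /F; under eq_integral do rewrite big_geq // negpow_pos // invr1 expr1n.
    by rewrite int_cst.
  have DD h : fixes (D j.+1) h -> fixes (D j) h.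
    move=> fh i v; rewrite /D => /mapP[i' vD' ->]; apply: fh; move: vD'; rewrite mem_iota => /andP[_ ij].
    by rewrite /D; apply/mapP; exists i'; rewrite // mem_iota /= add0n ltnS ltnW.
  rewrite (int_kap_reveal_left Lam_inv DD (measurable_rmul g0 (mF j)) (fun _ => F0 _ _)).
  pose f x := sqn (basis_vec R n j *m mx (kap (D j) x) i0 *m (mx g0 i0 *m B)).
  have jn : (j < n)%N by lia.
  have orthD (v : 'rV[C]_n) : v \in D j i0 -> v *m (basis_vec R n j)^t* = 0.
    rewrite /D => /mapP[i ii ->]; have ij : (i < j)%N by rewrite mem_iota in ii.
    by rewrite basis_vec_orth ?(ltn_trans ij) // (ltn_eqF ij) raddf0.
  have fE x y : F j (kap (D j.+1) y * kap (D j) x * g0)%g =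
      negpow al (f x * \prod_(j.+1 <= i < k)
        sqn (basis_vec R n i *m mx (kap (D j.+1) y * kap (D j) x * g0)%g i0 *m B)).
    have e : basis_vec R n j *m mx (kap (D j.+1) y) i0 = basis_vec R n j.
      have vD : basis_vec R n j \in D j.+1 i0.
        by rewrite /D; apply/mapP; exists j; rewrite // mem_iota /= add0n ltnS.
      exact: (fixes_kap y vD).
    by rewrite /F (big_ltn jk) {1}mxM {1}mxM !mulmxA e /f !mulmxA.
  apply: le_trans (_ : \int[Lam]_x ((gain ^+ (k - j.+1))%:E * negpow al (f x)) <= _)%E.
    have gk : 0 <= gain ^+ (k - j.+1) by rewrite exprn_ge0 // ltW // gain_gt0.
    rewrite ge0_integralZl //; last 2 first.
    - apply: measurable_negpow; apply: measurable_sqn_mx; exact: measurable_kap.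
    - by move=> x _; exact: negpow_ge0.
    rewrite -subnSK // exprSr EFinM; apply: lee_wpmul2l; first by rewrite lee_fin.
    apply: int_nearly_null.
    - by rewrite size_map size_iota ltnW.
    - by rewrite sqn_basis_vec.
    - have [_ <-] := prs_projector (D j i0); rewrite -[basis_vec R n j]trmxCK -adjM.
      by rewrite (prs_annihilate orthD) adj0.
    - move=> v; rewrite mulmxA; apply: le_trans (B4 _) _.
      by rewrite sqn_unitary // mx_unitary.
    - by apply: nearly_null_mull => //; exact: mx_unitary.
  have mG : measurable_fun setT (fun z : GG * GG => F j (kap (D j.+1) z.2 * kap (D j) z.1 * g0)%g).
    apply: (measurableT_comp (mF j)); apply: measurable_mulg; last exact: measurable_cst.
    apply: measurable_mulg.
      by apply: measurable_snd_comp; exact: measurable_kap.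
    by apply: measurable_fst_comp; exact: measurable_kap.
  apply: ge0_le_integral => //.
  - move=> x _; apply: mule_ge0; last exact: negpow_ge0.
    by rewrite lee_fin exprn_ge0 // ltW // gain_gt0.
  - apply: measurable_funeM; apply: measurable_negpow; apply: measurable_sqn_mx; exact: measurable_kap.
  - exact: (measurable_fun_fubini_tonelli_F _ mG (fun z => F0 _ _)).
  - move=> x _; under eq_integral do rewrite fE.
    have [fx0|fx0] := leP (f x) 0.
      have -> : f x = 0 by apply/eqP; rewrite eq_le fx0 sqn_ge0.
      under eq_integral do rewrite mul0r.
      by rewrite int_cst [X in (_ <= X)%E]/negpow lexx leey.
    under eq_integral do rewrite negpowM //.
    rewrite ge0_integralZl //; last 3 first.
    - apply: measurable_negpow; apply: measurable_prod => i _.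
      apply: measurable_sqn_mx; apply: measurable_mulg; last exact: measurable_cst.
      by apply: measurable_mulg; [exact: measurable_kap|exact: measurable_cst].
    - by move=> y _; exact: negpow_ge0.
    - exact: negpow_ge0.
    rewrite muleC; apply: lee_wpmul2l; first exact: negpow_ge0.
    apply: le_trans (ih j.+1 (kap (D j) x * g0)%g _ jk) _; first by lia.
    rewrite le_eqVlt; apply/orP; left; apply/eqP; apply: eq_integral => y _.
    by rewrite /F mulgA.
have := claim 0%N 1%g (leq0n k); rewrite subn0 => low.
apply: le_trans low _; rewrite le_eqVlt; apply/orP; left; apply/eqP.
apply: eq_integral => x _; have -> : D 0%N = fun=> [::] by [].
by rewrite kap_nil mulg1.
Qed.
End Gain.
End Frames.

(** * Words with a nearly null space *)

Section Concentration.
Variables (R : realType) (n r : nat).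
Local Notation C := R[i].
Local Notation GG := (utuple R n r).
Variable Lam : probability GG R.
Hypothesis Lam_inv : forall (h : GG) (A : set GG), measurable A ->
  Lam ((fun g => (h * g)%g) @^-1` A) = Lam A.
Local Open Scope sesquilinear_scope.

(** Right invariance follows from left invariance, as a special case of the
    invariance of the laws of the stabilizers. *)
Lemma int_conjg h (phi : GG -> \bar R) :
  measurable_fun setT phi -> (forall x, (0 <= phi x)%E) ->
  (\int[Lam]_x phi (h * x * h^-1)%g = \int[Lam]_x phi x)%E.
Proof.
move=> mphi phi0; have mr := measurable_rmul h^-1%g mphi.
rewrite (int_mulg Lam_inv h mr) //.
have fh : fixes (fun _ : 'I_r => [::] : seq 'rV[C]_n) h^-1%g by move=> i v; rewrite in_nil.
have := int_kap_mulr Lam_inv fh mphi phi0.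
under eq_integral do rewrite kap_nil; move=> ->.
by under eq_integral do rewrite kap_nil.
Qed.

(** A single random unitary, used to conjugate all the matrices of a tuple. *)
Definition diagonal (i0 : 'I_r) (x : GG) : GG := [tuple tnth x i0 | _ < r].

Lemma mx_diagonal i0 x i : mx (diagonal i0 x) i = mx x i0.
Proof. by rewrite /mx tnth_mktuple. Qed.

Lemma measurable_diagonal i0 : measurable_fun setT (diagonal i0).
Proof.
apply: measurable_utuple => i.
by apply: (mmeas_ext _ (@mmeas_mx R n r i0)) => x; rewrite mx_diagonal.
Qed.

Lemma sqn_sub_scalar_le (A : 'M[C]_n) (z : C) (v : 'rV[C]_n) : A \is unitarymx ->
  complex.Re z ^+ 2 + complex.Im z ^+ 2 = 1 -> sqn (v *m (A - z%:M)) <= 4 * sqn v.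
Proof.
move=> AU z1; rewrite mulmxBr; apply: le_trans (sqnD_le _ _) _.
by rewrite sqnN mul_mx_scalar sqnZ z1 mul1r sqn_unitary //; lra.
Qed.

Variables (w : word r) (i0 : 'I_r) (k m : nat) (a : R).
Hypotheses (w_red : reduced w) (w0 : (0 < size w)%N) (k0 : (0 < k)%N).
Let l := size w.
Let al := (n - k * l.+1)%N.
Hypotheses (kl_n : (k * l.+1 <= n)%N) (nm_al : (n - m < al)%N).
Hypotheses (a0 : 0 < a) (a4 : a <= 4).

(** For a tuple in [X], the negative moment over the random frame is large by
    [int_frame].  Averaged over the tuple as well, it does not depend on the frame,
    and [int_potential] bounds it. *)
Theorem prob_nearly_null (X : set GG) : measurable X ->
  (forall g, X g -> exists2 z : C, complex.Re z ^+ 2 + complex.Im z ^+ 2 = 1 &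
    nearly_null m a (word_mx g w - z%:M)) ->
  ((gain n m al a ^+ k)%:E * Lam X <= ((2 ^+ n) ^+ (k * l))%:E)%E.
Proof.
move=> mX hX; pose c0 := (i0, false); have al0 : (0 < al)%N by lia.
have alk : (al + k <= n)%N.
  have kT : (k <= k * l.+1)%N by rewrite leq_pmulr.
  by rewrite /al; lia.
pose Psi (g : GG) := negpow al (potential w k g (k * l.+1)).
have mPsi : measurable_fun setT Psi.
  by apply: measurable_negpow; exact: measurable_potential.
have Psi0 g : (0 <= Psi g)%E by exact: negpow_ge0.
pose cj (z : GG * GG) := (diagonal i0 z.2 * z.1 * (diagonal i0 z.2)^-1)%g.
have mcj : measurable_fun setT cj.
  have md : measurable_fun setT (fun z : GG * GG => diagonal i0 z.2).
    by apply: measurable_snd_comp; exact: measurable_diagonal.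
  apply: measurable_mulg; last exact: measurable_invg.
  by apply: measurable_mulg => //; exact: measurable_fst.
have mF : measurable_fun setT (fun z => Psi (cj z)) by exact: measurableT_comp.
have gk : 0 <= gain n m al a ^+ k by rewrite exprn_ge0 // ltW // gain_gt0.
have low g : X g -> ((gain n m al a ^+ k)%:E <= \int[Lam]_x Psi (cj (g, x)))%E.
  move=> Xg; have [z z1 hz] := hX g Xg.
  have AU := word_mx_unitary g w.
  pose Phi (x : GG) := negpow al (\prod_(0 <= j < k)
    sqn (basis_vec R n j *m mx x i0 *m (word_mx g w - z%:M))).
  have mPhi : measurable_fun setT Phi.
    apply: measurable_negpow; apply: measurable_prod => j _.
    by apply: measurable_sqn_mx; exact: measurable_id.
  have Phi0 x : (0 <= Phi x)%E by exact: negpow_ge0.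
  have le_Psi x : (Phi x <= Psi (cj (g, x)))%E.
    apply: le_negpow; apply: le_trans (potential_end k0 _ z w0) _.
    rewrite le_eqVlt; apply/orP; left; apply/eqP; apply: eq_bigr => j _.
    have uU := mx_unitary x i0.
    have uV : (mx x i0)^t* \is unitarymx by rewrite trmxC_unitary.
    have e : word_mx (cj (g, x)) w = mx x i0 *m word_mx g w *m (mx x i0)^t*.
      by apply: word_mxJ => // i; rewrite !mxM mxV mx_diagonal.
    have ez : mx x i0 *m z%:M *m (mx x i0)^t* = z%:M.
      by rewrite mul_mx_scalar -scalemxAl mx_mulK scalemx1.
    have -> : word_mx (cj (g, x)) w - z%:M =
        mx x i0 *m (word_mx g w - z%:M) *m (mx x i0)^t*.
      by rewrite mulmxBr mulmxBl ez e.
    by rewrite 2!mulmxA (sqn_unitary _ uV).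
  have mPsi_g : measurable_fun setT (fun x => Psi (cj (g, x))).
    exact: measurableT_comp mF (pair1_measurable g).
  have frame : ((gain n m al a ^+ k)%:E <= \int[Lam]_x Phi x)%E.
    exact: (int_frame Lam_inv i0 a0 a4 nm_al alk (fun v => sqn_sub_scalar_le v AU z1) hz).
  apply: le_trans frame _.
  exact: (ge0_le_integral Lam measurableT (fun x _ => Phi0 x) mPhi mPsi_g
    (fun x _ => le_Psi x)).
have mI : measurable_fun setT (fun g : GG => (\1_X g : R)%:E).
  by apply/measurable_EFinP; exact: measurable_indic.
have -> : ((gain n m al a ^+ k)%:E * Lam X =
    \int[Lam]_g ((gain n m al a ^+ k)%:E * (\1_X g : R)%:E))%E.
  rewrite (ge0_integralZl Lam measurableT mI) //.
  by rewrite (integral_indic Lam measurableT mX) setIT.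
apply: le_trans (_ : \int[Lam]_g \int[Lam]_x Psi (cj (g, x)) <= _)%E.
  apply: ge0_le_integral => //.
  - by move=> g _; rewrite -EFinM lee_fin mulr_ge0.
  - exact: measurable_funeM.
  - exact: (measurable_fun_fubini_tonelli_F _ mF (fun z => Psi0 _)).
  - move=> g _; rewrite indicE; have [gX|gX] := boolP (g \in X).
      by rewrite mule1; apply: low; exact: set_mem.
    by rewrite mule0; apply: integral_ge0.
rewrite (int_swap Lam mF) //.
have -> : (\int[Lam]_x \int[Lam]_g Psi (cj (g, x)) = \int[Lam]_g Psi g)%E.
  transitivity (\int[Lam]_x \int[Lam]_g Psi g)%E; last exact: int_cst.
  by apply: eq_integral => x _; exact: (int_conjg (diagonal i0 x) mPsi Psi0).
exact: (int_potential Lam_inv c0 k0 w_red al0 kl_n).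
Qed.
End Concentration.

(** * Eigenvalues in an arc *)

Section Eigenvalues.
Variables (R : realType) (n : nat).
Local Notation C := R[i].
Local Open Scope complex_scope.
Local Open Scope sesquilinear_scope.

Lemma eigenvalues_prod (A : 'M[C]_n) :
  char_poly A = \prod_(x <- eigenvalues A) ('X - x%:P).
Proof.
rewrite {1}(svalP (closed_field_poly_normal (char_poly A))) -/(eigenvalues A).
by rewrite (monicP (char_poly_monic A)) scale1r.
Qed.

Lemma unitary_diagonalization (A : 'M[C]_n) : A \is unitarymx ->
  exists (U : 'M[C]_n) (d : 'rV[C]_n), [/\ U \is unitarymx,
    A = U^t* *m diag_mx d *m U & perm_eq (eigenvalues A) [seq d 0 i | i : 'I_n]].
Proof.
move=> /unitarymxP AA; have An : A \is normalmx.
  by apply/normalmxP; rewrite AA; apply/esym/mulmx1C.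
have /orthomx_spectralP := An.
set U := spectralmx A; set d := spectral_diag A => AE.
have Uu : U \is unitarymx by exact: spectral_unitarymx.
rewrite (invmx_unitary Uu) in AE; exists U, d; split => //.
have UU : U^t* *m U = 1%:M := mulmx1C (unitarymxP Uu).
have cA : char_poly A = char_poly (diag_mx d).
  pose f := @polyC C; pose U' : 'M[C]_n := U^t*.
  have e : char_poly_mx A = map_mx f U' *m char_poly_mx (diag_mx d) *m map_mx f U.
    rewrite /char_poly_mx mulmxBr mulmxBl mul_mx_scalar -scalemxAl -!map_mxM -AE.
    by rewrite UU map_mx1 scalemx1.
  rewrite /char_poly e !det_mulmx mulrAC -det_mulmx -map_mxM UU map_mx1 det1.
  by rewrite mul1r.
apply: prod_XsubC_eq; rewrite -eigenvalues_prod cA char_poly_trig; last first.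
  exact: diag_mx_is_trig.
rewrite big_image /=; apply: eq_bigr => i _.
by rewrite !mxE eqxx mulr1n.
Qed.

Lemma ler_norm_sin (x : R) : `|sin x| <= `|x|.
Proof.
wlog x0 : x / 0 <= x.
  move=> h; have [x0|x0] := leP 0 x; first exact: h.
  by rewrite -normrN -sinN -[leRHS]normrN h // oppr_ge0 ltW.
have [c _] := @MVT_segment R sin cos 0 x x0 (fun y _ => is_derive_sin y)
  (continuous_subspaceT (@continuous_sin R)).
rewrite sin0 !subr0 => ->; rewrite normrM -[leRHS]mul1r ler_wpM2r //.
exact: cos_max.
Qed.

(** The chord between two angles that differ by [2 * y] is [2 * `|sin y|]. *)
Lemma chord_le (s t : R) :
  (cos s - cos t) ^+ 2 + (sin s - sin t) ^+ 2 <= (s - t) ^+ 2.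
Proof.
pose y := (s - t) / 2; have st : s - t = y *+ 2 by rewrite /y mulr2n; field.
have -> : (cos s - cos t) ^+ 2 + (sin s - sin t) ^+ 2 = 2 - 2 * cos (s - t).
  rewrite cosB; have := cos2Dsin2 s; have := cos2Dsin2 t; lra.
have -> : 2 - 2 * cos (s - t) = 4 * sin y ^+ 2.
  by rewrite st cos_mulr2n sin2cos2 mulr2n; ring.
have : sin y ^+ 2 <= y ^+ 2.
  by rewrite -[leLHS]real_normK ?num_real // -[leRHS]real_normK ?num_real // lerXn2r ?nnegrE // ler_norm_sin.
by rewrite st mulr2n; lra.
Qed.

(** The eigenvectors whose eigenvalues lie in the arc are orthogonal, and these
    eigenvalues are at distance at most [eps] from the midpoint of the arc. *)
Lemma arc_nearly_null (A : 'M[C]_n) (t eps : R) (m : nat) : A \is unitarymx ->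
  (m <= count (mem (circle_arc t (2 * eps))) (eigenvalues A))%N ->
  nearly_null m (eps ^+ 2) (A - (cos (t + eps) +i* sin (t + eps))%:M).
Proof.
set z := (_ +i* _) => AU mA; have [U [d [Uu AE /permP dA]]] := unitary_diagonalization AU.
pose I := finset.finset (fun i => d 0 i \in circle_arc t (2 * eps)).
have UU : U^t* *m U = 1%:M := mulmx1C (unitarymxP Uu).
have Uf : row_free U by rewrite row_free_unit unitarymx_unit.
exists (coord_proj R I *m U).
  rewrite mxrankMfree // rank_coord_proj; apply: leq_trans mA _.
  rewrite dA count_map -sum1_count -sum1_card big_enum_cond.
  by apply: eq_leq; apply: eq_bigl => i; rewrite /I finset.in_set.
move=> v /submxP[x ->]; set y := x *m coord_proj R I.
have yI i : i \notin I -> y 0 i = 0 by move=> iI; rewrite coord_projE (negbTE iI).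
have -> : x *m (coord_proj R I *m U) *m (A - z%:M) = (y *m (diag_mx d - z%:M)) *m U.
  rewrite mulmxA -/y AE mulmxBr [in RHS]mulmxBr mulmxBl !mul_mx_scalar -scalemxAl.
  by rewrite !mulmxA -[y *m U *m _]mulmxA (unitarymxP Uu) mulmx1.
rewrite (sqn_unitary _ Uu) [in leRHS]mulmxA -/y (sqn_unitary _ Uu) /sqn mulr_sumr; apply: ler_sum => i _.
have -> : (y *m (diag_mx d - z%:M)) 0 i = y 0 i * (d 0 i - z).
  by clearbody y; rewrite mulmxBr mul_mx_diag mul_mx_scalar !mxE [z * _]mulrC -mulrBr.
rewrite -![complex.Re _ ^+ 2 + complex.Im _ ^+ 2]/(nsq _).
have [iI|iI] := boolP (i \in I); last first.
  by rewrite yI // mul0r /nsq /= expr0n /= addr0 mulr0.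
rewrite nsqM mulrC ler_wpM2r //; first by rewrite addr_ge0 ?sqr_ge0.
move: iI; rewrite inE => /set_mem [s]; rewrite /= in_itv /= => /andP[s0 s2] <-.
rewrite /nsq /=; apply: le_trans (chord_le _ _) _.
rewrite (_ : t + s - (t + eps) = s - eps); last by ring.
by rewrite -subr_ge0 subr_sqr mulr_ge0 //; lra.
Qed.

End Eigenvalues.

(** * Measurability of clustering *)

Section ComplexContinuity.
Variables (R : realType) (T : topologicalType).
Local Notation C := R[i].

Definition ccont (f : T -> C) :=
  continuous (fun t => complex.Re (f t)) /\ continuous (fun t => complex.Im (f t)).

Lemma ccont_cst c : ccont (fun=> c).
Proof. by split => t; exact: cvg_cst. Qed.

Lemma ccontB f g : ccont f -> ccont g -> ccont (fun t => f t - g t).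
Proof.
move=> [f1 f2] [g1 g2]; split=> t.
  have -> : (fun t => complex.Re (f t - g t)) =
      (fun t => complex.Re (f t) - complex.Re (g t)).
    by apply/funext => x; case: (f x) (g x) => a b [c d].
  by apply: cvgB; [exact: f1|exact: g1].
have -> : (fun t => complex.Im (f t - g t)) =
    (fun t => complex.Im (f t) - complex.Im (g t)).
  by apply/funext => x; case: (f x) (g x) => a b [c d].
by apply: cvgB; [exact: f2|exact: g2].
Qed.

Lemma ccontM f g : ccont f -> ccont g -> ccont (fun t => f t * g t).
Proof.
move=> [f1 f2] [g1 g2]; split=> t.
  have -> : (fun t => complex.Re (f t * g t)) = (fun t =>
      complex.Re (f t) * complex.Re (g t) - complex.Im (f t) * complex.Im (g t)).
    by apply/funext => x; case: (f x) (g x) => a b [c d].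
  by apply: cvgB; apply: cvgM; [exact: f1|exact: g1|exact: f2|exact: g2].
have -> : (fun t => complex.Im (f t * g t)) = (fun t =>
    complex.Re (f t) * complex.Im (g t) + complex.Im (f t) * complex.Re (g t)).
  by apply/funext => x; case: (f x) (g x) => a b [c d].
by apply: cvgD; apply: cvgM; [exact: f1|exact: g2|exact: f2|exact: g1].
Qed.

Lemma ccont_prod (I : Type) (s : seq I) (f : I -> T -> C) :
  (forall i, ccont (f i)) -> ccont (fun t => \prod_(i <- s) f i t).
Proof.
move=> hf; elim: s => [|i s ih].
  by under eq_fun do rewrite big_nil; exact: ccont_cst.
by under eq_fun do rewrite big_cons; exact: ccontM.
Qed.

Lemma continuous_nsq f : ccont f -> continuous (fun t => nsq (f t)).
Proof.
move=> [f1 f2] t; rewrite /nsq.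
by apply: cvgD; apply: cvgM; [exact: f1|exact: f1|exact: f2|exact: f2].
Qed.

Lemma continuous_sumR (I : Type) (s : seq I) (f : I -> T -> R) :
  (forall i, continuous (f i)) -> continuous (fun t => \sum_(i <- s) f i t).
Proof.
move=> hf; elim: s => [|i s ih].
  by under eq_fun do rewrite big_nil; exact: cst_continuous.
by under eq_fun do rewrite big_cons; move=> t; exact: (cvgD (hf i t) (ih t)).
Qed.
End ComplexContinuity.

Section Clustering.
Variables (R : realType) (n m : nat) (eps : R).
Hypotheses (mn : (m <= n)%N) (eps0 : 0 < eps).
Local Notation C := R[i].
Local Notation U := (unitary R n).
Local Open Scope complex_scope.
Local Open Scope sesquilinear_scope.

Definition cis (x : R) : C := cos x +i* sin x.

Lemma nsq_cis x : nsq (cis x) = 1.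
Proof. by rewrite /nsq /= cos2Dsin2. Qed.

(** The bound is any number above [2 * pi]. *)
Lemma cis_onto (z : C) : nsq z = 1 -> exists2 x, 0 <= x <= 8 & z = cis x.
Proof.
case: z => a b; rewrite /nsq /= => ab.
have pi4 : (pi : R) < 4 by have := @pihalf_lt2 R; lra.
have pi_0 : 0 < (pi : R) := pi_gt0 R.
have a1 : -1 <= a <= 1.
  by rewrite -ler_norml -(@ler_pXn2r _ 2) ?nnegrE // expr1n real_normK ?num_real // -ab lerDl sqr_ge0.
have [x0 xpi] := (acos_ge0 a1, acos_lepi a1).
have cx : cos (acos a) = a by apply: acosK; rewrite in_itv.
have sx : sin (acos a) ^+ 2 = b ^+ 2 by rewrite sin2cos2 cx -ab; ring.
have s0 : 0 <= sin (acos a) by apply: sin_ge0_pi; rewrite x0 xpi.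
have [b0|b0] := leP 0 b.
  exists (acos a); first by rewrite x0 /=; lra.
  rewrite /cis cx; congr (_ +i* _); apply/eqP; rewrite eq_sym.
  by rewrite -(eqrXn2 (n := 2)) // sx.
exists (pi *+ 2 - acos a); first by rewrite mulr2n; lra.
rewrite /cis cosB sinB cos2pi sin2pi cx !mul0r mul1r addr0 sub0r.
congr (_ +i* _).
have /eqP : (sin (acos a) - b) * (sin (acos a) + b) = 0 by rewrite -subr_sqr sx subrr.
by rewrite mulf_eq0 => /orP[] /eqP; lra.
Qed.

(** Angles of [n] points of the circle, the first [m] of which lie in an arc of
    length [2 * eps] that starts at the angle [8 * u 0 0]. *)
Definition angle (u : 'rV[R]_n.+1) (j : 'I_n) : R :=
  if (j < m)%N then 8 * u 0 0 + 2 * eps * u 0 (lift ord0 j) else 8 * u 0 (lift ord0 j).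

Definition cube : set 'rV[R]_n.+1 := [set u | forall i, 0 <= u ord0 i <= 1].

(** The characteristic polynomial and the monic polynomial with the prescribed
    roots have degree [n]; they are compared at [n + 1] points. *)
Definition defect (A : 'M[C]_n) (u : 'rV[R]_n.+1) : R := \sum_(c < n.+1)
  nsq (\det ((c%:R)%:M - A) - \prod_(j < n) (c%:R - cis (angle u j))).

Lemma horner_char_poly (A : 'M[C]_n) (x : C) : (char_poly A).[x] = \det (x%:M - A).
Proof.
rewrite -[LHS]/(horner_eval x (char_poly A)) /char_poly -det_map_mx; congr (\det _).
apply/matrixP => i j; rewrite !mxE rmorphB rmorphMn /= /horner_eval.
by rewrite hornerX hornerC.
Qed.

Lemma defect_eq0 (A : 'M[C]_n) u :
  defect A u = 0 <-> perm_eq (eigenvalues A) [seq cis (angle u j) | j : 'I_n].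
Proof.
pose q : {poly C} := \prod_(z <- [seq cis (angle u j) | j : 'I_n]) ('X - z%:P).
have qE x : q.[x] = \prod_(j < n) (x - cis (angle u j)).
  by rewrite /q big_image /= horner_prod; apply: eq_bigr => j _; rewrite !hornerE.
split; last first.
  move=> pe; have cq : char_poly A = q by rewrite eigenvalues_prod; exact: perm_big.
  rewrite /defect big1 // => c _; rewrite -horner_char_poly cq qE subrr.
  by rewrite /nsq /= expr0n /= addr0.
move=> /eqP; rewrite psumr_eq0 => [|c _]; last exact: nsq_ge0.
move=> /allP h; apply: prod_XsubC_eq; rewrite -eigenvalues_prod -/q.
apply/eqP; rewrite -subr_eq0; apply/eqP.
apply: (@roots_geq_poly_eq0 _ _ [seq (c : nat)%:R | c : 'I_n.+1]).
- apply/allP => x /mapP[c _ ->]; rewrite /root !hornerE horner_char_poly qE.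
  have /implyP/(_ isT)/eqP := h c (mem_index_enum _).
  move=> e; have : sqn ((\det ((c%:R)%:M - A) - \prod_(j < n) (c%:R - cis (angle u j)))%:M : 'rV[C]_1) == 0.
    by rewrite sqn_nsq big_ord1 mxE eqxx mulr1n e.
  by rewrite sqn_eq0 => /eqP/rowP/(_ 0); rewrite !mxE eqxx mulr1n => ->.
- by rewrite map_inj_uniq ?enum_uniq // => c c' /eqP; rewrite eqr_nat => /eqP /val_inj.
- rewrite size_map size_enum_ord; apply: leq_trans (size_polyD _ _) _.
  rewrite size_polyN geq_max size_char_poly leqnn /=.
  by rewrite /q size_prod_XsubC size_map size_enum_ord.
Qed.

(** Turning the quantifier over arcs into one over a compact set of angles. *)
Lemma clusteredP (A : 'M[C]_n) : A \is unitarymx ->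
  (exists t, (m <= count (mem (circle_arc t (2 * eps))) (eigenvalues A))%N) <->
  exists2 u, cube u & defect A u = 0.
Proof.
move=> AU; have e2 : 0 < 2 * eps by rewrite mulr_gt0.
split=> [[t mt]|[u uc /defect_eq0 /permP pe]]; last first.
  exists (8 * u 0 0); rewrite pe count_map -sum1_count big_enum_cond /=.
  rewrite [leqLHS](_ : m = \sum_(j < n | (j < m)%N) 1)%N; last first.
    by rewrite -(big_ord_widen n (fun=> 1%N) mn) sum_nat_const card_ord muln1.
  rewrite big_mkcond [leqRHS]big_mkcond; apply: leq_sum => j _; case: ifP => // jm.
  case: ifP => // /negP; case; apply/mem_set; exists (2 * eps * u 0 (lift ord0 j)).
    have /andP[h0 h1] := uc (lift ord0 j); rewrite /= in_itv /= mulr_ge0 ?(ltW e2) //=.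
    by rewrite -[leRHS]mulr1 ler_pM2l.
  by rewrite /angle jm.
set arc := circle_arc t (2 * eps) in mt.
(* The eigenvalues that lie in the arc come first. *)
pose e := [seq x <- eigenvalues A | mem arc x] ++ [seq x <- eigenvalues A | predC (mem arc) x].
have pe : perm_eq e (eigenvalues A) by apply/permPl; exact: perm_filterC.
have [V [d [Vu AE pd]]] := unitary_diagonalization AU.
have size_e : size e = n.
  by rewrite (perm_size pe) (perm_size pd) size_map size_enum_ord.
have unit_e j : (j < n)%N -> nsq e`_j = 1.
  move=> jn; have : e`_j \in e by rewrite mem_nth // size_e.
  rewrite (perm_mem pe) (perm_mem pd) => /mapP[i _ ->].
  have VV : V^t* *m V = 1%:M := mulmx1C (unitarymxP Vu).
  have Vu' : V^t* \is unitarymx by rewrite trmxC_unitary.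
  have dE : diag_mx d = V *m A *m V^t*.
    by rewrite AE !mulmxA (unitarymxP Vu) mul1mx -mulmxA (unitarymxP Vu) mulmx1.
  have du : diag_mx d \is unitarymx by rewrite dE; exact: mul_unitarymx (mul_unitarymx Vu AU) Vu'.
  have ni : (i < n)%N by [].
  rewrite -(sqn_basis_vec R ni) -(sqn_unitary _ du) (basis_vec_mul i).
  rewrite sqn_nsq (bigD1 i) //= big1 ?addr0 ?mxE ?eqxx ?mulr1n //.
  move=> k ki; rewrite !mxE eq_sym (negbTE ki) mulr0n /nsq /=.
  by rewrite expr0n /= addr0.
have arc_e j : (j < m)%N -> arc e`_j.
  move=> jm; have js : (j < size [seq x <- eigenvalues A | mem arc x])%N.
    by rewrite size_filter; exact: leq_trans mt.
  have := mem_nth 0 js; rewrite /e nth_cat js mem_filter => /andP[+ _].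
  by move=> /set_mem.
have [T /andP[T0 T8] tT] := cis_onto (nsq_cis t).
have hv (j : 'I_n) : exists v : R, 0 <= v <= 1 /\
    e`_j = cis (if (j < m)%N then T + 2 * eps * v else 8 * v).
  case jm : (j < m)%N.
    have [s /=] := arc_e _ jm; rewrite in_itv /= => /andP[s0 s1] <-.
    exists (s / (2 * eps)); rewrite divr_ge0 ?(ltW e2) //= ler_pdivrMr // mul1r s1.
    split=> //; rewrite mulrCA divff ?gt_eqF // mulr1 /cis.
    by case: tT => c1 c2; rewrite !cosD !sinD c1 c2.
  have [x /andP[x0 x8] ->] := cis_onto (unit_e _ (ltn_ord j)).
  exists (x / 8); rewrite divr_ge0 //= ler_pdivrMr // mul1r x8; split=> //.
  by rewrite mulrCA divff ?mulr1.
have [v hv'] := choice hv.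
pose u : 'rV[R]_n.+1 := \row_i (if unlift ord0 i is Some j then v j else T / 8).
exists u.
  move=> i; rewrite mxE; case: unliftP => [j _|_]; first by case: (hv' j).
  by rewrite divr_ge0 //= ler_pdivrMr // mul1r.
apply/defect_eq0; rewrite perm_sym; suff -> : [seq cis (angle u j) | j : 'I_n] = e by [].
apply: (@eq_from_nth _ 0); first by rewrite size_map size_enum_ord size_e.
move=> j; rewrite size_map size_enum_ord => jn.
rewrite (nth_map (Ordinal jn)) ?size_enum_ord //.
have -> : nth (Ordinal jn) (enum 'I_n) j = Ordinal jn.
  by apply: val_inj; rewrite /= nth_enum_ord.
have [_ ->] := hv' (Ordinal jn); congr (cis _); rewrite /angle /= !mxE liftK unlift_none.
by rewrite mulrCA divff ?mulr1.
Qed.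

Lemma continuous_defect (A : 'M[C]_n) : continuous (defect A).
Proof.
have cc (i : 'I_n.+1) : continuous (fun u : 'rV[R]_n.+1 => u 0 i) .
  by move=> x; exact: coord_continuous.
have ca (j : 'I_n) : continuous (fun u => angle u j).
  have cl (b : R) i : continuous (fun u : 'rV[R]_n.+1 => b * u 0 i).
    by move=> u; apply: continuousM; [exact: cst_continuous|exact: cc].
  rewrite /angle; case: (j < m)%N => u; last exact: cl.
  exact: (cvgD (cl 8 0 u) (cl (2 * eps) (lift ord0 j) u)).
rewrite /defect; apply: continuous_sumR => c.
apply: continuous_nsq; apply: ccontB; first exact: ccont_cst.
apply: ccont_prod => j; apply: ccontB; first exact: ccont_cst.
by split=> x /=; apply: continuous_comp; [exact: ca|exact: continuous_cos|exact: ca|exact: continuous_sin].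
Qed.

Lemma measurable_defect u : measurable_fun setT (fun g : U => defect g u).
Proof.
apply: measurable_sum => c.
have [m1 m2] : cmeas (fun g : U => \det ((c%:R)%:M - unitary_mx g) -
    \prod_(j < n) (c%:R - cis (angle u j))).
  apply: cmeasD; last exact: cmeas_cst.
  apply: cmeas_det; apply: mmeasB; first exact: mmeas_cst.
  exact: mmeas_unitary.
by apply: measurable_funD; apply: measurable_funX.
Qed.

Lemma compact_cube : compact cube.
Proof.
have := @rV_compact _ _ (fun _ : 'I_n.+1 => `[0, 1]%classic : set R) (fun=> @segment_compact R 0 1).
by congr compact; apply/seteqP; split => u /= h i; have := h i; rewrite in_itv.
Qed.

(** The defect attains its minimum on the cube, so it vanishes somewhere as
    soon as it takes arbitrarily small values; by continuity the latter can be
    tested at rational points. *)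
Lemma measurable_clustered : measurable [set g : U |
  exists t, (m <= count (mem (circle_arc t (2 * eps))) (eigenvalues g))%N].
Proof.
pose pt (q : 'rV[rat]_n.+1) : 'rV[R]_n.+1 := map_mx ratr q.
pose Y N (q : 'rV[rat]_n.+1) := [set g : U | cube (pt q) /\ defect g (pt q) < N.+1%:R^-1].
rewrite (_ : [set g | _] = \bigcap_N \bigcup_q Y N q).
  apply: bigcapT_measurable => N; apply: countable_bigcupT_measurable.
    exact: countableP.
  move=> q; have [cq|cq] := pselect (cube (pt q)); last first.
    by rewrite (_ : Y N q = set0) //; apply/seteqP; split => g // [].
  rewrite (_ : Y N q = [set g : U | defect g (pt q) < N.+1%:R^-1]).
    rewrite -[X in measurable X]setTI.
    exact: (measurable_fun_ltr (measurable_defect (pt q)) (measurable_cst _)).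
  by apply/seteqP; split => g; [case|].
apply/seteqP; split => g; rewrite /= (clusteredP (unitary_mxP g)).
  move=> [u uc du] N _.
  have N0 : (0 : R) < N.+1%:R^-1 by rewrite invr_gt0.
  have := @continuous_defect g u; rewrite /continuous_at du => /cvgrPdist_lt /(_ _ N0).
  move=> /nbhs_ballP[d /= d0 hd].
  have hq (i : 'I_n.+1) : exists q : rat, 0 <= (ratr q : R) <= 1 /\ `|u 0 i - ratr q| < d.
    have /andP[u0 u1] := uc i.
    have lt : Num.max 0 (u 0 i - d) < Num.min 1 (u 0 i + d).
      by rewrite lt_min !gt_max !ltr01 /=; apply/and3P; split; lra.
    have [q] := rat_in_itvoo lt; rewrite in_itv /= gt_max lt_min.
    move=> /andP[/andP[q0 qd] /andP[q1 qd']]; exists q; split; first by rewrite !ltW.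
    by rewrite ltr_norml; lra.
  have [q hq'] := choice hq.
  exists (\row_i q i) => //; split.
    by move=> i; rewrite !mxE; case: (hq' i).
  have := hd (pt (\row_i q i)); rewrite sub0r normrN => h.
  apply: le_lt_trans (ler_norm _) (h _).
  split=> // i j; rewrite !mxE ord1; case: (hq' j) => _.
  by rewrite /ball /= /ball_.
move=> h; have [||u uc umin] := @EVT_min_rV R n.+1 (defect g) cube _ compact_cube.
- by exists 0 => i; rewrite mxE lexx ler01.
- by apply: continuous_subspaceT; exact: continuous_defect.
exists u; first exact: set_mem.
apply/eqP; rewrite eq_le sumr_ge0 ?andbT; last by move=> c _; exact: nsq_ge0.
rewrite leNgt; apply/negP => du.
have [N hN] : exists N, N.+1%:R^-1 < defect g u.
  have [N _ hN] := near_infty_natSinv_lt (PosNum du).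
  by exists N; apply: hN => /=.
have [q _ [cq dq]] := h N I.
have := umin (pt q) (mem_set cq); rewrite leNgt => /negP; apply.
exact: lt_trans dq hN.
Qed.
End Clustering.

(** * The law of independent Haar unitaries *)

Section Rectangles.
Variables (d : measure_display) (T : measurableType d) (r : nat) (R : realType).

Definition rectangle (A : 'I_r -> set T) : set (r.-tuple T) :=
  [set x | forall i, A i (tnth x i)].

Lemma measurable_rectangle (A : 'I_r -> set T) : (forall i, measurable (A i)) ->
  measurable (rectangle A).
Proof.
move=> mA; rewrite (_ : rectangle A = \bigcap_(i in [set: 'I_r]) ((fun x => tnth x i) @^-1` A i)).
  apply: fin_bigcap_measurable => [|i _]; first exact: finite_finset.
  by rewrite -[X in measurable X]setTI; exact: measurable_tnth.
by apply/seteqP; split=> x /= h i; [move=> _; exact: h|exact: h].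
Qed.

(** The rectangles are stable under intersection and generate the
    sigma-algebra. *)
Lemma rectangle_measure_unique (mu nu : {measure set (r.-tuple T) -> \bar R}) :
  (mu setT < +oo)%E ->
  (forall A, (forall i, measurable (A i)) -> mu (rectangle A) = nu (rectangle A)) ->
  forall X, measurable X -> mu X = nu X.
Proof.
move=> fin_mu mn X mX.
pose Rect := [set rectangle A | A in [set A : 'I_r -> set T | forall i, measurable (A i)]].
have rectT : Rect setT.
  exists (fun=> setT); first by move=> i; exact: measurableT.
  by apply/seteqP; split.
apply: (measure_unique Rect (fun=> setT)) => //.
- apply/seteqP; split; last first.
    apply: smallest_sub; first exact: sigma_algebra_measurable.
    by move=> _ [A mA <-]; exact: measurable_rectangle.
  apply: smallest_sub; first exact: smallest_sigma_algebra.
  elim/big_ind: _ => // [A B hA hB Y [/hA|/hB]//|i _ _ [B mB <-]].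
  apply: sub_sigma_algebra; exists (fun j => if j == i then B else setT).
    by move=> j; case: ifP => _ //; exact: measurableT.
  rewrite setTI; apply/seteqP; split=> x /= h; first by have := h i; rewrite eqxx.
  by move=> j; case: eqP => // ->.
- move=> _ _ [A mA <-] [B mB <-]; exists (fun i => A i `&` B i).
    by move=> i; exact: measurableI.
  by apply/seteqP; split=> x /=; [move=> h; split=> i; case: (h i)|case].
- by rewrite bigcup_const //; exists 0%N.
- by move=> _ [A mA <-]; exact: mn.
Qed.
End Rectangles.

Section JointLaw.
Variables (R : realType) (n r : nat) (d : measure_display) (Omega : measurableType d).
Variables (P : probability Omega R) (G : 'I_r -> {RV P >-> unitary R n}).
Local Notation GG := (utuple R n r).

Definition joint (omega : Omega) : GG := [tuple G i omega | i < r].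

Lemma measurable_joint : measurable_fun setT joint.
Proof.
apply/measurable_fun_tnthP => i.
rewrite (_ : _ \o joint = G i); first exact: measurable_funPT.
by apply/funext => omega; rewrite /= tnth_mktuple.
Qed.

HB.instance Definition _ := isMeasurableFun.Build _ _ Omega GG joint measurable_joint.

Definition joint_law : probability GG R := distribution P joint.

Lemma joint_lawE A : joint_law A = P (joint @^-1` A).
Proof. by []. Qed.

Hypotheses (indep : mutually_independent G)
  (haar : forall i, is_haar (distribution P (G i))).

Lemma joint_law_rectangle (A : 'I_r -> set (unitary R n)) :
  (forall i, measurable (A i)) ->
  joint_law (rectangle A) = (\prod_(i < r) distribution P (G i) (A i))%E.
Proof.
move=> mA; have := indep (J := finset.setTfor 'I_r) (fun i _ => mA i).
rewrite (eq_bigl xpredT) => [<-|i]; last by rewrite finset.in_setT.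
congr (P _); apply/seteqP; split=> omega /= h i.
  by move=> _; have := h i; rewrite tnth_mktuple.
by rewrite tnth_mktuple; apply: h; rewrite /= finset.in_setT.
Qed.

(** A translation carries rectangles to rectangles, on which independence reduces
    the claim to the invariance of each factor. *)
Lemma joint_law_invariant (h : GG) (X : set GG) : measurable X ->
  joint_law ((fun g => (h * g)%g) @^-1` X) = joint_law X.
Proof.
move=> mX; have mh : measurable_fun setT (fun g : GG => (h * g)%g).
  by apply: measurable_mulg; [exact: measurable_cst|exact: measurable_id].
pose nu := pushforward joint_law (fun g : GG => (h * g)%g).
apply/esym; apply: (@rectangle_measure_unique _ _ _ _ joint_law nu _ _ X mX).
  by rewrite [ltLHS](probability_setT joint_law) ltry.
move=> A mA; pose hA i := (fun g => (tnth h i * g)%g) @^-1` A i.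
have imE i : hA i = [set ((tnth h i)^-1 * g)%g | g in A i].
  apply/seteqP; split=> [g hg|_ [g gA <-]]; last by rewrite /hA /= mulVKg.
  by exists (tnth h i * g)%g => //; rewrite mulKg.
have mhA i : measurable (hA i).
  rewrite -[hA i]setTI; apply: measurable_unitary => //.
  apply: (mmeas_ext (A := fun g : unitary R n => unitary_mx (tnth h i) *m unitary_mx g)) => //.
  by apply: mmeasM; [exact: mmeas_cst|exact: mmeas_unitary].
have nuE : nu (rectangle A) = joint_law (rectangle hA).
  congr (joint_law _); apply/seteqP; split=> g /= gA i; have := gA i; rewrite tnth_mktuple //.
apply: etrans _ (esym nuE).
apply: etrans (joint_law_rectangle mA) (etrans _ (esym (joint_law_rectangle mhA))).
apply: eq_bigr => i _; rewrite imE; apply/esym; exact: haar.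
Qed.
End JointLaw.

(** * Choice of the parameters *)

Section Tuning.
Variable R : realType.

(** The exponent [2 * k * (M - 1 - k * L)] is a quadratic function of [k] whose
    maximum is close to [M / (2 * L)]; an integer at distance at most [1 / 2]
    of that point loses at most half of the maximum. *)
Lemma exponent_lower (M L k : R) : 8 < M -> 4 * (L - 1) < M -> 2 <= L ->
  - L <= 2 * k * L - M <= L -> M ^+ 2 / (4 * L) <= 2 * k * (M - 1 - k * L).
Proof.
move=> M8 LM L2 /andP[y1 y2]; have L0 : 0 < 4 * L by lra.
rewrite ler_pdivrMr //; set y := 2 * k * L - M in y1 y2.
have -> : 2 * k * (M - 1 - k * L) * (4 * L) =
   2 * M ^+ 2 - 2 * y ^+ 2 - 4 * (y + M) by rewrite /y; ring.
have yL : y ^+ 2 <= L ^+ 2.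
  by rewrite -subr_ge0 subr_sqr mulr_ge0 //; lra.
have L_le : 2 * L ^+ 2 <= 2 * (M / 4 + 1) ^+ 2.
  by rewrite ler_pM2l // lerXn2r ?nnegrE //; lra.
have M_ge : 0 <= (M - 8) * (7 * M + 8) by rewrite mulr_ge0 //; lra.
by nra.
Qed.

(** What [gain] says of the probability [p], once the powers of 2 are counted:
    they add up to less than [3 * n ^ 2]. *)
Lemma tail_lt (n m l k : nat) (eps x p : R) (al := (n - k * l.+1)%N)
    (E := (al - (n - m).+1)%N) : (0 < n)%N -> (k * (l + 5) < 3 * n)%N ->
  0 < eps -> eps < 1 -> x <= (2 * (E * k))%:R ->
  gain n m al (eps ^+ 2) ^+ k * p <= (2 ^+ n) ^+ (k * l) ->
  p < 2 ^+ (3 * n ^ 2) * eps `^ x.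
Proof.
move=> n0 kl e0 e1 xE gp; set g := gain n m al (eps ^+ 2) in gp.
have g0 : 0 < g by apply: gain_gt0; rewrite exprn_gt0.
have gE : 1 <= g * 2 ^+ (3 * al + 2 * n) * eps ^+ (2 * E).
  have -> : g * 2 ^+ (3 * al + 2 * n) * eps ^+ (2 * E) = 4 ^+ E.
    rewrite /g /gain exprD !exprM invf_div !exprVn !expr_div_n.
    have e2 : (2 ^+ 3 : R) = 8 by rewrite !exprS expr0; ring.
    have -> : (2 ^+ 2 : R) = 4 by rewrite !exprS expr0; ring.
    rewrite e2; field.
    by rewrite !expf_neq0 // ?gt_eqF // exprn_gt0.
  by rewrite exprn_ege1 // ler1n.
have gEk : 1 <= g ^+ k * 2 ^+ ((3 * al + 2 * n) * k) * eps ^+ (2 * (E * k)).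
  have -> : eps ^+ (2 * (E * k)) = (eps ^+ (2 * E)) ^+ k by rewrite -exprM mulnA.
  by rewrite [2 ^+ (_ * k)]exprM -!exprMn exprn_ege1.
have xk : eps ^+ (2 * (E * k)) <= eps `^ x.
  have e01 : 0 < eps <= 1 by rewrite e0 ltW.
  by have := ger_powR e01 xE; rewrite powR_mulrn // ltW.
have two : ((3 * al + 2 * n) * k + n * (k * l) < 3 * n ^ 2)%N.
  have al_n : (al <= n)%N by exact: leq_subr.
  have : ((3 * al + 2 * n) * k <= 5 * n * k)%N by rewrite leq_mul2r; apply/orP; right; lia.
  have : (n * (k * (l + 5)) < n * (3 * n))%N by rewrite ltn_pmul2l.
  rewrite -mulnn; nia.
have e2k : 0 < g ^+ k * 2 ^+ ((3 * al + 2 * n) * k) * eps ^+ (2 * (E * k)).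
  exact: lt_le_trans gEk.
rewrite ltNge; apply/negP => /(ler_wpM2l (ltW (exprn_gt0 k g0))) /le_trans /(_ gp).
apply/negP; rewrite -ltNge -exprM; apply: lt_le_trans (_ : 2 ^+ (3 * n ^ 2 - (3 * al + 2 * n) * k) <= _).
  by rewrite ltr_eXn2l ?ltr1n //; lia.
apply: le_trans (_ : 2 ^+ (3 * n ^ 2 - (3 * al + 2 * n) * k) *
    (g ^+ k * 2 ^+ ((3 * al + 2 * n) * k) * eps ^+ (2 * (E * k))) <= _).
  by rewrite -[leLHS]mulr1 ler_pM2l // exprn_gt0.
rewrite [leLHS](_ : _ = g ^+ k * (2 ^+ (3 * n ^ 2) * eps ^+ (2 * (E * k)))); last first.
  have -> : (2 ^+ (3 * n ^ 2) = 2 ^+ (3 * n ^ 2 - (3 * al + 2 * n) * k) * 2 ^+ ((3 * al + 2 * n) * k) :> R).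
    by rewrite -exprD subnK //; lia.
  by ring.
by rewrite ler_pM2l ?exprn_gt0 // ler_pM2l // exprn_gt0.
Qed.

(** The number [k] of basis vectors is the integer nearest to [M / (2 * L)] with
    [L = l + 1]. *)
Lemma parameters (n l : nat) (M : R) (m := (Num.trunc M).+1) : M < n%:R -> (1 <= l)%N ->
  4 * l%:R < M -> 8 < M ->
  exists k : nat, [/\ (0 < k)%N, (k * l.+1 < m)%N, (m <= n)%N, (k * (l + 5) < 3 * n)%N &
    M ^+ 2 / (4 * (l%:R + 1)) <=
      (2 * ((n - k * l.+1 - (n - m).+1) * k))%:R].
Proof.
move=> Mn l1 lM M8; set L : R := l%:R + 1.
have l1R : (1 : R) <= l%:R by rewrite ler1n.
have L2 : 2 <= L by rewrite /L; lra.
have L0 : 0 < L by lra.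
have M0 : 0 <= M by lra.
have /andP[tM Mt] := truncn_itv M0.
have y0 : 0 <= M / (2 * L) + 2^-1 by rewrite addr_ge0 // divr_ge0 //; lra.
pose k := Num.trunc (M / (2 * L) + 2^-1).
have /andP[k1 k2] := truncn_itv y0; rewrite -/k in k1 k2.
have ML : M / (2 * L) * (2 * L) = M by rewrite divfK // gt_eqF //; lra.
have L20 : 0 < 2 * L by lra.
have h1 : 2 * k%:R * L <= M + L.
  have : k%:R * (2 * L) <= (M / (2 * L) + 2^-1) * (2 * L) by rewrite ler_pM2r.
  by rewrite [(_ + 2^-1) * _]mulrDl ML; lra.
have h2 : M - L <= 2 * k%:R * L.
  have : (M / (2 * L) + 2^-1) * (2 * L) <= k.+1%:R * (2 * L) by rewrite ler_pM2r // ltW.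
  by rewrite [(_ + 2^-1) * _]mulrDl ML -[k.+1%:R]natr1; lra.
have LM : L < M / 4 + 1 by rewrite /L; lra.
have TE : (k * l.+1)%:R = k%:R * L :> R by rewrite natrM -natr1.
have Tt : (k * l.+1 <= Num.trunc M)%N.
  by rewrite truncn_ge_nat // TE; lra.
have mn : (m <= n)%N by rewrite /m truncn_lt_nat.
have k0 : (0 < k)%N.
  by rewrite truncn_gt0 -(ler_pM2r L20) [(_ + 2^-1) * _]mulrDl ML; lra.
exists k; split => //.
  rewrite -(ltr_nat R) !natrM natrD.
  have kM : 4 * k%:R <= M + 2.
    have : k%:R * 2 <= k%:R * L by rewrite ler_wpM2l.
    have : (L - 2) * (M - 4) >= 0 by rewrite mulr_ge0 //; lra.
    have : 0 <= (k%:R : R) by [].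
    have : k%:R * 2 * L <= M + L by lra.
    by nra.
  have -> : k%:R * (l%:R + 5%:R) = k%:R * L + 4 * k%:R :> R by rewrite /L; ring.
  by lra.
have -> : (n - k * l.+1 - (n - m).+1 = Num.trunc M - k * l.+1)%N 
  by move: mn Tt; rewrite /m; move: (Num.trunc M) (k * l.+1)%N => a b; clear; lia.
rewrite [leRHS](_ : _ = 2 * k%:R * ((Num.trunc M)%:R - k%:R * L)); last first.
  by rewrite natrM natrM natrB // TE; ring.
apply: le_trans (_ : 2 * k%:R * (M - 1 - k%:R * L) <= _).
  have L4 : 4 * (L - 1) < M by rewrite /L; lra.
  have kL : - L <= 2 * k%:R * L - M <= L by apply/andP; split; lra.
  exact: exponent_lower.
apply: ler_wpM2l; first by rewrite mulr_ge0.
by rewrite -[(Num.trunc M).+1%:R]natr1 in Mt; lra.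
Qed.
End Tuning.

(** * The tail bound *)

(** A count exceeds [M] exactly when it exceeds the integral part of [M]. *)
Lemma not_spreadP (R : realType) (n : nat) (beta eps : R) (g : unitary R n) :
  0 <= (1 - beta) * n%:R ->
  ~ spread beta eps g <-> exists t, ((Num.trunc ((1 - beta) * n%:R)).+1 <=
    count (mem (circle_arc t (2 * eps))) (eigenvalues g))%N.
Proof.
move=> M0; split.
  move=> /existsNP[t /negP]; rewrite -ltNge => h; exists t.
  by rewrite truncn_lt_nat.
by move=> [t]; rewrite truncn_lt_nat // ltNge => /negP h /(_ t).
Qed.

Section WordMap.
Variables (R : realType) (n r : nat) (w : word r).

Definition word_map (g : utuple R n r) : unitary R n := eval_word w (fun i => tnth g i).

Lemma measurable_word_map : measurable_fun setT word_map.
Proof.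
apply: measurable_unitary.
apply: (mmeas_ext (A := fun g => word_mx g w)); last first.
  by apply: mmeas_word; exact: measurable_id.
by move=> g; rewrite /word_map word_mx_eval.
Qed.
End WordMap.

Theorem theorem4p1 (R : realType) (r : nat) (w : word r) (l : nat) (beta : R)
    (n : nat) (d : measure_display) (Omega : measurableType d)
    (P : probability Omega R) (G : 'I_r -> {RV P >-> unitary R n}) (eps : R) :
  (1 <= r)%N ->
  reduced w -> size w = l -> (1 <= l)%N ->
  0 < beta < 1 ->
  mutually_independent G ->
  (forall i, is_haar (distribution P (G i))) ->
  0 < eps ->
  Num.max (4 * l%:R / (1 - beta)) (Num.max (8 / (1 - beta)) 16) < n%:R ->
  (P [set omega | ~ spread beta eps (eval_word w (fun i => G i omega))]
   < (2 ^+ (3 * n ^ 2)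
      * eps `^ (n%:R ^+ 2 * (1 - beta) ^+ 2 / (4 * (l%:R + 1))))%:E)%E.
Proof.
move=> r1 w_red <- l1 /andP[b0 b1] indep haar e0.
rewrite !gt_max => /and3P[n4 n8 n16].
have b10 : 0 < 1 - beta by rewrite subr_gt0.
pose M : R := (1 - beta) * n%:R.
have n0 : (0 < n)%N by rewrite -(ltr_nat R); lra.
have nR : 0 < (n%:R : R) by rewrite ltr0n.
have M0 : 0 <= M by rewrite mulr_ge0 // ltW.
have Mn : M < n%:R by rewrite -[ltRHS]mul1r ltr_pM2r //; lra.
have M4 : 4 * (size w)%:R < M by rewrite /M [(1 - beta) * _]mulrC -ltr_pdivrMr.
have M8 : 8 < M by rewrite /M [(1 - beta) * _]mulrC -ltr_pdivrMr.
have [k [k0 km mn kl xE]] := parameters Mn l1 M4 M8.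
set m := (Num.trunc M).+1 in km mn xE.
have -> : n%:R ^+ 2 * (1 - beta) ^+ 2 = M ^+ 2 by rewrite mulrC -exprMn.
set x := M ^+ 2 / _ in xE *.
pose clustered := [set g : unitary R n |
  exists t, (m <= count (mem (circle_arc t (2 * eps))) (eigenvalues g))%N].
pose X := @word_map R n r w @^-1` clustered.
have mX : measurable X.
  rewrite -[X]setTI; apply: measurable_word_map => //.
  exact: measurable_clustered.
have -> : [set omega | ~ spread beta eps (eval_word w (fun i => G i omega))] =
    joint G @^-1` X.
  apply/seteqP; split => omega; rewrite /X /= /word_map;
    rewrite (_ : (fun i => tnth (joint G omega) i) = (fun i => G i omega)).
  - by move=> /(not_spreadP _ _ M0).
  - by apply/funext => i; rewrite tnth_mktuple.
  - by move=> /(not_spreadP _ _ M0).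
  - by apply/funext => i; rewrite tnth_mktuple.
have mXj : measurable (joint G @^-1` X).
  by rewrite -[X in measurable X]setTI; exact: measurable_joint.
(* For [eps >= 1] the bound exceeds 1, so [eps] can be assumed small. *)
have [e1|e1] := leP 1 eps.
  apply: le_lt_trans (probability_le1 P mXj) _; rewrite lte_fin.
  have h1 : 1 <= eps `^ x.
    by rewrite -(powRr0 eps) ler_powR // divr_ge0 ?sqr_ge0 // mulr_ge0 // addr_ge0.
  apply: lt_le_trans (_ : 2 ^+ (3 * n ^ 2) <= _).
    have n3 : (3 * n ^ 2 != 0)%N by rewrite -lt0n muln_gt0 expn_gt0 n0.
    by rewrite exprn_egt1 // ltr1n.
  by rewrite -[leLHS]mulr1 ler_pM2l // exprn_gt0.
pose i0 : 'I_r := Ordinal r1.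
have a0 : 0 < eps ^+ 2 by rewrite exprn_gt0.
have a4 : eps ^+ 2 <= 4 by have : eps ^+ 2 <= 1 by [rewrite expr_le1 ?ltW // ltW]; lra.
have hX g : X g -> exists2 z : R[i], complex.Re z ^+ 2 + complex.Im z ^+ 2 = 1 &
    nearly_null m (eps ^+ 2) (word_mx g w - z%:M).
  move=> [t mt]; exists (cos (t + eps) +i* sin (t + eps))%C; first exact: cos2Dsin2.
  by rewrite word_mx_eval; apply: arc_nearly_null => //; exact: unitary_mxP.
have kln : (k * (size w).+1 <= n)%N by exact: ltnW (leq_trans km mn).
have nm : (n - m < n - k * (size w).+1)%N.
  by rewrite ltn_sub2l // (leq_trans km).
pose al := (n - k * (size w).+1)%N.
have bound := prob_nearly_null (joint_law_invariant indep haar) i0 w_red l1 k0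
  kln nm a0 a4 mX hX.
rewrite joint_lawE -/al in bound.
have Pfin : P (joint G @^-1` X) \is a fin_num by exact: fin_num_measure.
move: bound; rewrite -(fineK Pfin) -EFinM lee_fin lte_fin => bound.
exact: (tail_lt n0 kl e0 e1 xE bound).
Qed.
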